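(* Let $r$ be the roof function and let $\phi=-\kappa r$ with $\kappa>3$. Then for the Markov map $\sigma:X\to X$ defined on the Rauzy gasket there exists an invariant Gibbs measure with potential $\phi$, and this measure is unique.
   Context: **Induction and coding.** For a vector $l=(l_1,l_2,l_3)$ with positive coordinates whose largest coordinate $l_i$ is strictly greater than the sum of the other two, one simple step of the Rauzy induction (with winner $i$) replaces $l_i$ by $l_i-\sum_{j\ne i}l_j$ and keeps the other coordinates. The Rauzy gasket $G$ is the set of $l$ with $l_i>0$, $l_1+l_2+l_3=1$, for which the simple step can be applied infinitely many times (the coordinates of such $l$ are automatically distinct). An accelerated step is the composition of the maximal number $n$ of consecutive simple steps having the same winner. The code of $l$ is $(\tau,n)$, where $\tau=(\tau_1,\tau_2,\tau_3)$ lists the indices so that $l_{\tau_1}>l_{\tau_2}>l_{\tau_3}$, and $n$ is the number of simple steps in the accelerated step applied to $l$. The admissible transitions are $(\tau,n)\to(\tau',n')$ with $\tau'\in\{(\tau_2,\tau_1,\tau_3),(\tau_2,\tau_3,\tau_1)\}$ and $n,n'\ge1$ arbitrary. A path is a finite admissible sequence $\gamma=((\tau^1,n_1),\dots,(\tau^k,n_k))$; its winners are $\tau^1_1,\dots,\tau^k_1$; it is complete if each of $1,2,3$ occurs among its winners. Let $B_{(\tau,n)}$ be the $3\times3$ matrix equal to the identity plus entries $n$ at positions $(j,\tau_1)$, $j\neq\tau_1$, and $B_\gamma=B_{(\tau^k,n_k)}\cdots B_{(\tau^1,n_1)}$. If the successive codes of $l$ begin with $\gamma$, then $k$ accelerated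 steps send $l$ to $(B_\gamma^T)^{-1}l$. **First return map, roof function.** Fix a complete path $\gamma_*$ and let $\Delta_{\gamma_*}$ be the set of $l\in G$ whose sequence of codes (under renormalized accelerated steps, i.e. accelerated steps followed by division by the sum of the coordinates) begins with $\gamma_*$. Let $X\subset\Delta_{\gamma_*}$ be the set of points returning to $\Delta_{\gamma_*}$ infinitely often under the renormalized accelerated steps. For $l\in X$ let $\gamma(l)$ be the path followed up to the first return, $\sigma:X\to X$ the first return map, and $r(l)=-\log\|(B_{\gamma(l)}^T)^{-1}l\|$ the roof function, with $\|v\|=\sum|v_i|$. The map $\sigma$ is coded as a countable Markov shift whose symbols are the first-return paths: $l\mapsto(\gamma(l),\gamma(\sigma l),\dots)$; cylinders are taken with respect to this coding. **Gibbs measure.** A $\sigma$-invariant Borel probability measure $m$ is a Gibbs measure for $\phi$ if there are constants $Q\ge1$ and $P\in\mathbb R$ such that for every nonempty cylinder $[i_0\cdots i_{n-1}]$ and every $x$ in it, $Q^{-1}\le m[i_0\cdots i_{n-1}]\,e^{-\Phi_n(x)+nP}\le Q$, where $\Phi_n=\sum_{k=0}^{n-1}\phi\circ\sigma^k$. *)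

(* Defs.v *)
From HB Require Import structures.
From mathcomp Require Export all_boot all_order all_fingroup all_algebra.
From mathcomp Require Export all_classical all_reals all_analysis.

Set Implicit Arguments.
Unset Strict Implicit.
Unset Printing Implicit Defensive.

Export Order.TTheory GRing.Theory Num.Theory.
Export numFieldNormedType.Exports.

Local Open Scope classical_set_scope.
Local Open Scope ring_scope.

(* Coordinates are numbered 0, 1, 2, and vectors are column vectors.
   A code is a pair (tau, n), where the permutation tau lists the coordinates
   tau 0, tau 1, tau 2 in decreasing order of their values. *)
Definition code : Type := ('S_3 * nat)%type.

Definition winner_of (c : code) : 'I_3 := c.1 0.

Definition listing (tau : 'S_3) : seq 'I_3 := [:: tau 0; tau 1; tau 2].

Definition admissible (c c' : code) : bool :=
  listing c'.1 \in [:: [:: c.1 1; c.1 0; c.1 2]; [:: c.1 1; c.1 2; c.1 0]].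

Definition is_path (g : seq code) : bool :=
  [&& g != [::], all (fun c : code => (0 < c.2)%N) g & sorted admissible g].

Definition complete_path (g : seq code) : bool :=
  [forall i : 'I_3, i \in [seq winner_of c | c <- g]].

Section Dynamics.
Context {R : realType}.
Implicit Types (l : 'cV[R]_3) (g : seq code).

Definition l1norm l : R := \sum_i `|l i 0|.

Definition dominates l (i : 'I_3) : bool :=
  [forall j, 0 < l j 0] && (\sum_(j | j != i) l j 0 < l i 0).

(* At most one coordinate dominates; the default value is irrelevant on the
   vectors to which the simple step applies. *)
Definition winner l : 'I_3 := odflt ord0 [pick i | dominates l i].

Definition simple_step l : 'cV[R]_3 :=
  \col_i (if i == winner l then l i 0 - \sum_(j | j != i) l j 0 else l i 0).

Definition gasket : set 'cV[R]_3 :=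
  [set l : 'cV[R]_3 | [/\ forall i, 0 < l i 0, \sum_i l i 0 = 1
             & forall n : nat, exists i, dominates (iter n simple_step l) i]].

(* The last two conditions say that c.2 is the maximal number of consecutive
   simple steps having the same winner as the first one. *)
Definition is_code l (c : code) : Prop :=
  [/\ l (c.1 1) 0 < l (c.1 0) 0,
      l (c.1 2) 0 < l (c.1 1) 0,
      forall k : nat, (k < c.2)%N -> dominates (iter k simple_step l) (c.1 0)
    & ~~ dominates (iter c.2 simple_step l) (c.1 0)].

Definition code_of l : code := xget (1%g, 0%N) [set c | is_code l c].

Definition accel_step l : 'cV[R]_3 := iter (code_of l).2 simple_step l.

Definition renorm_step l : 'cV[R]_3 :=
  (\sum_i accel_step l i 0)^-1 *: accel_step l.

Definition codes l (n : nat) : seq code :=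
  mkseq (fun k => code_of (iter k renorm_step l)) n.

Definition Bcode (c : code) : 'M[R]_3 :=
  1%:M + \matrix_(i, j)
    (if (j == winner_of c) && (i != winner_of c) then c.2%:R else 0).

Definition Bpath g : 'M[R]_3 := foldl (fun M c => Bcode c *m M) 1%:M g.

Definition Delta g : set 'cV[R]_3 :=
  [set l : 'cV[R]_3 | gasket l /\ codes l (size g) = g].

Definition return_domain g : set 'cV[R]_3 :=
  [set l : 'cV[R]_3 | Delta g l /\
    forall N : nat, exists2 k, (N < k)%N & Delta g (iter k renorm_step l)].

Definition is_return_time g l (k : nat) : Prop :=
  [/\ (0 < k)%N, Delta g (iter k renorm_step l)
    & forall j, (0 < j < k)%N -> ~ Delta g (iter j renorm_step l)].

Definition return_time g l : nat := xget 0%N [set k | is_return_time g l k].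

Definition return_path g l : seq code := codes l (return_time g l).

(* The first return map of return_domain g, extended arbitrarily outside. *)
Definition return_map g l : 'cV[R]_3 := iter (return_time g l) renorm_step l.

Definition roof g l : R :=
  - ln (l1norm (invmx (Bpath (return_path g l))^T *m l)).

Definition cylinder g (w : seq (seq code)) : set 'cV[R]_3 :=
  [set l : 'cV[R]_3 | return_domain g l /\
    mkseq (fun k => return_path g (iter k (return_map g) l)) (size w) = w].

Definition birkhoff_sum g (phi : 'cV[R]_3 -> R) (n : nat) l : R :=
  \sum_(k < n) phi (iter k (return_map g) l).

End Dynamics.

Definition borelR3 (R : realType) := g_sigma_algebraType (@open 'cV[R]_3).

(* Borel probability measures on return_domain g are represented by Borel
   probability measures on R^3 giving it mass 1 (it is a Borel set). *)
Definition carried (R : realType) (g : seq code)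
    (m : probability (borelR3 R) R) : Prop :=
  m (return_domain g) = 1%E.

Definition invariant (R : realType) (g : seq code)
    (m : probability (borelR3 R) R) : Prop :=
  forall A : set (borelR3 R), measurable A ->
    m (return_domain g `&` return_map g @^-1` A) = m A.

Definition gibbs_bounds (R : realType) (g : seq code)
    (phi : 'cV[R]_3 -> R) (m : probability (borelR3 R) R) : Prop :=
  exists Q P : R, 1 <= Q /\
    forall (w : seq (seq code)) (x : 'cV[R]_3),
      (0 < size w)%N -> cylinder g w x ->
      ((Q^-1)%:E <=
         m (cylinder g w) *
           (expR (- birkhoff_sum g phi (size w) x + (size w)%:R * P))%:E
       <= Q%:E)%E.

Definition gibbs_measure (R : realType) (g : seq code)
    (phi : 'cV[R]_3 -> R) (m : probability (borelR3 R) R) : Prop :=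
  [/\ carried g m, invariant g m & gibbs_bounds g phi m].

(* Main.v *)
(* The first return map is a full shift over the countable set of return words.
   The cylinders of points are nested cones, contracted by the positive matrix
   of the complete path, so every sequence of return words has a unique point and
   the Birkhoff sums on the cylinder of [u] are, up to a constant, the logarithm
   of the weight [a u = |A_u|^(- kappa)], which is quasi-multiplicative:
   [a (u ++ w)] is comparable to [a u * a w].

   The weight has finite sum over the return words when [kappa >= 3]: a
   triangle of area proportional to [1 / (s_0 s_1 s_2)], with [s] the column sums
   of the matrix, contains its three images as disjoint triangles of the same
   form, so disjoint cylinders have bounded total area, and the cylinder of a
   return word of norm [N] has area at least of order [N^-3].

   For a summable quasi-multiplicative weight, averaging the masses of [u ++ v]
   and [v ++ u] over [v] with a Banach limit gives a Gibbs weight consistent on both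
   sides, that is, a shift invariant measure. It is transported to the gasket from
   Lebesgue measure on the unit interval through interval coding. Two Gibbs
   measures have the same pressure, hence bounded mutual density; this density is
   constant since quasi-multiplicativity makes distant symbols almost
   independent. *)

From HB Require Import structures.
Require Import Defs.
From mathcomp Require Import ring lra zify.

Set Implicit Arguments.
Unset Strict Implicit.
Unset Printing Implicit Defensive.

Local Open Scope classical_set_scope.
Local Open Scope ring_scope.

(** The alphabet of return words is infinite, so a limit of averaged measures could lose mass. The
    limit is therefore taken of numbers, the masses of words, and [lim_esum] moves it through the
    infinite sums over letters because all terms are dominated by a fixed multiple of the summable
    weight. Averaging on the right comes first, so that right consistency can be inherited by the
    average on the left.

    The weight is controlled only up to multiplicative constants, so uniqueness does not go through
    an eigenfunction of a transfer operator; it follows the second moment of the density on longer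
    and longer words.

    The area estimate concerns the open cones around the cylinders rather than the gasket itself. *)

(** * Banach limits *)

Lemma ultra_fmap (S T : Type) (f : S -> T) (F : set_system S) :
  UltraFilter F -> UltraFilter (f @ F).
Proof.
move=> FU; split; first exact: fmap_proper_filter.
move=> G GP FG; apply/seteqP; split=> // A GA.
have [//|FnA] := in_ultra_setVsetC (f @^-1` A) FU.
have GnA : G (~` A) by apply: FG.
case: (@filter_not_empty _ G _); rewrite -(setICr A).
exact: (@filterI _ G _ _ _ GA GnA).
Qed.

Section BanachLimit.
Context {R : realType}.
Implicit Types u v : nat -> R.

Definition bounded_seq u := exists M : R, forall n, `|u n| <= M.

(** Linearity, order and shift invariance are asked on bounded sequences only: elsewhere [lim] may
    be a junk value. *)
Definition banach_limit (L : (nat -> R) -> R) : Prop :=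
  [/\ forall c, L (fun=> c) = c,
      forall u v, bounded_seq u -> bounded_seq v ->
        L (fun n => u n + v n) = L u + L v,
      forall c u, bounded_seq u -> L (fun n => c * u n) = c * L u,
      forall u v, bounded_seq u -> bounded_seq v ->
        (forall n, u n <= v n) -> L u <= L v
    & forall u, bounded_seq u -> L (fun n => u n.+1) = L u].

Definition cesaro u (n : nat) : R := n.+1%:R^-1 * \sum_(i < n.+1) u i.

Lemma cesaro_bounded u (M : R) :
  (forall n, `|u n| <= M) -> forall n, `|cesaro u n| <= M.
Proof.
move=> uM n; rewrite normrM ger0_norm ?invr_ge0// mulrC ler_pdivrMr//.
apply: le_trans (ler_norm_sum _ _ _) _.
apply: (@le_trans _ _ (\sum_(i < n.+1) M)); first exact: ler_sum.
by rewrite sumr_const card_ord mulr_natr lexx.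
Qed.

(** The limit of Cesaro means along an ultrafilter finer than [\oo]; it exists by compactness of a
    segment. The means of [u] and of its shift differ by [(u n.+1 - u 0) / n.+1], whence shift
    invariance. *)
Lemma exists_banach_limit : exists L, banach_limit L.
Proof.
have [U [UU sU]] := @ultraFilterLemma nat \oo _.
have cvgU u : bounded_seq u -> cvg (u @ U).
  move=> [M uM]; have := @segment_compact R (- M) M.
  rewrite compact_ultra => /(_ _ (ultra_fmap u UU)) [|l [_ ul]]; last first.
    by apply/cvg_ex; exists l.
  apply: (@filterS _ U _ setT); last exact: filterT.
  by move=> n _ /=; have := uM n; rewrite ler_norml in_itv.
have ces u : bounded_seq u -> bounded_seq (cesaro u).
  by move=> [M uM]; exists M; exact: cesaro_bounded.
pose L u := lim (cesaro u @ U).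
have cv u : bounded_seq u -> cesaro u @ U --> L u.
  by move=> bu; apply/cvgU/ces.
have LE u l : cesaro u @ U --> l -> L u = l by move=> ul; apply: cvg_lim.
exists L; split.
- move=> c; apply: LE; rewrite (_ : cesaro _ = fun=> c); first exact: cvg_cst.
  apply/funext => n; rewrite /cesaro sumr_const card_ord -[c *+ _]mulr_natl.
  by rewrite mulKf.
- move=> u v bu bv; apply: LE.
  rewrite (_ : cesaro _ = fun n => cesaro u n + cesaro v n).
    by apply: cvgD; exact: cv.
  by apply/funext => n; rewrite /cesaro big_split mulrDr.
- move=> c u bu; apply: LE.
  rewrite (_ : cesaro _ = fun n => c * cesaro u n).
    by apply: cvgMr; exact: cv.
  by apply/funext => n; rewrite /cesaro -mulr_sumr mulrCA.
- move=> u v bu bv uv; apply: ler_cvg_to (cv _ bu) (cv _ bv) _.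
  apply: filterE => n; rewrite /cesaro ler_wpM2l ?invr_ge0//.
  by apply: ler_sum.
- move=> u bu; apply: LE.
  rewrite (_ : cesaro _ = fun n => cesaro u n + n.+1%:R^-1 * (u n.+1 - u 0%N)).
    rewrite -[L u]addr0; apply: cvgD; first exact: cv.
    apply: (cvg_trans (G := (fun n => n.+1%:R^-1 * (u n.+1 - u 0%N)) @ \oo)).
      by move=> A; exact: sU.
    have [M uM] := bu.
    apply/cvgr0Pnorm_le => e e0; near=> n.
    rewrite normrM ger0_norm ?invr_ge0// mulrC ler_pdivrMr//.
    apply: (@le_trans _ _ (M + M)).
      by apply: le_trans (ler_normB _ _) _; apply: lerD.
    rewrite mulrC -ler_pdivrMr//; near: n.
    have := @nbhs_infty_ger R ((M + M) / e).
    by apply: filterS => n /= /le_trans; apply; rewrite ler_nat.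
  apply/funext => n; rewrite /cesaro -mulrDr; congr (_ * _).
  rewrite [in RHS]big_ord_recl big_ord_recr/= addrAC addrC; congr (_ + _).
  by rewrite addrC subrK.
Unshelve. all: by end_near.
Qed.

End BanachLimit.

(** * Sums over words *)

Section ESum.
Context {R : realType}.
Local Open Scope ereal_scope.

Lemma esumZl (T : choiceType) (I : set T) (c : R) (a : T -> \bar R) :
  (0 <= c)%R -> (forall i, I i -> 0 <= a i) ->
  \esum_(i in I) (c%:E * a i) = c%:E * \esum_(i in I) a i.
Proof.
have le (d : R) (b : T -> \bar R) : (0 <= d)%R -> (forall i, I i -> 0 <= b i) ->
    \esum_(i in I) (d%:E * b i) <= d%:E * \esum_(i in I) b i.
  move=> d0 b0; apply: ge_ereal_sup => _ [X [finX XI] <-].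
  rewrite fsbig_finite// big_seq -ge0_sume_distrr; last first.
    by move=> i; rewrite in_fset_set// inE => /XI/b0.
  by rewrite -big_seq -fsbig_finite// lee_wpmul2l ?lee_fin//; apply: esum_ge; exists X.
move=> c0 a0; apply/eqP; rewrite eq_le le//=.
have [->|cN0] := eqVneq c 0%R.
  by rewrite mul0e esum_ge0// => i _; rewrite mul0e.
have {}c0 : (0 < c)%R by rewrite lt_neqAle eq_sym cN0.
(* The reverse inequality is the one just proved, for [c^-1] and the summand [c%:E * a i]. *)
have := @le c^-1%R (fun i => c%:E * a i) _ _.
rewrite invr_ge0 ltW// => /(_ isT).
have -> : (\esum_(i in I) (c^-1%:E * (c%:E * a i))) = \esum_(i in I) a i.
  by apply: eq_esum => i Ii; rewrite muleA -EFinM mulVf ?mul1e// gt_eqF.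
have c0e : 0 <= c%:E by rewrite lee_fin ltW.
move=> /(_ (fun i Ii => mule_ge0 c0e (a0 i Ii))) /(lee_wpmul2l c0e).
by rewrite muleA -EFinM divff ?mul1e// gt_eqF.
Qed.

Lemma esum_exchange (S T : choiceType) (I : set S) (J : set T)
    (a : S -> T -> \bar R) : (forall i j, 0 <= a i j) ->
  \esum_(i in I) \esum_(j in J) a i j = \esum_(j in J) \esum_(i in I) a i j.
Proof.
move=> a0; rewrite esum_esum// esum_esum//.
rewrite (reindex_esum (J `*`` (fun=> I)) _ (fun p => (p.2, p.1)))//.
split=> //.
- by move=> [i j] [/= ? ?]; split.
- by move=> [i j] [k l] _ _ [-> ->].
- by move=> [i j] [/= Ii Jj]; exists (j, i).
Qed.

Lemma esum_ge1 (T : choiceType) (I : set T) (a : T -> \bar R) (i : T) :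
  (forall j, I j -> 0 <= a j) -> I i -> a i <= \esum_(j in I) a j.
Proof.
move=> a0 Ii; apply: esum_ge; exists [set i]; last by rewrite fsbig_set1.
by split; [exact: finite_set1|move=> _ ->].
Qed.

Lemma esum_lty_fin (T : choiceType) (I : set T) (a : T -> \bar R) :
  (forall j, I j -> 0 <= a j) -> \esum_(j in I) a j < +oo ->
  \esum_(j in I) a j \is a fin_num.
Proof. by move=> a0 fin; rewrite ge0_fin_numE// esum_ge0. Qed.

End ESum.

Section Words.
Context {R : realType} {T : choiceType}.
Implicit Types (f g : seq T -> \bar R).
Local Open Scope ereal_scope.

Definition words (n : nat) : set (seq T) := [set u | size u = n].

Definition wsum (n : nat) f : \bar R := \esum_(u in words n) f u.

Lemma wsum_ge0 n f : (forall u, 0 <= f u) -> 0 <= wsum n f.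
Proof. by move=> f0; apply: esum_ge0. Qed.

Lemma le_wsum n f g : (forall u, f u <= g u) -> wsum n f <= wsum n g.
Proof. by move=> fg; apply: le_esum. Qed.

Lemma eq_wsum n f g : (forall u, f u = g u) -> wsum n f = wsum n g.
Proof. by move=> fg; apply: eq_esum. Qed.

Lemma wsumD n f g : (forall u, 0 <= f u) -> (forall u, 0 <= g u) ->
  wsum n (fun u => f u + g u) = wsum n f + wsum n g.
Proof. by move=> f0 g0; apply: esumD. Qed.

Lemma wsumZ n (c : R) f : (0 <= c)%R -> (forall u, 0 <= f u) ->
  wsum n (fun u => c%:E * f u) = c%:E * wsum n f.
Proof. by move=> c0 f0; apply: esumZl. Qed.

Lemma wsum0 f : 0 <= f [::] -> wsum 0 f = f [::].
Proof.
move=> f0; rewrite /wsum (_ : words 0 = [set [::]]) ?esum_set1//.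
by apply/seteqP; split=> [u /size0nil|u ->].
Qed.

Lemma wsum_cat n k f : (forall u, 0 <= f u) ->
  wsum (n + k) f = wsum n (fun u => wsum k (fun w => f (u ++ w))).
Proof.
move=> f0; rewrite /wsum esum_esum//.
rewrite (reindex_esum (words n `*`` (fun=> words k)) _ (fun p => p.1 ++ p.2))//.
split.
- by move=> [u w] [/= un wk]; rewrite /words/= size_cat un wk.
- move=> [u w] [u' w'] /=; rewrite !inE => -[/= un wk] [/= un' wk'] /eqP.
  by rewrite eqseq_cat ?un// => /andP[/eqP-> /eqP->].
- move=> u; rewrite /words/= => un; exists (take n u, drop n u).
    by split; rewrite /words/= ?size_take ?size_drop ?un ?addKn//; case: ltnP; lia.
  by rewrite cat_take_drop.
Qed.

Lemma wsum1 f : (forall u, 0 <= f u) -> wsum 1 f = \esum_(b in setT) f [:: b].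
Proof.
move=> f0; rewrite /wsum (reindex_esum setT _ (fun b => [:: b]))//.
split=> //; first by move=> b c _ _ [].
by move=> [|b [|]]//= _; exists b.
Qed.

Lemma wsum_cons n f : (forall u, 0 <= f u) ->
  wsum n.+1 f = \esum_(b in setT) wsum n (fun u => f (b :: u)).
Proof.
move=> f0; rewrite -add1n wsum_cat// wsum1// => u; exact: wsum_ge0.
Qed.

Lemma wsum_rcons n f : (forall u, 0 <= f u) ->
  wsum n.+1 f = wsum n (fun u => \esum_(b in setT) f (rcons u b)).
Proof.
move=> f0; rewrite -addn1 wsum_cat//; apply: eq_wsum => u.
by rewrite wsum1//; apply: eq_esum => b _; rewrite cats1.
Qed.

Lemma wsum_exchange n k (F : seq T -> seq T -> \bar R) :
  (forall u w, 0 <= F u w) ->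
  wsum n (fun u => wsum k (F u)) = wsum k (fun w => wsum n (F^~ w)).
Proof. by move=> F0; exact: esum_exchange. Qed.

Lemma wsum_ge_term n f u : (forall u, 0 <= f u) -> size u = n -> f u <= wsum n f.
Proof. by move=> f0 un; apply: esum_ge1. Qed.

End Words.

Section Lim.
Context {R : realType} (L : (nat -> R) -> R) (hL : banach_limit L).
Implicit Types u v : nat -> R.

Lemma bounded_seqI (u : nat -> R) (M : R) :
  (forall n, 0 <= u n <= M) -> bounded_seq u.
Proof.
by move=> uM; exists M => n; have /andP[u0 ?] := uM n; rewrite ger0_norm.
Qed.

Lemma lim_bounds (u : nat -> R) (c M : R) : (forall n, c <= u n <= M) ->
  c <= L u <= M.
Proof.
move=> uM; have [Lc _ _ Lle _] := hL.
have b c' : bounded_seq (fun=> c' : R) by exists `|c'|.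
have bu : bounded_seq u.
  exists (`|c| + `|M|) => n; have /andP[c1 c2] := uM n.
  rewrite ler_norml; apply/andP; split.
    by have := ler_normr c (-c); have := normr_ge0 M; have := ler_norm (- c); rewrite normrN; lra.
  by have := normr_ge0 c; have := ler_norm M; lra.
apply/andP; split.
  by rewrite -{1}[c]Lc; apply: Lle => // n; have /andP[] := uM n.
by rewrite -[M in _ <= M]Lc; apply: Lle => // n; have /andP[] := uM n.
Qed.

Lemma bounded_seqD u v : bounded_seq u -> bounded_seq v ->
  bounded_seq (fun n => u n + v n).
Proof.
move=> [M uM] [N vN]; exists (M + N) => n.
by apply: le_trans (ler_normD _ _) _; apply: lerD.
Qed.

Lemma bounded_seqZ c u : bounded_seq u -> bounded_seq (fun n => c * u n).
Proof.
move=> [M uM]; exists (`|c| * M) => n.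
by rewrite normrM ler_wpM2l.
Qed.

Lemma bounded_seq_sum (I : Type) (r : seq I) (P : pred I) (F : I -> nat -> R) :
  (forall i, bounded_seq (F i)) -> bounded_seq (fun n => \sum_(i <- r | P i) F i n).
Proof.
move=> bF; elim: r => [|i r IH].
  by exists 0 => n; rewrite big_nil normr0.
have [Pi|nPi] := boolP (P i).
  rewrite (_ : (fun n => _) = fun n => F i n + \sum_(i <- r | P i) F i n).
    exact: bounded_seqD.
  by apply/funext => n; rewrite big_cons Pi.
rewrite (_ : (fun n => _) = fun n => \sum_(i <- r | P i) F i n)//.
by apply/funext => n; rewrite big_cons (negbTE nPi).
Qed.

Lemma lim_sum (I : Type) (r : seq I) (P : pred I) (F : I -> nat -> R) :
  (forall i, bounded_seq (F i)) ->
  L (fun n => \sum_(i <- r | P i) F i n) = \sum_(i <- r | P i) L (F i).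
Proof.
have [Lc LD _ _ _] := hL.
move=> bF; elim: r => [|i r IH].
  by rewrite big_nil -[RHS]Lc; congr L; apply/funext => n; rewrite big_nil.
rewrite big_cons; have [Pi|nPi] := boolP (P i).
  rewrite (_ : (fun n => _) = fun n => F i n + \sum_(i <- r | P i) F i n).
    by rewrite LD ?IH//; exact: bounded_seq_sum.
  by apply/funext => n; rewrite big_cons Pi.
rewrite -IH; congr L; apply/funext => n.
by rewrite big_cons (negbTE nPi).
Qed.

Lemma lim_shift k u : bounded_seq u -> L (fun n => u (k + n)%N) = L u.
Proof.
have [_ _ _ _ Ls] := hL.
move=> [M uM]; elim: k => [//|k IH]; rewrite -IH -[RHS]Ls; last by exists M.
by congr L; apply/funext => n; rewrite addSnnS.
Qed.

Lemma lim_ge0_near k u : bounded_seq u -> (forall n, (k <= n)%N -> 0 <= u n) ->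
  0 <= L u.
Proof.
move=> [M uM] u0; rewrite -(@lim_shift k); last by exists M.
suff /andP[] : 0 <= L (fun n => u (k + n)%N) <= M by [].
apply: (@lim_bounds _ 0 M) => n; rewrite u0 ?leq_addr//=.
by apply: le_trans (ler_norm _) (uM _).
Qed.

(** Dominated convergence for a functional that is only finitely additive: a finite set [X] carries
    the sum of [M] up to [e], so the tails of all the sums of [x n] are at most [e] at once, and
    only finite sums over [X] are exchanged with [L]. *)
Lemma lim_esum (T : choiceType) (x : nat -> T -> R) (M : T -> R) :
  (forall n b, 0 <= x n b <= M b) -> (\esum_(b in setT) (M b)%:E < +oo)%E ->
  (\esum_(b in setT) (L (x^~ b))%:E =
   (L (fun n => fine (\esum_(b in setT) (x n b)%:E)))%:E)%E.
Proof.
move=> xM Mfin.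
have x0 n b : 0 <= x n b by have /andP[] := xM n b.
have M0 b : 0 <= M b by have /andP[] := xM 0%N b; exact: le_trans.
have xn n b : x n b <= M b by have /andP[] := xM n b.
have bx b : bounded_seq (x^~ b) by apply: (@bounded_seqI _ (M b)).
have L0 b : 0 <= L (x^~ b).
  by have /andP[] := @lim_bounds (x^~ b) 0 (M b) (fun n => xM n b).
have Sfin n : (\esum_(b in setT) (x n b)%:E)%E \is a fin_num.
  apply: esum_lty_fin => [b _|]; first by rewrite lee_fin.
  by apply: le_lt_trans Mfin; apply: le_esum => b _; rewrite lee_fin.
have Mf : (\esum_(b in setT) (M b)%:E)%E \is a fin_num.
  by apply: esum_lty_fin => // b _; rewrite lee_fin.
have bS : bounded_seq (fun n => fine (\esum_(b in setT) (x n b)%:E)%E).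
  apply: (@bounded_seqI _ (fine (\esum_(b in setT) (M b)%:E)%E)) => n.
  rewrite fine_ge0/=; last by apply: esum_ge0 => b _; rewrite lee_fin.
  by rewrite fine_le//; apply: le_esum => b _; rewrite lee_fin.
have [Lc LD _ Lle _] := hL.
apply/eqP; rewrite eq_le; apply/andP; split.
  apply: ge_ereal_sup => _ [X [finX _] <-].
  rewrite fsbig_finite//= sumEFin lee_fin -lim_sum//.
  apply: Lle => //; first exact: bounded_seq_sum.
  move=> n; rewrite -lee_fin fineK// -sumEFin.
  by apply: esum_ge; exists X => //; rewrite fsbig_finite.
apply/lee_addgt0Pr => e e0.
have : exists2 X, fsets setT X &
    (\esum_(b in setT) (M b)%:E - e%:E < \sum_(b \in X) (M b)%:E)%E.
  have := @ub_ereal_sup_adherent R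
    [set (\sum_(b \in A) (M b)%:E)%E | A in fsets setT] e e0 Mf.
  by move=> [_ [X sX <-] h]; exists X.
move=> [X [finX XT] hX].
have fX : finite_set X by [].
have tail n : (\esum_(b in setT) (x n b)%:E <= \sum_(b \in X) (x n b)%:E + e%:E)%E.
  rewrite (esumID X)/=; last by move=> b _; rewrite lee_fin.
  rewrite !setTI esum_fset//; last by move=> b _; rewrite lee_fin.
  rewrite leeD2l//; apply: (@le_trans _ _ (\esum_(b in ~` X) (M b)%:E)%E).
    by apply: le_esum => b _; rewrite lee_fin.
  move: hX; rewrite (esumID X)/=; last by move=> b _; rewrite lee_fin.
  rewrite !setTI esum_fset//; last by move=> b _; rewrite lee_fin.
  have fX1 : (\sum_(b \in X) (M b)%:E)%E \is a fin_num.
    by rewrite fsbig_finite//= sumEFin.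
  have fX2 : (\esum_(b in ~` X) (M b)%:E)%E \is a fin_num.
    apply: esum_lty_fin => [b _|]; first by rewrite lee_fin.
    apply: le_lt_trans Mfin; rewrite [leRHS](esumID X)/= => [|b _]; last by rewrite lee_fin.
    by rewrite !setTI leeDr// esum_ge0// => b _; rewrite lee_fin.
  rewrite -(fineK fX1) -(fineK fX2) -!EFinD lte_fin lee_fin; lra.
apply: (@le_trans _ _ (\sum_(b \in X) (L (x^~ b))%:E + e%:E)%E); last first.
  rewrite leeD2r//; apply: esum_ge; exists X => //.
rewrite fsbig_finite//= sumEFin -EFinD lee_fin -lim_sum// -[X in _ + X]Lc -LD//.
- apply: Lle => //.
    by apply: bounded_seqD; [exact: bounded_seq_sum|exists `|e|].
  by move=> n; rewrite -lee_fin fineK//; have := tail n;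
    rewrite fsbig_finite//= sumEFin.
- exact: bounded_seq_sum.
- by exists `|e|.
Qed.

End Lim.

(** Expanding [b (n * m)] in both ways shows that, for positive [n] and [m], every [(b n - D) / n]
    is below every [(b m + D) / m]; the supremum of the former separates the two families and serves
    as [P]. *)
Lemma almost_additive {R : realType} (b : nat -> R) (D : R) :
  (forall n m, `|b (n + m)%N - b n - b m| <= D) ->
  exists P : R, forall n, `|b n - n%:R * P| <= D.
Proof.
move=> bD.
have D0 : 0 <= D by apply: le_trans (bD 0%N 0%N).
have S k : k.+1%:R = k%:R + 1 :> R by rewrite natr1.
have up m n : b (n * m.+1)%N - m.+1%:R * b n <= m%:R * D.
  elim: m => [|m IH]; first by rewrite muln1 !mul1r subrr mul0r.
  have := bD n (n * m.+1)%N; rewrite -mulnS ler_norml => /andP[_].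
  by move: IH; rewrite !S; lra.
have lo m n : - (m%:R * D) <= b (n * m.+1)%N - m.+1%:R * b n.
  elim: m => [|m IH]; first by rewrite muln1 !mul1r subrr mul0r oppr0.
  have := bD n (n * m.+1)%N; rewrite -mulnS ler_norml => /andP[].
  by move: IH; rewrite !S; lra.
have key n m : (b n.+1 - D) / n.+1%:R <= (b m.+1 + D) / m.+1%:R.
  rewrite ler_pdivrMr// mulrAC ler_pdivlMr//.
  have := lo m n.+1; have := up n m.+1; rewrite mulnC.
  by rewrite !S; lra.
pose A := [set (b n.+1 - D) / n.+1%:R | n in @setT nat].
have hsA : has_sup A.
  split; first by exists ((b 1%N - D) / 1%:R), 0%N.
  by exists ((b 1%N + D) / 1%:R) => _ [n _ <-]; exact: key.
exists (sup A) => -[|n].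
  by rewrite mul0r subr0; have := bD 0%N 0%N; rewrite addn0 subrr sub0r normrN.
rewrite ler_norml; apply/andP; split.
  have : sup A <= (b n.+1 + D) / n.+1%:R.
    apply: ge_sup; first by have [] := hsA.
    by move=> _ [m _ <-]; exact: key.
  rewrite ler_pdivlMr// mulrC; lra.
have : (b n.+1 - D) / n.+1%:R <= sup A by apply: ub_le_sup; [have [] := hsA|exists n].
rewrite ler_pdivrMr// mulrC; lra.
Qed.

(** * Existence and uniqueness of Gibbs weights on words *)

Section Weights.
Context {R : realType} {T : choiceType}.
Implicit Types (a m r : seq T -> R).

Definition quasi_multiplicative (C : R) a : Prop :=
  forall u w, a (u ++ w) <= C * (a u * a w) /\ a u * a w <= C * a (u ++ w).

(** For masses of cylinders: additivity over the cylinders one letter longer. *)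
Definition right_consistent m : Prop :=
  forall v, (\esum_(b in setT) (m (rcons v b))%:E = (m v)%:E)%E.

(** For masses of cylinders: shift invariance, since the words [b :: v] code the preimage of the
    cylinder of [v]. *)
Definition left_consistent m : Prop :=
  forall v, (\esum_(b in setT) (m (b :: v))%:E = (m v)%:E)%E.

Section TotalWeight.
Context (a : seq T -> R) (C : R).
Hypotheses (a0 : forall u, 0 < a u) (qa : quasi_multiplicative C a).
Hypothesis (a1 : (\esum_(b in setT) (a [:: b])%:E < +oo)%E).

Let a_ge0 u : (0 <= (a u)%:E)%E. Proof. by rewrite lee_fin ltW. Qed.

Let C0 : 0 < C.
Proof.
have [_ h] := qa [::] [::].
have : 0 < C * a [::] by apply: lt_le_trans h; rewrite mulr_gt0.
by rewrite pmulr_lgt0.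
Qed.

Lemma wsum_cat_bounds n v :
  (C^-1%:E * ((a v)%:E * wsum n (fun u => (a u)%:E)) <=
    wsum n (fun u => (a (v ++ u))%:E) <=
   C%:E * ((a v)%:E * wsum n (fun u => (a u)%:E)))%E.
Proof.
rewrite !muleA -!EFinM -!wsumZ//; last 2 first.
- by rewrite mulr_ge0 ?invr_ge0 ?ltW.
- by rewrite mulr_ge0 ?invr_ge0 ?ltW.
apply/andP; split; apply: le_wsum => u; rewrite lee_fin -mulrA.
  by rewrite ler_pdivrMl//; have [] := qa v u.
by have [] := qa v u.
Qed.

Lemma wsum_cat_boundsl n v :
  (C^-1%:E * ((a v)%:E * wsum n (fun u => (a u)%:E)) <=
    wsum n (fun u => (a (u ++ v))%:E) <=
   C%:E * ((a v)%:E * wsum n (fun u => (a u)%:E)))%E.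
Proof.
rewrite !muleA -!EFinM -!wsumZ//; last 2 first.
- by rewrite mulr_ge0 ?invr_ge0 ?ltW.
- by rewrite mulr_ge0 ?invr_ge0 ?ltW.
apply/andP; split; apply: le_wsum => u; rewrite lee_fin -mulrA [a v * _]mulrC.
  by rewrite ler_pdivrMl//; have [] := qa u v.
by have [] := qa u v.
Qed.

Lemma wsum_fin n : wsum n (fun u => (a u)%:E) \is a fin_num.
Proof.
rewrite ge0_fin_numE ?wsum_ge0//.
elim: n => [|n IH]; first by rewrite wsum0// ltry.
rewrite -addn1 wsum_cat//.
have A1 : wsum 1 (fun u => (a u)%:E) \is a fin_num.
  by rewrite wsum1// ge0_fin_numE// esum_ge0.
apply: (@le_lt_trans _ _
  (wsum n (fun u => (C * fine (wsum 1 (fun u => (a u)%:E)))%:E * (a u)%:E)))%E.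
  apply: le_wsum => u; have /andP[_] := wsum_cat_bounds 1 u.
  by rewrite EFinM fineK// -muleA [((a u)%:E * _)%E]muleC.
have F0 : 0 <= fine (wsum 1 (fun u => (a u)%:E)) by rewrite fine_ge0// wsum_ge0.
rewrite wsumZ//; last by rewrite mulr_ge0// ltW.
by rewrite lte_mul_pinfty// lee_fin mulr_ge0// ltW.
Qed.

Definition total_weight n : R := fine (wsum n (fun u => (a u)%:E)).

Lemma total_weightE n : (total_weight n)%:E = wsum n (fun u => (a u)%:E).
Proof. by rewrite fineK// wsum_fin. Qed.

Context (b0 : T).

Lemma total_weight_gt0 n : 0 < total_weight n.
Proof.
rewrite -lte_fin total_weightE; apply: (@lt_le_trans _ _ (a (nseq n b0))%:E).
  by rewrite lte_fin.
by apply: (wsum_ge_term (f := fun u => (a u)%:E)); rewrite ?size_nseq.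
Qed.

Lemma total_weight_quasi n k :
  C^-1 * (total_weight n * total_weight k) <= total_weight (n + k) <=
  C * (total_weight n * total_weight k).
Proof.
have E (c : R) : 0 <= c -> (c * (total_weight n * total_weight k))%:E =
   wsum n (fun u => c%:E * ((a u)%:E * wsum k (fun u => (a u)%:E)))%E.
  have Zk := ltW (total_weight_gt0 k).
  move=> c0; rewrite !EFinM (total_weightE n) -[wsum k _]total_weightE.
  rewrite [(_ * (total_weight k)%:E)%E]muleC -wsumZ//.
  rewrite -wsumZ//; last by move=> u; rewrite mule_ge0// lee_fin.
  by apply: eq_wsum => u; congr (_ * _)%E; rewrite muleC.
have Ci : 0 <= C^-1 by rewrite invr_ge0 ltW.
have Cp := ltW C0.
by apply/andP; split; rewrite -lee_fin E// total_weightE wsum_cat//;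
  apply: le_wsum => u; have /andP[] := wsum_cat_bounds k u.
Qed.

(* Fekete's lemma for almost additive sequences gives the pressure [P] *)
Lemma pressure_exists : exists P, forall n,
  C^-1 <= total_weight n * expR (- (n%:R * P)) <= C.
Proof.
have [|P hP] := @almost_additive R (fun n => ln (total_weight n)) (ln C).
  move=> n m /=; have Z0 := total_weight_gt0.
  have /andP[h1 h2] := total_weight_quasi n m.
  rewrite -ler_ln ?posrE ?mulr_gt0 ?invr_gt0// in h1.
  rewrite !lnM ?posrE ?mulr_gt0 ?invr_gt0// lnV ?posrE// in h1.
  rewrite -ler_ln ?posrE ?mulr_gt0// !lnM ?posrE ?mulr_gt0// in h2.
  by rewrite ler_norml; apply/andP; split; lra.
exists P => n; have := hP n; have Z0 := total_weight_gt0 n.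
rewrite ler_norml /= => /andP[h1 h2].
by rewrite -ler_ln ?posrE ?invr_gt0 ?mulr_gt0 ?expR_gt0// -[_ <= C]ler_ln
  ?posrE ?mulr_gt0 ?expR_gt0//
  lnM ?posrE ?expR_gt0// expRK lnV ?posrE//; apply/andP; split; lra.
Qed.

End TotalWeight.

Section Averaging.
Context (a : seq T -> R) (C K : R).
Hypotheses (a0 : forall u, 0 < a u) (C0 : 0 < C) (qa : quasi_multiplicative C a).
Hypothesis (a1 : (\esum_(b in setT) (a [:: b])%:E < +oo)%E).
(** This is the conclusion of [pressure_exists] once the exponential factor has been absorbed into
    the weight. *)
Hypothesis (hK : forall n, K^-1 <= fine (wsum n (fun u => (a u)%:E)) <= K).
Context (L : (nat -> R) -> R) (hL : banach_limit L).

Let K0 : 0 < K.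
Proof.
have /andP[h1 h2] := hK 0; rewrite wsum0/= in h1 h2; last by rewrite lee_fin ltW.
exact: lt_le_trans h2.
Qed.

Definition comparable_to (B : R) f : Prop :=
  forall v, B^-1 * a v <= f v <= B * a v.

Lemma summable_right v : (\esum_(b in setT) (a (rcons v b))%:E < +oo)%E.
Proof.
apply: (@le_lt_trans _ _ (\esum_(b in setT) ((C * a v)%:E * (a [:: b])%:E))%E).
  by apply: le_esum => b _; rewrite lee_fin -mulrA -cats1; have [] := qa v [:: b].
rewrite esumZl//; last by move=> b _; rewrite lee_fin ltW.
  by rewrite lte_mul_pinfty// lee_fin mulr_ge0// ltW.
by rewrite mulr_ge0// ltW.
Qed.

Lemma summable_left v : (\esum_(b in setT) (a (b :: v))%:E < +oo)%E.
Proof.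
apply: (@le_lt_trans _ _ (\esum_(b in setT) ((C * a v)%:E * (a [:: b])%:E))%E).
  apply: le_esum => b _; rewrite lee_fin -mulrA [a v * _]mulrC.
  by have [] := qa [:: b] v.
rewrite esumZl//; last by move=> b _; rewrite lee_fin ltW.
  by rewrite lte_mul_pinfty// lee_fin mulr_ge0// ltW.
by rewrite mulr_ge0// ltW.
Qed.

Lemma summableZ (c : R) (g : T -> R) : 0 <= c -> (forall b, 0 <= g b) ->
  (\esum_(b in setT) (g b)%:E < +oo)%E ->
  (\esum_(b in setT) (c * g b)%:E < +oo)%E.
Proof.
move=> c0 g0 gfin; under eq_esum do rewrite EFinM.
rewrite esumZl//; last by move=> b _; rewrite lee_fin.
rewrite lte_mul_pinfty// lee_fin//.
Qed.

Section Comparable.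
Context (f : seq T -> R) (B : R) (B0 : 0 < B) (hf : comparable_to B f).

Lemma comparable_gt0 u : 0 < f u.
Proof.
have /andP[+ _] := hf u; apply: lt_le_trans.
by rewrite mulr_gt0// invr_gt0.
Qed.

Let f_ge0 u : (0 <= (f u)%:E)%E.
Proof. by rewrite lee_fin ltW// comparable_gt0. Qed.

Let Zfin n : wsum n (fun u => (a u)%:E) \is a fin_num.
Proof. exact: (wsum_fin a0 qa a1). Qed.

(** [e u] stands for [v ++ u] or [u ++ v], so one proof bounds the terms of both averages: [B] comes
    from [f], [C] from splitting the word, [K] from the total weight. *)
Lemma comparable_wsum (e : seq T -> seq T) n v :
  (C^-1%:E * ((a v)%:E * wsum n (fun u => (a u)%:E)) <=
    wsum n (fun u => (a (e u))%:E) <=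
   C%:E * ((a v)%:E * wsum n (fun u => (a u)%:E)))%E ->
  wsum n (fun u => (f (e u))%:E) \is a fin_num /\
  (B * C * K)^-1 * a v <= fine (wsum n (fun u => (f (e u))%:E)) <= B * C * K * a v.
Proof.
rewrite -(fineK (Zfin n)) -!EFinM => /andP[h1 h2].
have /andP[k1 k2] := hK n.
have lo : (((B * C * K)^-1 * a v)%:E <= wsum n (fun u => (f (e u))%:E))%E.
  apply: (@le_trans _ _ (wsum n (fun u => B^-1%:E * (a (e u))%:E))%E); last first.
    by apply: le_wsum => u; rewrite -EFinM lee_fin; have /andP[] := hf (e u).
  have Bi : 0 <= B^-1 by rewrite invr_ge0 ltW.
  rewrite wsumZ// => [|u]; last by rewrite lee_fin ltW.
  apply: le_trans (lee_wpmul2l _ h1); last by rewrite lee_fin.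
  rewrite -EFinM lee_fin !invfM -!mulrA ler_pM2l ?invr_gt0//.
  by rewrite ler_pM2l ?invr_gt0// mulrC ler_pM2l.
have up : (wsum n (fun u => (f (e u))%:E) <= (B * C * K * a v)%:E)%E.
  apply: (@le_trans _ _ (wsum n (fun u => B%:E * (a (e u))%:E))%E).
    by apply: le_wsum => u; rewrite -EFinM lee_fin; have /andP[] := hf (e u).
  rewrite wsumZ ?(ltW B0)// => [|u]; last by rewrite lee_fin ltW.
  apply: le_trans (lee_wpmul2l _ h2) _; first by rewrite lee_fin ltW.
  rewrite -EFinM lee_fin -!mulrA ler_pM2l//.
  by rewrite ler_pM2l// mulrC ler_pM2r.
have fin : wsum n (fun u => (f (e u))%:E) \is a fin_num.
  by rewrite ge0_fin_numE ?wsum_ge0// (le_lt_trans up)// ltry.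
by split=> //; rewrite -2!lee_fin fineK// lo up.
Qed.

Definition right_average v : R :=
  L (fun n => fine (wsum n (fun u => (f (v ++ u))%:E))).

Definition left_average v : R :=
  L (fun n => fine (wsum n (fun u => (f (u ++ v))%:E))).

Lemma right_average_comparable : comparable_to (B * C * K) right_average.
Proof.
move=> v; apply: (lim_bounds hL) => n.
by have [] := comparable_wsum (wsum_cat_bounds a0 qa n v).
Qed.

Lemma left_average_comparable : comparable_to (B * C * K) left_average.
Proof.
move=> v; apply: (lim_bounds hL) => n.
by have [] := comparable_wsum (wsum_cat_boundsl a0 qa n v).
Qed.

Let BCK0 : 0 < B * C * K. Proof. by rewrite !mulr_gt0. Qed.

Let rfin n v : wsum n (fun u => (f (v ++ u))%:E) \is a fin_num.
Proof. by have [] := comparable_wsum (wsum_cat_bounds a0 qa n v). Qed.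

Let lfin n v : wsum n (fun u => (f (u ++ v))%:E) \is a fin_num.
Proof. by have [] := comparable_wsum (wsum_cat_boundsl a0 qa n v). Qed.

Let rbnd n v : 0 <= fine (wsum n (fun u => (f (v ++ u))%:E)) <= B * C * K * a v.
Proof.
have [_ /andP[h1 ->]] := comparable_wsum (wsum_cat_bounds a0 qa n v).
by rewrite andbT fine_ge0// wsum_ge0.
Qed.

Let lbnd n v : 0 <= fine (wsum n (fun u => (f (u ++ v))%:E)) <= B * C * K * a v.
Proof.
have [_ /andP[h1 ->]] := comparable_wsum (wsum_cat_boundsl a0 qa n v).
by rewrite andbT fine_ge0// wsum_ge0.
Qed.

(** The words [rcons v b ++ u], over all [b] and all [u] of length [n], are the extensions of [v] by
    [n.+1] letters: the averaged sequence is shifted by one, which [L] does not see. *)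
Lemma right_average_consistent : right_consistent right_average.
Proof.
move=> v; rewrite /right_average.
rewrite (@lim_esum _ _ hL _ (fun n b => fine (wsum n (fun u => (f (rcons v b ++ u))%:E)))
  (fun b => B * C * K * a (rcons v b))); last 2 first.
- by move=> n b; exact: rbnd.
-
  by apply: summableZ (summable_right v); [exact: ltW|move=> b; exact: ltW].
have [_ _ _ _ Ls] := hL.
congr EFin.
rewrite -[RHS]Ls; last exact: (bounded_seqI (fun n => rbnd n v)).
congr L; apply/funext => n; rewrite wsum_cons//; congr fine.
apply: eq_esum => b _; rewrite fineK//.
by apply: eq_wsum => u; rewrite cat_rcons.
Qed.

Lemma left_average_consistent : left_consistent left_average.
Proof.
move=> v; rewrite /left_average.
rewrite (@lim_esum _ _ hL _ (fun n b => fine (wsum n (fun u => (f (u ++ b :: v))%:E)))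
  (fun b => B * C * K * a (b :: v))); last 2 first.
- by move=> n b; exact: lbnd.
-
  by apply: summableZ (summable_left v); [exact: ltW|move=> b; exact: ltW].
have [_ _ _ _ Ls] := hL.
congr EFin.
rewrite -[RHS]Ls; last exact: (bounded_seqI (fun n => lbnd n v)).
congr L; apply/funext => n; rewrite wsum_rcons//; congr fine.
rewrite /wsum esum_exchange//; apply: eq_esum => b _.
rewrite fineK; last exact: lfin.
by apply: eq_wsum => u; rewrite cat_rcons.
Qed.

(** Here consistency holds for every [n] before the limit, being inherited from [f]. *)
Lemma left_average_right_consistent :
  right_consistent f -> right_consistent left_average.
Proof.
move=> fr v; rewrite /left_average.
rewrite (@lim_esum _ _ hL _ (fun n b => fine (wsum n (fun u => (f (u ++ rcons v b))%:E)))
  (fun b => B * C * K * a (rcons v b))); last 2 first.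
- by move=> n b; exact: lbnd.
-
  by apply: summableZ (summable_right v); [exact: ltW|move=> b; exact: ltW].
congr EFin; congr L; apply/funext => n; congr fine.
rewrite (eq_esum (b := fun b => wsum n (fun u => (f (u ++ rcons v b))%:E))); last first.
  by move=> b _; rewrite fineK.
rewrite esum_exchange//; apply: eq_wsum => u.
by under eq_esum do rewrite -rcons_cat; exact: fr.
Qed.

End Comparable.

End Averaging.

(** The factor [z + z^-1] exceeds both [z] and [z^-1], whichever side of 1 the mass [z] lies on. *)
Lemma normalized_bounds (b x y z : R) : 0 < b -> 0 < x -> 0 < z ->
  b^-1 * x <= y <= b * x ->
  (b * (z + z^-1))^-1 * x <= z^-1 * y <= b * (z + z^-1) * x.
Proof.
move=> b0 x0 z0 /andP[h1 h2].
have im : 0 < z^-1 by rewrite invr_gt0.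
have s0 : 0 < z + z^-1 by exact: addr_gt0.
have zs : z <= z + z^-1 by rewrite lerDl ltW.
have zs' : z^-1 <= z + z^-1 by rewrite lerDr ltW.
apply/andP; split.
  rewrite invfM -mulrA mulrCA; apply: ler_pM => //.
  - by rewrite invr_ge0 ltW.
  - by rewrite mulr_ge0 ?invr_ge0 ?ltW.
  - by rewrite lef_pV2 ?posrE.
rewrite [b * _]mulrC -mulrA; apply: ler_pM => //; first exact: ltW.
by apply: le_trans h1; rewrite mulr_ge0 ?invr_ge0 ?ltW.
Qed.

Theorem gibbs_weight_exists a (C : R) (b0 : T) :
  (forall u, 0 < a u) -> quasi_multiplicative C a ->
  (\esum_(b in setT) (a [:: b])%:E < +oo)%E ->
  exists (m : seq T -> R) (P K : R),
    [/\ 0 < K, m [::] = 1, right_consistent m, left_consistent m &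
     forall u, K^-1 * (a u * expR (- ((size u)%:R * P))) <= m u <=
               K * (a u * expR (- ((size u)%:R * P)))].
Proof.
move=> a0 qa a1.
have [P hP] := pressure_exists a0 qa a1 b0.
(* Removing the pressure keeps the constant [C], the exponent being additive in the length, and puts
   the total weights between [C^-1] and [C]. *)
pose a' u := a u * expR (- ((size u)%:R * P)).
have a'0 u : 0 < a' u by rewrite mulr_gt0 ?expR_gt0.
have C0 : 0 < C.
  have [_ h] := qa [::] [::].
  have : 0 < C * a [::] by apply: lt_le_trans h; rewrite mulr_gt0.
  by rewrite pmulr_lgt0.
have qa' : quasi_multiplicative C a'.
  move=> u w; rewrite /a' size_cat natrD mulrDl opprD expRD.
  have [h1 h2] := qa u w.
  rewrite (_ : a u * _ * _ = a u * a w *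
    (expR (- ((size u)%:R * P)) * expR (- ((size w)%:R * P)))); last by ring.
  by split; rewrite [C * _]mulrA ler_pM2r// mulr_gt0// expR_gt0.
have W n : wsum n (fun u => (a' u)%:E) =
    ((expR (- (n%:R * P)))%:E * wsum n (fun u => (a u)%:E))%E.
  rewrite -wsumZ ?expR_ge0//; last by move=> u; rewrite lee_fin ltW.
  by apply: eq_esum => u /= <-; rewrite -EFinM mulrC.
have a'1 : (\esum_(b in setT) (a' [:: b])%:E < +oo)%E.
  have := wsum1 (f := fun u => (a' u)%:E) => <-; last by move=> u; rewrite lee_fin ltW.
  rewrite W -(total_weightE a0 qa a1) -EFinM ltry//.
have hK n : C^-1 <= fine (wsum n (fun u => (a' u)%:E)) <= C.
  by rewrite W -(total_weightE a0 qa a1) -EFinM mulrC; exact: hP.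
have [L hL] := @exists_banach_limit R.
have c1 : comparable_to a' 1 a' by move=> v; rewrite invr1 mul1r lexx.
pose nu := right_average L a'.
have c2 : comparable_to a' (1 * C * C) nu.
  exact: (right_average_comparable a'0 C0 qa' a'1 hK hL ltr01 c1).
have nur : right_consistent nu.
  exact: (right_average_consistent a'0 C0 qa' a'1 hK hL ltr01 c1).
have C20 : 0 < 1 * C * C by rewrite !mulr_gt0.
pose mu := left_average L nu.
pose B := 1 * C * C * C * C.
have c3 : comparable_to a' B mu.
  exact: (left_average_comparable a'0 C0 qa' a'1 hK hL C20 c2).
have mur : right_consistent mu.
  exact: (left_average_right_consistent a'0 C0 qa' a'1 hK hL C20 c2).
have mul : left_consistent mu.
  exact: (left_average_consistent a'0 C0 qa' a'1 hK hL C20 c2).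
have B0 : 0 < B by rewrite !mulr_gt0.
have mu0 u : 0 < mu u by exact: (comparable_gt0 a'0 B0 c3).
exists (fun u => (mu [::])^-1 * mu u), P, (B * (mu [::] + (mu [::])^-1)).
have im : 0 < (mu [::])^-1 by rewrite invr_gt0.
have imge := ltW im.
split.
- by rewrite mulr_gt0 ?(addr_gt0 _ im).
- by rewrite mulVf// gt_eqF.
- move=> v; under eq_esum do rewrite EFinM.
  rewrite esumZl ?mur//.
  by move=> b _; rewrite lee_fin ltW.
- move=> v; under eq_esum do rewrite EFinM.
  rewrite esumZl ?mul//.
  by move=> b _; rewrite lee_fin ltW.
move=> u; rewrite -/(a' u).
exact: normalized_bounds.
Qed.

End Weights.

(** * Uniqueness through second moments of the density *)

Section Uniqueness.
Context {R : realType} {T : choiceType}.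

Definition dsum n k (F : seq T -> seq T -> R) : \bar R :=
  wsum n (fun u => wsum k (fun w => (F u w)%:E)).

Lemma dsum_ge0 n k F : (forall u w, 0 <= F u w) -> (0 <= dsum n k F)%E.
Proof.
by move=> F0; apply: wsum_ge0 => u; apply: wsum_ge0 => w; rewrite lee_fin.
Qed.

Lemma dsumD n k F G : (forall u w, 0 <= F u w) -> (forall u w, 0 <= G u w) ->
  dsum n k (fun u w => F u w + G u w) = (dsum n k F + dsum n k G)%E.
Proof.
move=> F0 G0; rewrite /dsum -wsumD; last 2 first.
- by move=> u; apply: wsum_ge0 => w; rewrite lee_fin.
- by move=> u; apply: wsum_ge0 => w; rewrite lee_fin.
apply: eq_wsum => u; rewrite -wsumD//.
- by move=> w; rewrite lee_fin.
- by move=> w; rewrite lee_fin.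
Qed.

Lemma dsumZ n k c F : 0 <= c -> (forall u w, 0 <= F u w) ->
  dsum n k (fun u w => c * F u w) = (c%:E * dsum n k F)%E.
Proof.
move=> c0 F0; rewrite /dsum -wsumZ//; last first.
  by move=> u; apply: wsum_ge0 => w; rewrite lee_fin.
apply: eq_wsum => u; rewrite -wsumZ//.
by move=> w; rewrite lee_fin.
Qed.

Lemma le_dsum n k F G : (forall u w, F u w <= G u w) ->
  (dsum n k F <= dsum n k G)%E.
Proof.
by move=> FG; apply: le_wsum => u; apply: le_wsum => w; rewrite lee_fin.
Qed.

Lemma eq_dsum n k F G : (forall u w, F u w = G u w) -> dsum n k F = dsum n k G.
Proof.
by move=> FG; apply: eq_wsum => u; apply: eq_wsum => w; rewrite FG.
Qed.

Lemma dsum_exchange n k F : (forall u w, 0 <= F u w) ->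
  dsum n k F = dsum k n (fun w u => F u w).
Proof. by move=> F0; apply: wsum_exchange => u w; rewrite lee_fin. Qed.

Lemma dsum_cat n k (f : seq T -> R) : (forall u, 0 <= f u) ->
  dsum n k (fun u w => f (u ++ w)) = wsum (n + k) (fun u => (f u)%:E).
Proof. by move=> f0; rewrite wsum_cat// => u; rewrite lee_fin. Qed.

Lemma wsum_right_consistent k (m : seq T -> R) u : (forall u, 0 <= m u) ->
  right_consistent m -> wsum k (fun w => (m (u ++ w))%:E) = (m u)%:E.
Proof.
move=> m0 mr; elim: k => [|k IH].
  by rewrite wsum0 ?cats0// lee_fin.
rewrite wsum_rcons; last by move=> w; rewrite lee_fin.
rewrite -IH; apply: eq_wsum => w; rewrite -mr.
by apply: eq_esum => b _; rewrite rcons_cat.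
Qed.

Lemma wsum_left_consistent k (m : seq T -> R) w : (forall u, 0 <= m u) ->
  left_consistent m -> wsum k (fun u => (m (u ++ w))%:E) = (m w)%:E.
Proof.
move=> m0 ml; elim: k => [|k IH].
  by rewrite wsum0// lee_fin.
rewrite wsum_cons; last by move=> u; rewrite lee_fin.
rewrite /wsum esum_exchange; last by move=> b u; rewrite lee_fin.
rewrite -IH; apply: eq_esum => u _; rewrite -ml.
exact: eq_esum.
Qed.

Lemma dsum_left n k (m : seq T -> R) (f : seq T -> R) :
  (forall u, 0 <= m u) -> (forall u, 0 <= f u) -> left_consistent m ->
  dsum n k (fun u w => f w * m (u ++ w)) = wsum k (fun w => (f w * m w)%:E).
Proof.
move=> m0 f0 ml; rewrite dsum_exchange; last by move=> u w; rewrite mulr_ge0.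
apply: eq_wsum => w; rewrite EFinM -(wsum_left_consistent n w m0 ml) -wsumZ//.
by move=> u; rewrite lee_fin.
Qed.

Lemma dsum_right n k (m : seq T -> R) (f : seq T -> R) :
  (forall u, 0 <= m u) -> (forall u, 0 <= f u) -> right_consistent m ->
  dsum n k (fun u w => f u * m (u ++ w)) = wsum n (fun w => (f w * m w)%:E).
Proof.
move=> m0 f0 mr.
apply: eq_wsum => w; rewrite EFinM -(wsum_right_consistent k w m0 mr) -wsumZ//.
by move=> u; rewrite lee_fin.
Qed.

Lemma dsum_prod n k (f g : seq T -> R) :
  (forall u, 0 <= f u) -> (forall u, 0 <= g u) ->
  (wsum k (fun u => (g u)%:E) \is a fin_num)%E ->
  dsum n k (fun u w => f u * g w) =
  (wsum n (fun u => (f u)%:E) * wsum k (fun u => (g u)%:E))%E.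
Proof.
move=> f0 g0 gf; rewrite -(fineK gf) muleC -wsumZ; last 2 first.
- by rewrite fine_ge0// wsum_ge0// => u; rewrite lee_fin.
- by move=> u; rewrite lee_fin.
by apply: eq_wsum => u; rewrite fineK// muleC -wsumZ.
Qed.

Context (m r : seq T -> R) (K : R).
Hypotheses (K0 : 0 < K) (m0 : forall u, 0 < m u) (r0 : forall u, 0 <= r u)
  (m1 : m [::] = 1) (r1 : r [::] = 1)
  (mr : right_consistent m) (ml : left_consistent m)
  (rr : right_consistent r) (rl : left_consistent r)
  (rm : forall u, r u <= K * m u)
  (mm : forall u w, m u * m w <= K * m (u ++ w)).

Let mge0 u : 0 <= m u := ltW (m0 u).

Let mm0 u w : 0 <= m u * m w. Proof. exact: mulr_ge0. Qed.

Let h u := r u / m u.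

Let h0 u : 0 <= h u. Proof. by rewrite divr_ge0. Qed.

Let hm u : h u * m u = r u. Proof. by rewrite divfK// gt_eqF. Qed.

Let hK u : h u <= K. Proof. by rewrite ler_pdivrMr. Qed.

Let mtot n : wsum n (fun u => (m u)%:E) = 1%E.
Proof.
have := wsum_right_consistent n [::] mge0 mr; rewrite m1 => <-.
exact: eq_wsum.
Qed.

Let rtot n : wsum n (fun u => (r u)%:E) = 1%E.
Proof.
have := wsum_right_consistent n [::] r0 rr; rewrite r1 => <-.
exact: eq_wsum.
Qed.

(* [E n] is the second moment of the density [h = r / m] on cylinders of length
   [n]. It is bounded, while [E n > 1] would let it grow: the words [u ++ w] see
   [h u] and [h w] as almost independent, so their difference has a variance
   comparable to that of [h]. *)
Let E n := fine (wsum n (fun u => (h u * r u)%:E)).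

Let EK n : (wsum n (fun u => (h u * r u)%:E) <= K%:E)%E.
Proof.
rewrite -[K%:E]mule1 -(rtot n) -wsumZ ?(ltW K0)//.
by apply: le_wsum => u; rewrite -EFinM lee_fin ler_wpM2r.
Qed.

Let EE n : wsum n (fun u => (h u * r u)%:E) = (E n)%:E.
Proof.
rewrite fineK// ge0_fin_numE; last first.
  by apply: wsum_ge0 => u; rewrite lee_fin mulr_ge0.
by apply: le_lt_trans (EK n) _; rewrite ltry.
Qed.

Let EleK n : E n <= K. Proof. by have := EK n; rewrite EE lee_fin. Qed.

(** Under [m], [h w] is the conditional mean of [h (u ++ w)] given the last block, by left
    consistency of [r]; the increment is orthogonal to it. *)
Let diff_left n k :
  dsum n k (fun u w => (m (u ++ w) * (h (u ++ w) - h w) ^+ 2)%R) =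
  (E (n + k) - E k)%:E.
Proof.
(* The expanded square, with the cross term moved to the left to avoid subtracting extended reals.
   The cross sum and the last sum both reduce to [E k]. *)
have : (dsum n k (fun u w => (m (u ++ w) * (h (u ++ w) - h w) ^+ 2)%R) +
    2%:E * dsum n k (fun u w => (h w * r (u ++ w))%R) =
    dsum n k (fun u w => (h (u ++ w) * r (u ++ w))%R) +
    dsum n k (fun u w => (h w ^+ 2 * m (u ++ w))%R))%E.
  rewrite -dsumZ//; last by move=> u w; rewrite mulr_ge0.
  rewrite -!dsumD//; last first.
  - by move=> u w; rewrite mulr_ge0 ?ler0n// mulr_ge0.
  - by move=> u w; rewrite mulr_ge0// ?sqr_ge0.
  - by move=> u w; rewrite mulr_ge0 ?ler0n// mulr_ge0.
  - by move=> u w; rewrite mulr_ge0// ?sqr_ge0.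
  by apply: eq_dsum => u w; rewrite -hm; ring.
rewrite dsum_left// (@dsum_cat n k (fun u => h u * r u)); last first.
  by move=> u; rewrite mulr_ge0.
rewrite dsum_left// => [|u]; last exact: sqr_ge0.
rewrite (@eq_wsum _ _ k (fun w => (h w ^+ 2 * m w)%:E) (fun w => (h w * r w)%:E)); last first.
  by move=> u; rewrite -hm expr2 mulrA.
rewrite !EE; case: (dsum _ _ _) => [d| |]//.
  by rewrite -EFinM -!EFinD => -[e]; congr EFin; lra.
Qed.

Let diff_right n k :
  dsum n k (fun u w => (m (u ++ w) * (h (u ++ w) - h u) ^+ 2)%R) =
  (E (n + k) - E n)%:E.
Proof.
have : (dsum n k (fun u w => (m (u ++ w) * (h (u ++ w) - h u) ^+ 2)%R) +
    2%:E * dsum n k (fun u w => (h u * r (u ++ w))%R) =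
    dsum n k (fun u w => (h (u ++ w) * r (u ++ w))%R) +
    dsum n k (fun u w => (h u ^+ 2 * m (u ++ w))%R))%E.
  rewrite -dsumZ//; last by move=> u w; rewrite mulr_ge0.
  rewrite -!dsumD//; last first.
  - by move=> u w; rewrite mulr_ge0 ?ler0n// mulr_ge0.
  - by move=> u w; rewrite mulr_ge0// ?sqr_ge0.
  - by move=> u w; rewrite mulr_ge0 ?ler0n// mulr_ge0.
  - by move=> u w; rewrite mulr_ge0// ?sqr_ge0.
  by apply: eq_dsum => u w; rewrite -hm; ring.
rewrite dsum_right// (@dsum_cat n k (fun u => h u * r u)); last first.
  by move=> u; rewrite mulr_ge0.
rewrite dsum_right// => [|u]; last exact: sqr_ge0.
rewrite (@eq_wsum _ _ n (fun w => (h w ^+ 2 * m w)%:E) (fun w => (h w * r w)%:E)); last first.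
  by move=> u; rewrite -hm expr2 mulrA.
rewrite !EE; case: (dsum _ _ _) => [d| |]//.
  by rewrite -EFinM -!EFinD => -[e]; congr EFin; lra.
Qed.

(** For independent blocks of law [m] the mean square difference is the sum of the variances
    [E n - 1] and [E k - 1], as [h] has mean 1. *)
Let diff_prod n k :
  dsum n k (fun u w => (m u * m w * (h u - h w) ^+ 2)%R) = (E n + E k - 2)%:E.
Proof.
have : (dsum n k (fun u w => (m u * m w * (h u - h w) ^+ 2)%R) +
    2%:E * dsum n k (fun u w => (r u * r w)%R) =
    dsum n k (fun u w => (h u * r u * m w)%R) +
    dsum n k (fun u w => (m u * (h w * r w))%R))%E.
  rewrite -dsumZ//; last by move=> u w; rewrite mulr_ge0.
  rewrite -!dsumD//; last first.
  - by move=> u w; rewrite mulr_ge0 ?ler0n// mulr_ge0.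
  - by move=> u w; rewrite mulr_ge0// sqr_ge0.
  - by move=> u w; rewrite mulr_ge0 ?ler0n// mulr_ge0.
  - by move=> u w; rewrite mulr_ge0 ?ler0n// mulr_ge0.
  by apply: eq_dsum => u w; rewrite -!hm; ring.
rewrite (@dsum_prod n k r r) ?rtot//.
rewrite (@dsum_prod n k (fun u => h u * r u) m) ?mtot//; last first.
  by move=> u; rewrite mulr_ge0.
rewrite (@dsum_prod n k m (fun u => h u * r u)) ?mtot ?EE//; last first.
  by move=> u; rewrite mulr_ge0.
rewrite !mule1 mul1e; case: (dsum _ _ _) => [d| |]//.
by rewrite -!EFinD => -[e]; congr EFin; lra.
Qed.

Let E_ge1 n : 1 <= E n.
Proof.
suff : (0 <= (E n + E n - 2)%:E)%E by rewrite lee_fin; lra.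
rewrite -diff_prod; apply: dsum_ge0 => u w.
by rewrite mulr_ge0// sqr_ge0.
Qed.

(** The left side is the mean square of [h u - h w] for independent blocks. Passing to consecutive
    blocks costs [K] by [mm], and going through [h (u ++ w)] costs 2 by the parallelogram
    inequality. *)
Let E_double n : 2 * (E n - 1) <= 4 * K * (E (n + n) - E n).
Proof.
rewrite -lee_fin (_ : (2 * (E n - 1))%:E = (E n + E n - 2)%:E); last by congr EFin; ring.
rewrite -diff_prod (_ : (_ * _)%:E =
  ((2 * K)%:E * (dsum n n (fun u w => (m (u ++ w) * (h (u ++ w) - h w) ^+ 2)%R) +
   dsum n n (fun u w => (m (u ++ w) * (h (u ++ w) - h u) ^+ 2)%R)))%E); last first.
  by rewrite diff_left diff_right -EFinD -EFinM; congr EFin; ring.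
have p1 u w : 0 <= m (u ++ w) * (h (u ++ w) - h w) ^+ 2 by rewrite mulr_ge0// ?sqr_ge0.
have p2 u w : 0 <= m (u ++ w) * (h (u ++ w) - h u) ^+ 2 by rewrite mulr_ge0// ?sqr_ge0.
rewrite -dsumD// -dsumZ//; last 2 first.
- by rewrite mulr_ge0// ltW.
- by move=> u w; rewrite addr_ge0.
apply: le_dsum => u w.
apply: (@le_trans _ _ (K * m (u ++ w) * (h u - h w) ^+ 2)).
  by rewrite ler_wpM2r// sqr_ge0.
rewrite -subr_ge0 (_ : _ - _ = K * m (u ++ w) *
  ((h (u ++ w) - h w) + (h (u ++ w) - h u)) ^+ 2); last by ring.
by rewrite mulr_ge0 ?sqr_ge0// mulr_ge0// ltW.
Qed.

Let E1 n : E n = 1.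
Proof.
apply/eqP; rewrite eq_le E_ge1 andbT leNgt; apply/negP => En.
(* By [E_double] the excess [E k - 1] grows at least by the factor [1 + q] when [k] doubles. A lower
   bound linear in the number of doublings already contradicts the bound [K]. *)
pose q := (2 * K)^-1.
have q0 : 0 < q by rewrite invr_gt0 mulr_gt0.
have step k : (1 + q) * (E k - 1) <= E (k + k) - 1.
  have := E_double k; rewrite /q.
  have -> : 4 * K * (E (k + k) - E k) = 2 * (2 * K * (E (k + k) - E k)) by ring.
  rewrite ler_pM2l// mulrC -ler_pdivrMr ?mulr_gt0//; lra.
have it j : exists k, (1 + j%:R * q) * (E n - 1) <= E k - 1.
  elim: j => [|j [k hk]]; first by exists n; rewrite mul0r addr0 mul1r.
  exists (k + k)%N; apply: le_trans (step k).
  apply: (@le_trans _ _ ((1 + q) * ((1 + j%:R * q) * (E n - 1)))); last first.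
    by rewrite ler_pM2l// addr_gt0.
  rewrite mulrA ler_pM2r ?subr_gt0// -natr1.
  by have := mulr_ge0 (ler0n R j) (sqr_ge0 q); lra.
have [j hj] : exists j : nat, K / (q * (E n - 1)) < j%:R.
  exists (Num.bound (K / (q * (E n - 1)))).
  by apply: archi_boundP; rewrite divr_ge0 ?mulr_ge0 ?ltW// subr_gt0.
have [k hk] := it j.
have EK' := EleK k.
rewrite ltr_pdivrMr ?mulr_gt0 ?subr_gt0// in hj.
by have := mulr_ge0 (ltW q0) (ltW q0); nra.
Qed.

Theorem gibbs_weight_unique u : r u = m u.
Proof.
(* With an empty second block, the vanishing of a sum of squares forces [h u = h [::] = 1]. *)
have := diff_prod (size u) 0; rewrite !E1 => D.
have : ((m u * m [::] * (h u - h [::]) ^+ 2)%:E <= 0)%E.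
  have <- : (1 + 1 - 2)%:E = 0%E :> \bar R by congr EFin; ring.
  rewrite -D /dsum.
  have p (v w : seq T) : (0 <= (m v * m w * (h v - h w) ^+ 2)%:E)%E.
    by rewrite lee_fin mulr_ge0// sqr_ge0.
  apply: le_trans (wsum_ge_term (n := size u) (u := u) _ _) => //.
    by rewrite wsum0.
  by move=> v; apply: wsum_ge0.
rewrite lee_fin m1 mulr1 /h r1 m1 divr1 pmulr_rle0// => hh.
have : (r u / m u - 1) ^+ 2 = 0 by apply/eqP; rewrite eq_le hh sqr_ge0.
by move/eqP; rewrite sqrf_eq0 subr_eq0 => /eqP e; rewrite -[RHS]mul1r -e divfK// gt_eqF.
Qed.

End Uniqueness.

(** * The Rauzy induction in matrix form *)

Lemma ord3_forall (P : 'I_3 -> Prop) : P 0 -> P 1 -> P 2 -> forall i, P i.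
Proof.
move=> P0 P1 P2 [[|[|[|n]]] h] //.
- by rewrite (_ : Ordinal h = 0)//; exact: val_inj.
- by rewrite (_ : Ordinal h = 1)//; exact: val_inj.
- by rewrite (_ : Ordinal h = 2)//; exact: val_inj.
Qed.

Lemma perm3_forall (t : 'S_3) (P : 'I_3 -> Prop) :
  P (t 0) -> P (t 1) -> P (t 2) -> forall i, P i.
Proof.
move=> P0 P1 P2 i; rewrite -(permKV t i).
by move: ((t^-1)%g i); exact: ord3_forall.
Qed.

Lemma perm3_eq (s t : 'S_3) : s 0 = t 0 -> s 1 = t 1 -> s = t.
Proof.
move=> e0 e1; apply/permP; apply: ord3_forall => //.
have : s 2 != t 0 by rewrite -e0 (inj_eq perm_inj).
have : s 2 != t 1 by rewrite -e1 (inj_eq perm_inj).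
by elim/(@perm3_forall t): (s 2); rewrite ?eqxx.
Qed.

Lemma perm3_exists (i j : 'I_3) : i != j -> exists t : 'S_3, t 0 = i /\ t 1 = j.
Proof.
move=> ij; pose s : 'S_3 := tperm 0 i; pose s' : 'S_3 := tperm 1 (s j).
have s0 : s 0 = i by rewrite /s tpermL.
have sK : s (s j) = j by rewrite /s tpermK.
have s'1 : s' 1 = s j by rewrite /s' tpermL.
have s'0 : s' 0 = 0.
  by rewrite /s' tpermD//; apply: contraNneq ij => sj0; rewrite -s0 -sj0 sK.
by exists (s' * s)%g; rewrite !permM s'0 s'1.
Qed.

(** The two allowed listings are exactly those beginning with the second index, so a transition
    prescribes the next winner and nothing else. *)
Lemma admissibleE c c' : admissible c c' = (c'.1 0 == c.1 1).
Proof.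
rewrite /admissible /listing !inE !eqseq_cons !andbT.
have [e|] //= := eqVneq (c'.1 0) (c.1 1).
have n01 : c'.1 1 != c'.1 0 by rewrite (inj_eq perm_inj).
have n02 : c'.1 2 != c'.1 0 by rewrite (inj_eq perm_inj).
have n12 : c'.1 1 != c'.1 2 by rewrite (inj_eq perm_inj).
rewrite {}e in n01 n02; move: n01 n02 n12.
by elim/(@perm3_forall c.1): (c'.1 1); elim/(@perm3_forall c.1): (c'.1 2);
  rewrite ?eqxx ?orbT.
Qed.

Section Sums.
Context {R : realType}.

Lemma sum_perm3 (t : 'S_3) (f : 'I_3 -> R) :
  \sum_i f i = f (t 0) + f (t 1) + f (t 2).
Proof.
rewrite (reindex_inj (@perm_inj _ t)) /= !big_ord_recl big_ord0 addr0 addrA.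
by congr (f (t _) + f (t _) + f (t _)); exact: val_inj.
Qed.

Lemma sum3 (f : 'I_3 -> R) : \sum_i f i = f 0 + f 1 + f 2.
Proof. by rewrite (sum_perm3 1%g) !perm1. Qed.

Lemma sum_others (t : 'S_3) (f : 'I_3 -> R) :
  \sum_(j | j != t 0) f j = f (t 1) + f (t 2).
Proof.
have := sum_perm3 t f; rewrite (bigD1 (t 0))//= -addrA => /addrI.
exact.
Qed.

End Sums.

Section Steps.
Context {R : realType}.
Implicit Types (l v y : 'cV[R]_3) (c : code) (g : seq code).

Definition positive l : Prop := forall j, 0 < l j 0.

Lemma dominatesP l i :
  reflect (positive l /\ \sum_(j | j != i) l j 0 < l i 0) (dominates l i).
Proof.
apply: (iffP andP) => [[/forallP ? ?]|[? ?]]; split=> //.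
by apply/forallP.
Qed.

Lemma dominates_permP l (t : 'S_3) :
  reflect (positive l /\ l (t 1) 0 + l (t 2) 0 < l (t 0) 0) (dominates l (t 0)).
Proof. by rewrite -(sum_others t (fun j => l j 0)); exact: dominatesP. Qed.

Lemma dominates_uniq l i j : dominates l i -> dominates l j -> i = j.
Proof.
move=> di dj; apply/eqP; apply/negPn/negP => /perm3_exists [t [ti tj]].
move: di dj; rewrite -ti -tj => /dominates_permP [p h] /dominatesP[_].
rewrite (bigD1 (t 0))/=; last by rewrite (inj_eq perm_inj).
rewrite ltNge => /negP; apply; apply: (@le_trans _ _ (l (t 0) 0)).
  by have := p (t 2); lra.
by rewrite lerDl sumr_ge0// => k _; exact: ltW.
Qed.

Lemma winnerE l i : dominates l i -> winner l = i.
Proof.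
rewrite /winner => di; case: pickP => [j dj|/(_ i)]; last by rewrite di.
exact: dominates_uniq dj di.
Qed.

(** The inverse of an accelerated step with code [c]. *)
Definition act c v : 'cV[R]_3 := (Bcode c)^T *m v.

Lemma actE c v i : act c v i 0 = v i 0 +
  if i == winner_of c then c.2%:R * \sum_(j | j != winner_of c) v j 0 else 0.
Proof.
rewrite /act /Bcode linearD/= trmx1 mulmxDl mul1mx !mxE; congr (_ + _).
rewrite (eq_bigr (fun j => (if (i == winner_of c) && (j != winner_of c)
    then c.2%:R else 0) * v j 0)); last by move=> j _; rewrite !mxE.
case: ifPn => [_|iw]; last by apply: big1 => j _; rewrite mul0r.
rewrite mulr_sumr [RHS]big_mkcond; apply: eq_bigr => j _ /=.
by case: ifP => // _; rewrite mul0r.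
Qed.

Lemma act_perm0 t n v : act (t, n) v (t 0) 0 =
  v (t 0) 0 + n%:R * (v (t 1) 0 + v (t 2) 0).
Proof. by rewrite actE /winner_of/= eqxx (sum_others t (fun j => v j 0)). Qed.

Lemma act_perm (t : 'S_3) n v i : i != t 0 -> act (t, n) v i 0 = v i 0.
Proof. by rewrite actE /winner_of/= => /negbTE->; rewrite addr0. Qed.

Lemma act_perm1 t n v : act (t, n) v (t 1) 0 = v (t 1) 0.
Proof. by rewrite act_perm// (inj_eq perm_inj). Qed.

Lemma act_perm2 t n v : act (t, n) v (t 2) 0 = v (t 2) 0.
Proof. by rewrite act_perm// (inj_eq perm_inj). Qed.

Lemma colP_perm (t : 'S_3) l v : l (t 0) 0 = v (t 0) 0 ->
  l (t 1) 0 = v (t 1) 0 -> l (t 2) 0 = v (t 2) 0 -> l = v.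
Proof. by move=> h0 h1 h2; apply/colP; exact: (perm3_forall h0 h1 h2). Qed.

Lemma act0 t v : act (t, 0%N) v = v.
Proof.
by apply: (@colP_perm t); rewrite ?act_perm0 ?act_perm1 ?act_perm2 ?mul0r ?addr0.
Qed.

Lemma actD t m n v : act (t, m) (act (t, n) v) = act (t, (m + n)%N) v.
Proof.
apply: (@colP_perm t); rewrite ?act_perm0 ?act_perm1 ?act_perm2//.
by rewrite natrD mulrDl -addrA [_ * _ + _ * _]addrC.
Qed.

Lemma act_positive c v : positive v -> positive (act c v).
Proof.
move=> v0 i; rewrite actE ltr_wpDr//; case: ifP => // _.
by rewrite mulr_ge0// sumr_ge0// => j _; exact: ltW.
Qed.

Lemma act_dominates c v : positive v -> (0 < c.2)%N ->
  dominates (act c v) (winner_of c).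
Proof.
case: c => t [//|n] v0 _; apply/dominates_permP; split.
  exact: act_positive.
rewrite act_perm0 act_perm1 act_perm2 -natr1.
have := v0 (t 0); have := v0 (t 1); have := v0 (t 2).
have : 0 <= n%:R * (v (t 1) 0 + v (t 2) 0).
  by rewrite mulr_ge0// addr_ge0// ltW.
lra.
Qed.

Lemma simple_step_permE l (t : 'S_3) : dominates l (t 0) ->
  [/\ simple_step l (t 0) 0 = l (t 0) 0 - (l (t 1) 0 + l (t 2) 0),
      simple_step l (t 1) 0 = l (t 1) 0 & simple_step l (t 2) 0 = l (t 2) 0].
Proof.
move=> d; rewrite /simple_step !mxE (winnerE d) eqxx.
by rewrite (sum_others t (fun j => l j 0)) !(inj_eq perm_inj).
Qed.

Lemma simple_step_act t n v : positive v ->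
  simple_step (act (t, n.+1) v) = act (t, n) v.
Proof.
move=> v0; have [//|e0 e1 e2] := @simple_step_permE (act (t, n.+1) v) t.
  exact: (@act_dominates (t, n.+1)).
apply: (@colP_perm t); rewrite ?e0 ?e1 ?e2 ?act_perm0 ?act_perm1 ?act_perm2//.
by rewrite -natr1; ring.
Qed.

Lemma iter_simple_act t n k v : positive v -> (k <= n)%N ->
  iter k simple_step (act (t, n) v) = act (t, (n - k)%N) v.
Proof.
move=> v0; elim: k => [|k IH] kn; first by rewrite subn0.
rewrite iterS IH ?(ltnW kn)// (_ : (n - k)%N = (n - k.+1).+1); last by lia.
exact: simple_step_act.
Qed.

Lemma act_simple_step (t : 'S_3) l : dominates l (t 0) -> act (t, 1%N) (simple_step l) = l.
Proof.
move=> d; have [e0 e1 e2] := simple_step_permE d.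
apply: (@colP_perm t); rewrite ?act_perm0 ?act_perm1 ?act_perm2 ?e0 ?e1 ?e2//.
by ring.
Qed.

Lemma act_iter_simple (t : 'S_3) n l :
  (forall k, (k < n)%N -> dominates (iter k simple_step l) (t 0)) ->
  act (t, n) (iter n simple_step l) = l.
Proof.
elim: n => [|n IH] d; first by rewrite act0.
have -> w : act (t, n.+1) w = act (t, n) (act (t, 1%N) w) by rewrite actD addn1.
rewrite iterS act_simple_step ?IH//; last exact: d.
by move=> k kn; apply: d; exact: ltnW.
Qed.

(** Dominance of [c.1 1] in [v] serves twice: it orders the two losing coordinates of [act c v], and
    it stops the wins of [c.1 0] after exactly [c.2] steps. *)
Lemma is_code_act c v : dominates v (c.1 1) -> (0 < c.2)%N -> is_code (act c v) c.
Proof.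
case: c => t n /= d n0; have [v0 hd] := dominatesP _ _ d.
have hd2 : v (t 2) 0 < v (t 1) 0 /\ v (t 0) 0 < v (t 1) 0.
  move: hd; rewrite (bigD1 (t 0)) ?(inj_eq perm_inj)//=.
  rewrite (bigD1 (t 2)) ?(inj_eq perm_inj)//=.
  rewrite big1 ?addr0; last first.
    by apply: (@perm3_forall t); rewrite ?eqxx ?andbF.
  by have := v0 (t 2); have := v0 (t 0); lra.
have dom := @act_dominates (t, n) v v0 n0.
split=> /=.
- move: dom => /dominates_permP[p]; rewrite act_perm1 act_perm2.
  by have := v0 (t 2); lra.
- by rewrite act_perm1 act_perm2; case: hd2.
- move=> k kn; rewrite iter_simple_act// ?(ltnW kn)//.
  by apply: (@act_dominates (t, (n - k)%N)) => //=; rewrite subn_gt0.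
- rewrite iter_simple_act// subnn act0; apply/negP => /dominates_uniq/(_ d).
  by move/perm_inj.
Qed.

Lemma is_code_uniq l c c' : is_code l c -> is_code l c' -> c = c'.
Proof.
case: c c' => [t n] [t' n'] [/= a1 a2 a3 a4] [/= b1 b2 b3 b4].
have e : t = t'.
  move: a1 a2 b1 b2; clear.
  have n01 : t' 0 != t' 1 by rewrite (inj_eq perm_inj).
  have n02 : t' 0 != t' 2 by rewrite (inj_eq perm_inj).
  have n12 : t' 1 != t' 2 by rewrite (inj_eq perm_inj).
  move=> a1 a2 b1 b2.
  suff [] : t 0 = t' 0 /\ t 1 = t' 1 by exact: perm3_eq.
  move: n01 n02 n12 b1 b2;
  elim/(@perm3_forall t): (t' 0); elim/(@perm3_forall t): (t' 1);
  elim/(@perm3_forall t): (t' 2); rewrite ?eqxx//= => _ _ _ b1 b2;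
  first [by split | exfalso; lra].
rewrite {}e in a1 a2 a3 a4 *; congr (_, _).
case: (ltngtP n n') => // h.
- by move: a4; rewrite b3.
- by move: b4; rewrite a3.
Qed.

Lemma code_of_eq l c : is_code l c -> code_of l = c.
Proof.
move=> lc; rewrite /code_of; case: xgetP => [c' _ /= lc'|/(_ c)//].
exact: is_code_uniq lc' lc.
Qed.

Lemma code_of_act c v : dominates v (c.1 1) -> (0 < c.2)%N ->
  code_of (act c v) = c /\ accel_step (act c v) = v.
Proof.
move=> d c0; have e := code_of_eq (is_code_act d c0).
split=> //; rewrite /accel_step e; case: c {e c0} d => t n /= d.
rewrite iter_simple_act ?subnn ?act0//.
by have [] := dominatesP _ _ d.
Qed.

Definition inducible l : Prop := forall n, exists i, dominates (iter n simple_step l) i.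

Lemma inducible_positive l : inducible l -> positive l.
Proof. by move=> /(_ 0%N)[i /dominatesP[]]. Qed.

Lemma inducible_iter n l : inducible l -> inducible (iter n simple_step l).
Proof. by move=> h k; rewrite -iterD; exact: h. Qed.

(** A winner cannot win forever, since each win subtracts the same positive amount [s] while the
    other coordinates stay fixed. When [i] first fails to dominate, another index [j] does, and [j]
    becomes the second index of the code. *)
Lemma inducible_act l : inducible l -> exists c v,
  [/\ (0 < c.2)%N, l = act c v, inducible v & dominates v (c.1 1)].
Proof.
move=> hl; have [i di] := hl 0%N; rewrite /= in di.
have [k1 k12] : exists k : 'S_3, k 0 = i by exists (tperm 0 i); rewrite tpermL.
have : exists n, ~~ dominates (iter n simple_step l) i.
  apply: contrapT => /forallNP nd.
  have dd n : dominates (iter n simple_step l) (k1 0).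
    by rewrite k12; have /negP := nd n; rewrite negbK.
  have E n := act_iter_simple (fun k (_ : (k < n)%N) => dd k).
  pose s := l (k1 1) 0 + l (k1 2) 0.
  have p := inducible_positive hl.
  have s0 : 0 < s by rewrite addr_gt0.
  have [n hn] : exists n : nat, l (k1 0) 0 / s < n%:R.
    by exists (Num.bound (l (k1 0) 0 / s)); apply: archi_boundP; rewrite divr_ge0 ?ltW.
  have := E n; move: (dd n) => /dominatesP[pn _] En.
  have e1 : iter n simple_step l (k1 1) 0 = l (k1 1) 0.
    by rewrite -[in RHS]En act_perm1.
  have e2 : iter n simple_step l (k1 2) 0 = l (k1 2) 0.
    by rewrite -[in RHS]En act_perm2.
  have := act_perm0 k1 n (iter n simple_step l); rewrite En e1 e2 -/s.
  by move: hn; rewrite ltr_pdivrMr//; have := pn (k1 0); lra.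
move=> ex_n; case: (ex_minnP ex_n) => n' n'd n'min.
have n0 : (0 < n')%N by case: n' n'd {n'min} => //; rewrite /= di.
have [j dj] := hl n'.
have ij : i != j by apply: contraNneq n'd => ->.
have [t [ti tj]] := perm3_exists ij.
exists (t, n'), (iter n' simple_step l); split=> //=.
- rewrite act_iter_simple// => k kn; rewrite ti; apply: contraTT kn => /n'min.
  by rewrite -leqNgt.
- exact: inducible_iter.
- by rewrite tj.
Qed.

Lemma positiveZ a l : 0 < a -> positive l -> positive (a *: l).
Proof. by move=> a0 p i; rewrite mxE mulr_gt0. Qed.

Lemma dominatesZ a l i : 0 < a -> dominates (a *: l) i = dominates l i.
Proof.
move=> a0; rewrite /dominates; congr (_ && _).
  by apply: eq_forallb => j; rewrite mxE pmulr_rgt0.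
rewrite (eq_bigr (fun j => a * l j 0)); last by move=> j _; rewrite mxE.
by rewrite -mulr_sumr mxE ltr_pM2l.
Qed.

Lemma simple_stepZ a l : 0 < a -> simple_step (a *: l) = a *: simple_step l.
Proof.
move=> a0; have ew : winner (a *: l) = winner l.
  by rewrite /winner; congr odflt; apply: eq_pick => i; exact: dominatesZ.
apply/colP => i; rewrite !mxE ew; case: ifP => // _.
rewrite (eq_bigr (fun j => a * l j 0)); last by move=> j _; rewrite mxE.
by rewrite -mulr_sumr mulrBr.
Qed.

Lemma iter_simple_stepZ a l n : 0 < a ->
  iter n simple_step (a *: l) = a *: iter n simple_step l.
Proof. by move=> a0; elim: n => //= n ->; rewrite simple_stepZ. Qed.

Lemma code_ofZ a l : 0 < a -> code_of (a *: l) = code_of l.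
Proof.
move=> a0; rewrite /code_of; congr xget; apply/seteqP; split=> c /= [h1 h2 h3 h4].
  split.
  - by move: h1; rewrite !mxE ltr_pM2l.
  - by move: h2; rewrite !mxE ltr_pM2l.
  - by move=> k /h3; rewrite iter_simple_stepZ// dominatesZ.
  - by move: h4; rewrite iter_simple_stepZ// dominatesZ.
split.
- by rewrite !mxE ltr_pM2l.
- by rewrite !mxE ltr_pM2l.
- by move=> k /h3; rewrite iter_simple_stepZ// dominatesZ.
- by move: h4; rewrite iter_simple_stepZ// dominatesZ.
Qed.

Lemma renorm_stepZ a l : 0 < a -> renorm_step (a *: l) = renorm_step l.
Proof.
move=> a0; rewrite /renorm_step /accel_step code_ofZ// iter_simple_stepZ//.
move: (iter _ _ l) => v; rewrite (eq_bigr (fun i => a * v i 0)); last first.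
  by move=> i _; rewrite mxE.
by rewrite -mulr_sumr scalerA invfM mulrAC mulVf ?mul1r// gt_eqF.
Qed.

Lemma inducibleZ a l : 0 < a -> inducible l -> inducible (a *: l).
Proof.
by move=> a0 h n; have [i d] := h n; exists i; rewrite iter_simple_stepZ// dominatesZ.
Qed.

Lemma codes_rec l n : codes l n.+1 = code_of l :: codes (renorm_step l) n.
Proof.
rewrite /codes /mkseq /= (iotaDl 1 0) -map_comp; congr cons.
by apply: eq_map => k; rewrite /= -iterSr.
Qed.

Lemma codesZ a l n : 0 < a -> codes (a *: l) n = codes l n.
Proof.
by move=> a0; case: n => // n; rewrite !codes_rec code_ofZ// renorm_stepZ.
Qed.

Lemma size_codes l n : size (codes l n) = n.
Proof. exact: size_mkseq. Qed.

Lemma codes_cat l m n : codes l (m + n) = codes l m ++ codes (iter m renorm_step l) n.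
Proof.
elim: m l => // m IH l; rewrite addSn !codes_rec IH/=.
by rewrite -iterSr.
Qed.

End Steps.

(** By [admissibleE], the winner of every code that can follow [g]. *)
Definition next_winner (g : seq code) : 'I_3 := (last (1%g, 0%N) g).1 1.

Lemma is_path_cons c g : is_path (c :: g) =
  (0 < c.2)%N && (nilp g || admissible c (head c g) && is_path g).
Proof.
rewrite /is_path/=; case: g => [|c' g] /=; first by rewrite andbT.
by case: (0 < c.2)%N; case: (0 < c'.2)%N; case: (all _ g); case: (admissible c c').
Qed.

Lemma is_path_cat g h : g != [::] -> h != [::] -> is_path (g ++ h) =
  [&& is_path g, admissible (last (1%g, 0%N) g) (head (1%g, 0%N) h) & is_path h].
Proof.
case: g => // c g _; case: h => // c' h _.
rewrite /is_path/= all_cat/= cat_path/=.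
by case: (0 < c.2)%N; case: (0 < c'.2)%N; case: (all _ g); case: (all _ h);
  case: (path _ c g); case: (admissible (last c g) c').
Qed.

Lemma is_path_catl g h : is_path (g ++ h) -> g != [::] -> is_path g.
Proof.
move=> gh g0; have [h0|h0] := eqVneq h [::]; first by rewrite h0 cats0 in gh.
by move: gh; rewrite is_path_cat// => /and3P[].
Qed.

Lemma is_path_catr g h : is_path (g ++ h) -> h != [::] -> is_path h.
Proof.
move=> gh h0; have [g0|g0] := eqVneq g [::]; first by rewrite g0 in gh.
by move: gh; rewrite is_path_cat// => /and3P[].
Qed.

Lemma next_winner_cat g h : is_path (g ++ h) -> g != [::] -> h != [::] ->
  winner_of (head (1%g, 0%N) h) = next_winner g.
Proof.
move=> gh g0 h0; move: gh; rewrite is_path_cat// => /and3P[_ + _].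
by rewrite admissibleE => /eqP.
Qed.

Section Paths.
Context {R : realType}.
Implicit Types (l v y : 'cV[R]_3) (c : code) (g h : seq code).

Lemma Bpath_cat g h : Bpath (g ++ h) = Bpath h *m Bpath g :> 'M[R]_3.
Proof.
have fold (M : 'M[R]_3) s : foldl (fun M c => Bcode c *m M) M s = Bpath s *m M.
  rewrite /Bpath; elim/last_ind: s => [|s c IH]; first by rewrite mul1mx.
  by rewrite !foldl_rcons IH mulmxA.
by rewrite {1}/Bpath foldl_cat fold.
Qed.

Definition Apath g : 'M[R]_3 := (Bpath g)^T.

Lemma Apath_nil : Apath [::] = 1%:M.
Proof. by rewrite /Apath /Bpath/= trmx1. Qed.

Lemma Apath_cat g h : Apath (g ++ h) = Apath g *m Apath h.
Proof. by rewrite /Apath Bpath_cat trmx_mul. Qed.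

Lemma Apath_cons c g : Apath (c :: g) = (Bcode c)^T *m Apath g.
Proof. by rewrite -cat1s Apath_cat {1}/Apath /Bpath/= mulmx1. Qed.

Lemma Apath_act c g v : Apath (c :: g) *m v = act c (Apath g *m v).
Proof. by rewrite Apath_cons /act mulmxA. Qed.

Lemma act_inj c : injective (@act R c).
Proof.
case: c => t n v w e.
have e1 : v (t 1) 0 = w (t 1) 0 by rewrite -(act_perm1 t n v) e act_perm1.
have e2 : v (t 2) 0 = w (t 2) 0 by rewrite -(act_perm2 t n v) e act_perm2.
apply: (@colP_perm _ t) => //.
by have := act_perm0 t n v; rewrite e act_perm0 e1 e2 => /addIr.
Qed.

Lemma Apath_unit g : Apath g \in unitmx.
Proof.
rewrite -unitmx_tr -row_free_unit -kermx_eq0; apply/eqP/row_matrixP => i.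
rewrite row0; set k := row _ _.
have /sub_kermxP : (k <= kermx (Apath g)^T)%MS by exact: row_sub.
move/(congr1 trmx); rewrite trmx_mul trmxK trmx0 => e.
suff : k^T = 0 by move/(congr1 trmx); rewrite trmxK trmx0.
move: e; move: (k^T) => v {k i}; elim: g => [|c g IH].
  by rewrite Apath_nil mul1mx.
rewrite Apath_act => e; apply: IH; apply: (@act_inj c); rewrite e.
by rewrite /act mulmx0.
Qed.

Lemma Apath_positive g v : positive v -> positive (Apath g *m v).
Proof.
move=> v0; elim: g => [|c g IH]; first by rewrite Apath_nil mul1mx.
by rewrite Apath_act; exact: act_positive.
Qed.

Lemma Apath_dominates c g y : is_path (c :: g) ->
  dominates y (next_winner (c :: g)) -> dominates (Apath g *m y) (c.1 1).
Proof.
case: g => [|c' g]; first by rewrite Apath_nil mul1mx.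
rewrite is_path_cons/= => /and3P[_ + +] d.
rewrite admissibleE => /eqP <-; rewrite is_path_cons => /andP[c'0 _].
rewrite Apath_act; apply: act_dominates => //; apply: Apath_positive.
by have [] := dominatesP _ _ d.
Qed.

Lemma codes_Apath g y : is_path g -> dominates y (next_winner g) ->
  codes (Apath g *m y) (size g) = g /\
  exists2 a, 0 < a & iter (size g) renorm_step (Apath g *m y) = a *: y.
Proof.
elim: g => [//|c g IH] pg d.
have dg := Apath_dominates pg d.
have c0 : (0 < c.2)%N by move: pg; rewrite is_path_cons => /andP[].
have [e1 e2] := code_of_act dg c0.
have [v0 _] := dominatesP _ _ dg.
pose b := (\sum_i (Apath g *m y) i 0)^-1.
have b0 : 0 < b.
  by rewrite invr_gt0 (sum3 (fun i => (Apath g *m y) i 0)) !addr_gt0.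
have e3 : renorm_step (Apath (c :: g) *m y) = b *: (Apath g *m y).
  by rewrite /renorm_step Apath_act e2.
rewrite /= codes_rec e3 codesZ// Apath_act e1 -Apath_act -iterS iterSr e3.
have [g0|g0] := eqVneq g [::].
  by rewrite g0 /= Apath_nil mul1mx; split=> //; exists b.
have pg' : is_path g by apply: (is_path_catr (g := [:: c])).
have d' : dominates y (next_winner g) by move: d; case: (g) g0.
have [-> [a a0 ea]] := IH pg' d'; split=> //.
rewrite -size_eq0 in g0; move: ea; case: (size g) g0 => // m _.
by rewrite !iterSr renorm_stepZ// => ea; exists a.
Qed.

(** Each accelerated step of a path contains at least one simple step, so cones of long paths
    guarantee many simple steps. *)
Lemma iter_simple_Apath g y k : is_path g -> dominates y (next_winner g) ->
  (k <= size g)%N -> exists i, dominates (iter k simple_step (Apath g *m y)) i.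
Proof.
elim: g k => [//|c g IH] k pg d kg.
have dg := Apath_dominates pg d.
have c0 : (0 < c.2)%N by move: pg; rewrite is_path_cons => /andP[].
have [v0 _] := dominatesP _ _ dg.
rewrite Apath_act; case: c c0 pg d dg kg => t n /= n0 pg d dg kg.
have [kn|nk] := ltnP k n.
  exists (t 0); rewrite iter_simple_act// ?(ltnW kn)//.
  by apply: (@act_dominates _ (t, (n - k)%N)) => //=; rewrite subn_gt0.
rewrite -(subnK nk) iterD iter_simple_act// subnn act0.
have [kn|kn] := posnP (k - n); first by rewrite kn; exists (t 1).
have g0 : g != [::] by apply/eqP => g0; move: kg kn nk; rewrite g0 /=; lia.
apply: IH; last by lia.
- exact: (is_path_catr (g := [:: (t, n)])).
- by move: d; case: (g) g0.
Qed.

Lemma inducible_codes l n : inducible l -> exists y,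
  [/\ is_path (codes l n.+1), l = Apath (codes l n.+1) *m y, inducible y,
      dominates y (next_winner (codes l n.+1))
    & exists2 a, 0 < a & iter n.+1 renorm_step l = a *: y].
Proof.
elim: n l => [|n IH] l hl.
  have [c [v [c0 e iv dv]]] := inducible_act hl.
  have [e1 e2] := code_of_act dv c0.
  have -> : codes l 1 = [:: c] by rewrite codes_rec e e1.
  exists v; rewrite is_path_cons c0 Apath_act Apath_nil mul1mx; split=> //.
  exists (\sum_i v i 0)^-1; last by rewrite /= /renorm_step e e2.
  have v0 := inducible_positive iv.
  by rewrite invr_gt0 (sum3 (fun i => v i 0)) !addr_gt0.
have [c [v [c0 e iv dv]]] := inducible_act hl.
have [e1 e2] := code_of_act dv c0.
pose b := (\sum_i v i 0)^-1.
have b0 : 0 < b.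
  have v0 := inducible_positive iv.
  by rewrite invr_gt0 (sum3 (fun i => v i 0)) !addr_gt0.
have er : renorm_step l = b *: v by rewrite /renorm_step e e2.
have [y [p ev iy dy [a a0 ea]]] := IH v iv.
have -> : codes l n.+2 = c :: codes v n.+1.
  by rewrite codes_rec er codesZ// e e1.
exists y; split=> //.
- rewrite is_path_cons c0 p andbT codes_rec/= admissibleE.
  have [c' [v' [c'0 e' iv' dv']]] := inducible_act iv.
  have [ec _] := code_of_act dv' c'0; rewrite e' ec.
  apply/eqP; rewrite e' in dv; apply: dominates_uniq dv.
  by apply: act_dominates => //; exact: inducible_positive.
- by rewrite Apath_act -ev.
- exists a => //; rewrite iterSr er; move: ea; rewrite !iterSr => <-.
  by rewrite renorm_stepZ.
Qed.

(* [cone g l] says that the codes of [l] begin with [g]; unlike membership in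
   the gasket it is an open condition *)
Definition cone g l : bool := dominates (invmx (Apath g) *m l) (next_winner g).

Lemma coneP g l :
  reflect (exists2 y, l = Apath g *m y & dominates y (next_winner g)) (cone g l).
Proof.
apply: (iffP idP) => [d|[y -> d]].
  by exists (invmx (Apath g) *m l) => //; rewrite mulKVmx// Apath_unit.
by rewrite /cone mulKmx// Apath_unit.
Qed.

Lemma cone_codes g l : is_path g -> cone g l -> codes l (size g) = g.
Proof. by move=> pg /coneP[y -> d]; have [] := codes_Apath pg d. Qed.

Lemma cone_catl g h l : is_path (g ++ h) -> g != [::] -> cone (g ++ h) l -> cone g l.
Proof.
move=> gh g0 /coneP[y -> d]; apply/coneP; exists (Apath h *m y).
  by rewrite mulmxA Apath_cat.
case/lastP: g g0 gh d => // g c _ gh d.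
have p : is_path (c :: h) by apply: (is_path_catr (g := g)); rewrite // -cat_rcons.
have := @Apath_dominates c h y p; rewrite /next_winner last_rcons; apply.
by move: d; rewrite /next_winner last_cat last_rcons.
Qed.

Lemma inducible_codesP l n (hl : inducible l) : is_path (codes l n.+1) /\
  cone (codes l n.+1) l.
Proof.
have [y [p e _ d _]] := inducible_codes n hl; split=> //.
by apply/coneP; exists y.
Qed.

Lemma coneE l n g : inducible l -> is_path g -> size g = n ->
  cone g l <-> codes l n = g.
Proof.
move=> hl pg <-; split; first exact: cone_codes.
case: g pg => // c g pg eg; have [_] := inducible_codesP (size g) hl.
by rewrite -[in X in _ -> X]eg.
Qed.

Lemma gasketP l : gasket l <-> \sum_i l i 0 = 1 /\ inducible l.
Proof.
split=> [[p s h]|[s h]]; first by split.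
by split=> //; exact: inducible_positive.
Qed.

(** This form, with countably many open cones at each level [n], gives the measurability of the
    gasket. *)
Lemma gasket_cone l : gasket l <-> \sum_i l i 0 = 1 /\
  (forall n, exists g, [/\ is_path g, size g = n.+1 & cone g l]).
Proof.
split=> [/gasketP[s h]|[s h]]; [split=> // n|apply/gasketP; split=> // n].
  by exists (codes l n.+1); have [p c] := inducible_codesP n h; rewrite size_codes.
have [g [p sg /coneP[y -> d]]] := h n.
by apply: iter_simple_Apath => //; rewrite sg.
Qed.

Lemma positive_sum_gt0 l : positive l -> 0 < \sum_i l i 0.
Proof. by move=> p; rewrite (sum3 (fun i => l i 0)) !addr_gt0. Qed.

Lemma gasket_renorm l : gasket l -> gasket (renorm_step l).
Proof.
move=> /gasketP[s h]; apply/gasketP.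
have [c [v [c0 e iv dv]]] := inducible_act h.
have [_ e2] := code_of_act dv c0.
have v0 := positive_sum_gt0 (inducible_positive iv).
rewrite /renorm_step e e2; split; last by apply: inducibleZ => //; rewrite invr_gt0.
rewrite (eq_bigr (fun i => (\sum_j v j 0)^-1 * v i 0)); last by move=> i _; rewrite mxE.
by rewrite -mulr_sumr mulVf// gt_eqF.
Qed.

Lemma gasket_iter_renorm l k : gasket l -> gasket (iter k renorm_step l).
Proof. by move=> h; elim: k => //= k; exact: gasket_renorm. Qed.

Lemma gasket_Apath l n : gasket l -> exists2 a, 0 < a &
  l = a *: (Apath (codes l n) *m iter n renorm_step l).
Proof.
case: n => [|n] hl; first by exists 1 => //; rewrite scale1r Apath_nil mul1mx.
have [_ il] := (gasketP l).1 hl.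
have [y [_ e _ _ [a a0 ea]]] := inducible_codes n il.
exists a^-1; first by rewrite invr_gt0.
by rewrite ea -scalemxAr scalerA mulVf ?scale1r// gt_eqF.
Qed.

End Paths.

(** * The first return map *)

Section ReturnWords.
Context (gs : seq code) (gs_path : is_path gs).

Let gs0 : gs != [::]. Proof. by case/andP: gs_path. Qed.

(** Occurrences of [gs] are sought in [w ++ gs] because a return word can be shorter than [gs],
    whose copies then overlap. The excluded positions are 1 to [size w - 1]. *)
Definition return_word (w : seq code) : bool :=
  [&& (0 < size w)%N, is_path (w ++ gs), prefix gs (w ++ gs) &
      all (fun k => ~~ prefix gs (drop k (w ++ gs))) (iota 1 (size w).-1)].

Lemma return_word_inner w k : return_word w -> (0 < k < size w)%N ->
  ~~ prefix gs (drop k (w ++ gs)).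
Proof.
move=> /and4P[w0 _ _ /allP h] /andP[k0 kw]; apply: h.
by rewrite mem_iota; lia.
Qed.

(** The reason why the shift is full: what follows a return word starts again with [gs], whichever
    return words come next. *)
Lemma flatten_prefix (u : seq (seq code)) : all return_word u ->
  exists r, flatten u ++ gs = gs ++ r.
Proof.
elim: u => [_|w u IH /= /andP[/and4P[_ _ /prefixP[r hr] _] /IH[r' e]]].
  by exists [::]; rewrite cats0.
by exists (r ++ r'); rewrite -catA e catA hr catA.
Qed.

Lemma flatten_path (u : seq (seq code)) : all return_word u ->
  is_path (flatten u ++ gs).
Proof.
elim: u => [//|w u IH /= /andP[hw hu]].
have [r e] := flatten_prefix hu; have := IH hu; rewrite -catA e => p.
case/and4P: hw => w0 + _ _.
have wn0 : w != [::] by rewrite -size_eq0 -lt0n.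
have gr0 : gs ++ r != [::] by case: (gs) gs0.
rewrite (is_path_cat wn0 gs0) (is_path_cat wn0 gr0) p andbT => /and3P[-> h _].
by case: (gs) gs0 h.
Qed.

Lemma size_flatten_ge (u : seq (seq code)) : all return_word u ->
  (size u <= size (flatten u))%N.
Proof.
elim: u => [//|w u IH /= /andP[/and4P[w0 _ _ _] /IH h]].
by rewrite size_cat; lia.
Qed.

(** Taken together, [size gs] return words are at least as long as [gs], so the initial copy of [gs]
    no longer reaches into the final one. *)
Lemma flatten_long_prefix (u : seq (seq code)) : all return_word u ->
  (size gs <= size u)%N -> exists r, flatten u = gs ++ r.
Proof.
move=> hu su; have [r e] := flatten_prefix hu.
have sf : (size gs <= size (flatten u))%N.
  by apply: leq_trans su _; exact: size_flatten_ge.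
exists (drop (size gs) (flatten u)).
rewrite -[LHS](cat_take_drop (size gs)); congr (_ ++ _).
have := congr1 (take (size gs)) e.
by rewrite takel_cat// take_size_cat.
Qed.

End ReturnWords.

Section ReturnMap.
Context {R : realType} (gs : seq code) (gs_path : is_path gs).
Implicit Types (l : 'cV[R]_3) (w : seq code) (u : seq (seq code)).

Let gs0 : gs != [::]. Proof. by case/andP: gs_path. Qed.

Lemma Delta_iterE l k : gasket l ->
  Delta gs (iter k renorm_step l) <-> codes (iter k renorm_step l) (size gs) = gs.
Proof.
by move=> hl; split=> [[]//|e]; split=> //; exact: gasket_iter_renorm.
Qed.

Lemma codes_iterE l k N : (k + size gs <= N)%N ->
  codes (iter k renorm_step l) (size gs) = gs <->
  prefix gs (drop k (codes l N)).
Proof.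
move=> kN; rewrite (_ : N = (k + (size gs + (N - k - size gs)))%N); last by lia.
rewrite codes_cat drop_size_cat ?size_codes// codes_cat prefixE.
by rewrite take_size_cat ?size_codes//; split=> [->|/eqP].
Qed.

Lemma is_return_time_uniq l j k :
  is_return_time gs l j -> is_return_time gs l k -> j = k.
Proof.
move=> [j0 dj hj] [k0 dk hk]; case: (ltngtP j k) => // h.
- by exfalso; apply: (hk j) => //; rewrite j0.
- by exfalso; apply: (hj k) => //; rewrite k0.
Qed.

Lemma return_timeE l k : is_return_time gs l k -> return_time gs l = k.
Proof.
move=> h; rewrite /return_time; case: xgetP => [j _ /= hj|/(_ k)//].
exact: is_return_time_uniq hj h.
Qed.

Lemma return_word_time l w : gasket l -> return_word gs w ->
  codes l (size w + size gs) = w ++ gs ->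
  [/\ return_time gs l = size w, return_path gs l = w &
      return_map gs l = iter (size w) renorm_step l].
Proof.
move=> hl hw e.
have et : return_time gs l = size w.
  apply: return_timeE; split.
  - by case/and4P: hw.
  - apply/(Delta_iterE _ hl); move: e; rewrite codes_cat => /eqP.
    by rewrite eqseq_cat ?size_codes// => /andP[_ /eqP].
  - move=> j jw; rewrite Delta_iterE// (codes_iterE l (N := (size w + size gs)%N)).
      by rewrite e; apply/negP; exact: return_word_inner.
    by case/andP: jw => _ jw; lia.
split=> //; last by rewrite /return_map et.
rewrite /return_path et; move: e; rewrite codes_cat => /eqP.
by rewrite eqseq_cat ?size_codes// => /andP[/eqP].
Qed.

Lemma return_domain_word l : return_domain gs l ->
  return_word gs (return_path gs l) /\
  codes l (size (return_path gs l) + size gs) = return_path gs l ++ gs.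
Proof.
move=> [[hl e] hio].
have ex : exists k, (0 < k)%N && `[< Delta gs (iter k renorm_step l) >].
  by have [k k0 dk] := hio 0%N; exists k; rewrite k0; apply/asboolP.
case: (ex_minnP ex) => n /andP[n0 /asboolP dn] nmin.
have rt : is_return_time gs l n.
  split=> // j /andP[j0 jn] dj.
  have := nmin j; rewrite j0/= => /(_ _)/wrap[]; first by apply/asboolP.
  by rewrite leqNgt jn.
rewrite /return_path (return_timeE rt) size_codes.
have ec : codes l (n + size gs) = codes l n ++ gs.
  by rewrite codes_cat; congr (_ ++ _); case: dn.
split=> //; rewrite /return_word size_codes n0 -ec; apply/and4P; split=> //.
- have [_ il] := (gasketP l).1 hl.
  by case: (n) n0 => // m _; have [] := inducible_codesP (m + size gs) il.
- by have := (codes_iterE l (k := 0) (N := (n + size gs)%N)); rewrite drop0 /= => <-//; lia.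
- apply/allP => k; rewrite mem_iota => hk; apply/negP => pk.
  case: rt => _ _ /(_ k); apply; first by lia.
  by apply/Delta_iterE => //; apply/(@codes_iterE l k (n + size gs)) => //; lia.
Qed.

Lemma return_domain_iter l k : return_domain gs l ->
  Delta gs (iter k renorm_step l) -> return_domain gs (iter k renorm_step l).
Proof.
move=> [_ hio] dk; split=> // N; have [m hm dm] := hio (N + k)%N.
exists (m - k)%N; first by lia.
by rewrite -iterD subnK//; lia.
Qed.

Lemma return_domain_map l : return_domain gs l -> return_domain gs (return_map gs l).
Proof.
move=> hl; have [hw e] := return_domain_word hl.
have [[gl _] _] := hl.
have [et _ em] := return_word_time gl hw e.
rewrite em; apply: return_domain_iter => //.
apply/(Delta_iterE _ gl); move: e; rewrite codes_cat => /eqP.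
by rewrite eqseq_cat ?size_codes// => /andP[_ /eqP].
Qed.

Lemma return_domain_iter_map l n : return_domain gs l ->
  return_domain gs (iter n (return_map gs) l).
Proof. by move=> hl; elim: n => //= n; exact: return_domain_map. Qed.

Lemma cylinder_nil l : cylinder gs [::] l <-> return_domain gs l.
Proof. by split=> [[]|]. Qed.

Lemma cylinder_cons l w u : cylinder gs (w :: u) l <->
  [/\ return_domain gs l, return_path gs l = w & cylinder gs u (return_map gs l)].
Proof.
rewrite /cylinder /= /mkseq /= (iotaDl 1 0) -map_comp.
rewrite (_ : map _ _ = [seq return_path gs (iter k (return_map gs) (return_map gs l))
    | k <- iota 0 (size u)]); last first.
  by apply: eq_map => k; rewrite /= -iterSr.
split=> [[hl [e1 e2]]|[hl e1 [_ e2]]]; split=> //.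
- by split=> //; exact: return_domain_map.
- by rewrite e1 e2.
Qed.

Lemma cylinder_words l u : cylinder gs u l -> all (return_word gs) u.
Proof.
elim: u l => [//|w u IH] l /cylinder_cons[hl <- /IH hu] /=.
by rewrite hu; have [->] := return_domain_word hl.
Qed.

(** The occurrences of [gs] force the cut into return words; the final [gs] marks the end of the
    last one. *)
Lemma cylinder_codes l u : all (return_word gs) u -> cylinder gs u l <->
  return_domain gs l /\ codes l (size (flatten u ++ gs)) = flatten u ++ gs.
Proof.
elim: u l => [|w u IH] l.
  by split=> [[hl _]|[]//]; split=> //; case: hl => -[].
move=> /= /andP[hw hu]; have [r er] := flatten_prefix hu.
rewrite -catA size_cat codes_cat; split.
  move=> /cylinder_cons[hl ew /(IH _ hu)[_ e]]; split=> //.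
  have [hw' ec] := return_domain_word hl; rewrite ew in hw' ec.
  have [_ _ em] := return_word_time hl.1.1 hw' ec.
  rewrite -em e; congr (_ ++ _); move: ec; rewrite codes_cat => /eqP.
  by rewrite eqseq_cat ?size_codes// => /andP[/eqP].
move=> [hl /eqP]; rewrite eqseq_cat ?size_codes// => /andP[/eqP e1 /eqP e2].
have e3 : codes (iter (size w) renorm_step l) (size gs) = gs.
  have sz : (0 + size gs <= size (flatten u ++ gs))%N by rewrite size_cat; lia.
  apply/(codes_iterE (iter (size w) renorm_step l) (k := 0) sz).
  by rewrite drop0 e2 er prefix_prefix.
have [et ep em] : [/\ return_time gs l = size w, return_path gs l = w &
      return_map gs l = iter (size w) renorm_step l].
  by apply: return_word_time => //; [case: hl => -[]|rewrite codes_cat e1 e3].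
apply/cylinder_cons; split=> //; apply/(IH _ hu); split.
  exact: return_domain_map.
by rewrite em.
Qed.

Lemma cylinder_cone l u : all (return_word gs) u -> cylinder gs u l <->
  return_domain gs l /\ cone (flatten u ++ gs) l.
Proof.
move=> hu; rewrite cylinder_codes//.
have E : return_domain gs l -> cone (flatten u ++ gs) l <->
    codes l (size (flatten u ++ gs)) = flatten u ++ gs.
  move=> [[hl _] _]; apply: coneE => //; last exact: flatten_path.
  by have [] := (gasketP l).1 hl.
by split=> -[hl h]; split=> //; apply/E.
Qed.

(** Infinitely many returns become arbitrarily long paths ending with [gs], hence countable
    operations on open cones. *)
Lemma return_domain_cone l : return_domain gs l <->
  [/\ gasket l, cone gs l & forall N, exists g,
    [/\ (N < size g)%N, is_path (g ++ gs) & cone (g ++ gs) l]].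
Proof.
have E g : gasket l -> is_path (g ++ gs) -> cone (g ++ gs) l <->
    codes l (size g + size gs) = g ++ gs.
  move=> hl p; apply: coneE => //; last by rewrite size_cat.
  by have [] := (gasketP l).1 hl.
split=> [[[hl e] hio]|[hl hc hio]].
  split=> //; first by apply/(E [::]).
  move=> N; have [k kN [_ dk]] := hio N.
  have ek : codes l (k + size gs) = codes l k ++ gs by rewrite codes_cat dk.
  have [_ il] := (gasketP l).1 hl.
  exists (codes l k); rewrite size_codes -ek.
  case: k {dk ek} kN => // m kN; split=> //.
  - by have [] := inducible_codesP (m + size gs) il.
  - by have [] := inducible_codesP (m + size gs) il.
split; first by split=> //; apply/(E [::]).
move=> N; have [g [gN p /(E _ hl p) e]] := hio N.
exists (size g) => //; apply/Delta_iterE => //.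
by move: e; rewrite codes_cat => /eqP; rewrite eqseq_cat ?size_codes// => /andP[_ /eqP].
Qed.

End ReturnMap.

(** * Distortion and contraction *)

Lemma mkseqD (T : Type) (f : nat -> T) n m :
  mkseq f (n + m) = mkseq f n ++ mkseq (fun k => f (n + k)%N) m.
Proof.
rewrite /mkseq iotaD map_cat; congr (_ ++ _).
by rewrite add0n -[X in iota X m](addn0 n) iotaDl -map_comp.
Qed.

Section VectorOrder.
Context {R : realType}.
Implicit Types (l v x y z : 'cV[R]_3) (c : code) (g h : seq code).

Definition lev x y : Prop := forall i, x i 0 <= y i 0.

Definition vsum v : R := \sum_i v i 0.

Definition ones : 'cV[R]_3 := const_mx 1.


Lemma lev_trans y x z : lev x y -> lev y z -> lev x z.
Proof. by move=> xy yz i; exact: le_trans (xy i) (yz i). Qed.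

Lemma le_vsum x y : lev x y -> vsum x <= vsum y.
Proof. by move=> xy; apply: ler_sum => i _; exact: xy. Qed.

Lemma vsum0 : vsum 0 = 0.
Proof. by rewrite /vsum big1// => i _; rewrite mxE. Qed.

Lemma vsumZ a x : vsum (a *: x) = a * vsum x.
Proof. by rewrite /vsum mulr_sumr; apply: eq_bigr => i _; rewrite mxE. Qed.

Lemma vsumD x y : vsum (x + y) = vsum x + vsum y.
Proof. by rewrite /vsum -big_split; apply: eq_bigr => i _; rewrite mxE. Qed.

Lemma vsumB x y : vsum (x - y) = vsum x - vsum y.
Proof. by rewrite -scaleN1r vsumD vsumZ mulN1r. Qed.

Lemma onesE i : ones i 0 = 1. Proof. by rewrite mxE. Qed.

Lemma colZE a x i : (a *: x) i 0 = a * x i 0. Proof. by rewrite mxE. Qed.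

Lemma colBE x y i : (x - y) i 0 = x i 0 - y i 0. Proof. by rewrite !mxE. Qed.

Lemma col0E i : (0 : 'cV[R]_3) i 0 = 0. Proof. by rewrite mxE. Qed.

Lemma scaled_onesE a i : (a *: ones) i 0 = a. Proof. by rewrite colZE onesE mulr1. Qed.

Lemma ones_positive : positive ones. Proof. by move=> i; rewrite onesE. Qed.

Lemma positive_ge0 x : positive x -> lev 0 x.
Proof. by move=> p i; rewrite mxE ltW. Qed.

Lemma vsum_gt0 x : positive x -> 0 < vsum x.
Proof. exact: positive_sum_gt0. Qed.

Lemma vsum_ge0 x : lev 0 x -> 0 <= vsum x.
Proof. by move=> x0; apply: sumr_ge0 => i _; have := x0 i; rewrite mxE. Qed.

Lemma lev_vsum x : lev 0 x -> lev x (vsum x *: ones).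
Proof.
move=> x0 i; rewrite mxE onesE mulr1 /vsum (bigD1 i)//= lerDl sumr_ge0// => j _.
by have := x0 j; rewrite mxE.
Qed.

Lemma act_lev c x y : lev x y -> lev (act c x) (act c y).
Proof.
move=> xy i; rewrite !actE lerD//; case: ifP => // _.
by rewrite ler_wpM2l//; apply: ler_sum.
Qed.

Lemma Apath_lev g x y : lev x y -> lev (Apath g *m x) (Apath g *m y).
Proof.
move=> xy; elim: g => [|c g IH]; first by rewrite Apath_nil !mul1mx.
by rewrite !Apath_act; exact: act_lev.
Qed.

Lemma Apath_lev0 g x : lev 0 x -> lev 0 (Apath g *m x).
Proof. by move=> /(Apath_lev g); rewrite mulmx0. Qed.

Lemma act_ge c x : lev 0 x -> lev x (act c x).
Proof.
move=> x0 i; rewrite actE lerDl; case: ifP => // _.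
by rewrite mulr_ge0// sumr_ge0// => j _; have := x0 j; rewrite mxE.
Qed.

Lemma Apath_ge g x : lev 0 x -> lev x (Apath g *m x).
Proof.
move=> x0; elim: g => [|c g IH]; first by rewrite Apath_nil mul1mx.
by rewrite Apath_act; apply: lev_trans IH _; apply: act_ge; exact: Apath_lev0.
Qed.

(** When [i] wins, its coordinate receives all the others and reaches the total; the remaining
    factors never decrease a coordinate. *)
Lemma Apath_winner g i x : lev 0 x -> all (fun c : code => (0 < c.2)%N) g ->
  i \in [seq winner_of c | c <- g] -> vsum x <= (Apath g *m x) i 0.
Proof.
move=> x0; elim: g => [//|c g IH] /= /andP[c0 g0].
rewrite inE Apath_act => /orP[/eqP ->|/(IH g0) h]; last first.
  by apply: le_trans h _; apply: act_ge; exact: Apath_lev0.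
have Ax := Apath_ge g x0.
rewrite actE eqxx /vsum (bigD1 (winner_of c))//= lerD//.
apply: (@le_trans _ _ (\sum_(j | j != winner_of c) (Apath g *m x) j 0)).
  by apply: ler_sum => j _; exact: Ax.
rewrite ler_peMl ?ler1n// sumr_ge0// => j _.
by have := Apath_lev0 g x0 j; rewrite mxE.
Qed.

(** The entry-sum norm of [Apath g]. *)
Definition pnorm g : R := vsum (Apath g *m ones).

Lemma vsum_ones : vsum ones = 3.
Proof. by rewrite /vsum (sum3 (fun i => ones i 0)) !onesE; ring. Qed.

Lemma pnorm_ge3 g : 3 <= pnorm g.
Proof.
rewrite -vsum_ones; apply/le_vsum/Apath_ge.
exact/positive_ge0/ones_positive.
Qed.

Lemma pnorm_gt0 g : 0 < pnorm g.
Proof. by apply: lt_le_trans (pnorm_ge3 g). Qed.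

Lemma vsum_Apath_le g a x : lev x (a *: ones) ->
  vsum (Apath g *m x) <= a * pnorm g.
Proof.
by move=> /(Apath_lev g)/le_vsum; rewrite -scalemxAr vsumZ.
Qed.

Lemma vsum_Apath_ge g a x : lev (a *: ones) x ->
  a * pnorm g <= vsum (Apath g *m x).
Proof.
by move=> /(Apath_lev g)/le_vsum; rewrite -scalemxAr vsumZ.
Qed.

Lemma pnorm_cat g h : pnorm (g ++ h) <= pnorm g * pnorm h.
Proof.
rewrite {1}/pnorm Apath_cat -mulmxA mulrC; apply: vsum_Apath_le.
by apply/lev_vsum/Apath_lev0/positive_ge0/ones_positive.
Qed.

Section CompletePath.
Context (gs : seq code) (gs_path : is_path gs) (gs_complete : complete_path gs).

Local Notation M := (pnorm gs).

Lemma complete_ge x : lev 0 x -> lev (vsum x *: ones) (Apath gs *m x).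
Proof.
move=> x0 i; rewrite scaled_onesE; apply: Apath_winner => //.
  by case/and3P: gs_path.
by move/forallP: gs_complete.
Qed.

Lemma complete_le x : lev 0 x -> lev (Apath gs *m x) ((M * vsum x) *: ones).
Proof.
move=> x0 i; apply: le_trans (Apath_lev gs (lev_vsum x0) i) _.
rewrite -scalemxAr colZE scaled_onesE mulrC ler_wpM2r ?vsum_ge0//.
have e0 : lev 0 (Apath gs *m ones) by exact/Apath_lev0/positive_ge0/ones_positive.
by have := lev_vsum e0 i; rewrite scaled_onesE.
Qed.

Lemma complete_positive x : lev 0 x -> x != 0 -> positive (Apath gs *m x).
Proof.
move=> x0 xn0 i; have := complete_ge x0 i; rewrite scaled_onesE.
apply: lt_le_trans; rewrite lt_neqAle vsum_ge0// andbT eq_sym.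
apply: contraNneq xn0 => /eqP; rewrite psumr_eq0; last first.
  by move=> j _; have := x0 j; rewrite mxE.
move=> /allP h; apply/eqP/colP => j; rewrite [RHS]mxE; apply/eqP.
by apply: (h j); rewrite mem_index_enum.
Qed.

(** A normalized vector in the image of [Apath gs] has all its coordinates between [M^-1] and 1. *)
Lemma complete_distortion x g y : lev 0 y -> x = Apath gs *m y -> vsum x = 1 ->
  M^-1 * pnorm g <= vsum (Apath g *m x) <= pnorm g.
Proof.
move=> y0 e x1; have M0 := pnorm_gt0 gs.
have x0 : lev 0 x by rewrite e; exact: Apath_lev0.
apply/andP; split; last first.
  by rewrite -[leRHS]mul1r; apply: vsum_Apath_le; rewrite -x1; exact: lev_vsum.
apply: vsum_Apath_ge => i; rewrite scaled_onesE.
have h1 := complete_ge y0 i; rewrite -e scaled_onesE in h1.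
apply: le_trans h1; rewrite -[M^-1]mulr1 ler_pdivrMl// mulrC.
by have := vsum_Apath_le gs (lev_vsum y0); rewrite -e x1.
Qed.

(** For nonnegative matrices the norm of a product can be far below the product of the norms. Here
    [A_h A_gs = A_gs A_r] inserts a positive factor between [g] and the rest: [M] is paid once to
    compare the norms of [h] and [r], and once to split off [g]. *)
Lemma pnorm_quasi g h r : h ++ gs = gs ++ r ->
  pnorm g * pnorm h <= M ^+ 2 * pnorm (g ++ h).
Proof.
move=> e; have M0 := pnorm_gt0 gs.
have o0 := positive_ge0 ones_positive.
have r0 : lev 0 (Apath r *m ones) by exact: Apath_lev0.
have E : Apath h *m (Apath gs *m ones) = Apath gs *m (Apath r *m ones).
  by rewrite !mulmxA -!Apath_cat e.
have h1 : pnorm h <= M * pnorm r.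
  apply: (@le_trans _ _ (vsum (Apath h *m (Apath gs *m ones)))).
    by apply/le_vsum/Apath_lev/Apath_ge.
  by rewrite E mulrC; apply/vsum_Apath_le/lev_vsum.
have h2 : pnorm r * pnorm g <= M * pnorm (g ++ h).
  apply: (@le_trans _ _ (vsum (Apath g *m (Apath h *m (Apath gs *m ones))))).
    by rewrite E; apply/vsum_Apath_ge/complete_ge.
  rewrite mulmxA -Apath_cat; apply: vsum_Apath_le.
  by apply/lev_vsum/Apath_lev0.
have g0 := pnorm_gt0 g.
apply: (@le_trans _ _ (pnorm g * (M * pnorm r))).
  by rewrite ler_pM2l.
by rewrite expr2 mulrCA -mulrA ler_pM2l// mulrC.
Qed.

Definition gap (d : R) x y : Prop := exists a b,
  [/\ lev (b *: y) x, lev x (a *: y) & a - b <= d].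

Lemma gap_Apath d g x y : gap d x y -> gap d (Apath g *m x) (Apath g *m y).
Proof.
by move=> [a [b [h1 h2 h3]]]; exists a, b; split=> //; rewrite scalemxAr;
  exact: Apath_lev.
Qed.

(* Birkhoff contraction, with the multiplicative gap replaced by the additive
   gap between the two comparison constants *)
Lemma gap_complete d x y : positive y -> gap d x y ->
  gap ((1 - M^-1) * d) (Apath gs *m x) (Apath gs *m y).
Proof.
move=> y0 [a [b [h1 h2 h3]]]; have M0 := pnorm_gt0 gs.
have sy := vsum_gt0 y0.
have u0 : lev 0 (x - b *: y).
  by move=> i; rewrite colBE col0E subr_ge0.
have v0 : lev 0 (a *: y - x).
  by move=> i; rewrite colBE col0E subr_ge0.
have My : 0 < M * vsum y by rewrite mulr_gt0.
have yu := complete_le (positive_ge0 y0).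
(* [Apath gs] sends [x - b *: y] above its sum in each coordinate and [y] below [M * vsum y]; the
   quotient is the gain on [b]. The loss on [a] comes from [a *: y - x] in the same way. *)
exists (a - vsum (a *: y - x) / (M * vsum y)),
  (b + vsum (x - b *: y) / (M * vsum y)); split.
- move=> i; have := complete_ge u0 i; have := yu i.
  rewrite mulmxBr -scalemxAr colBE !scaled_onesE !colZE => k1 k2.
  rewrite mulrDl -lerBrDl; apply: le_trans k2.
  rewrite mulrAC ler_pdivrMr// ler_wpM2l//; exact: vsum_ge0.
- move=> i; have := complete_ge v0 i; have := yu i.
  rewrite mulmxBr -scalemxAr colBE !scaled_onesE !colZE => k1 k2.
  rewrite mulrBl lerBrDl -lerBrDr; apply: le_trans k2.
  rewrite mulrAC ler_pdivrMr// ler_wpM2l//; exact: vsum_ge0.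
rewrite !vsumB !vsumZ.
have -> : a - (a * vsum y - vsum x) / (M * vsum y) -
  (b + (vsum x - b * vsum y) / (M * vsum y)) = (1 - M^-1) * (a - b).
  by field; rewrite !gt_eqF.
rewrite ler_wpM2l// subr_ge0 invf_le1//; have := pnorm_ge3 gs; lra.
Qed.

(** Each block of [size gs] return words begins with [gs], so it contracts the gap once. *)
Lemma gap_words d k (u : seq (seq code)) x y : all (return_word gs) u ->
  size u = (k * size gs)%N -> positive y -> gap d x y ->
  gap ((1 - M^-1) ^+ k * d) (Apath (flatten u) *m x) (Apath (flatten u) *m y).
Proof.
move=> hu su y0 g0; elim: k u hu su => [|k IH] u hu su.
  by rewrite (size0nil su) /= Apath_nil !mul1mx mul1r.
rewrite -(cat_take_drop (size gs) u) flatten_cat Apath_cat -!mulmxA.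
have st : (size gs <= size u)%N by rewrite su mulSn leq_addr.
have hu1 : all (return_word gs) (take (size gs) u).
  by apply/allP => w /mem_take; exact: (allP hu).
have hu2 : all (return_word gs) (drop (size gs) u).
  by apply/allP => w /mem_drop; exact: (allP hu).
have [|r ->] := flatten_long_prefix gs_path hu1; first by rewrite size_takel.
rewrite Apath_cat -!mulmxA exprS -mulrA; apply: gap_complete.
  by do 2 apply: Apath_positive.
apply: gap_Apath; apply: IH => //.
by rewrite size_drop su mulSn addKn.
Qed.

Lemma cone_gap (u : seq (seq code)) k l v : all (return_word gs) u ->
  size u = (k * size gs)%N -> vsum l = 1 -> vsum v = 1 ->
  cone (flatten u ++ gs) l -> cone (flatten u ++ gs) v ->
  forall i, `|l i 0 - v i 0| <= (1 - M^-1) ^+ k * M ^+ 2.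
Proof.
move=> hu su l1 v1 /coneP[y ey /dominatesP[y0 _]] /coneP[z ez /dominatesP[z0 _]] i.
have M0 := pnorm_gt0 gs.
have [sy sz] : 0 < vsum y /\ 0 < vsum z by split; exact: vsum_gt0.
have f0 := pnorm_gt0 (flatten u).
rewrite Apath_cat -mulmxA in ey; rewrite Apath_cat -mulmxA in ez.
have b1 : vsum y * pnorm (flatten u) <= 1.
  by rewrite -l1 ey; apply/vsum_Apath_ge/complete_ge/positive_ge0.
have b2 : 1 <= M * vsum z * pnorm (flatten u).
  by rewrite -v1 ez; apply/vsum_Apath_le/complete_le/positive_ge0.
have yz : vsum y <= M * vsum z.
  by rewrite -(ler_pM2r f0); exact: le_trans b1 b2.
(* One factor [M] is the distortion of [Apath gs], the other bounds [vsum y] by [vsum z], as both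
   points are normalized. *)
have g0 : gap (M ^+ 2) (Apath gs *m y) (Apath gs *m z).
  exists (M ^+ 2), 0; rewrite subr0 scale0r; split=> //.
    exact/Apath_lev0/positive_ge0.
  apply: lev_trans (complete_le (positive_ge0 y0)) _ => j.
  have := complete_ge (positive_ge0 z0) j.
  rewrite !scaled_onesE colZE => h.
  rewrite expr2 -mulrA ler_pM2l//; apply: le_trans yz _.
  by rewrite ler_pM2l.
have zz : positive (Apath gs *m z) by exact: Apath_positive.
have [a [b [h1 h2 h3]]] := gap_words hu su zz g0.
rewrite -ey -ez in h1 h2.
(* Equal sums force [b <= 1 <= a], so each coordinate differs by at most [a - b]. *)
have a1 : 1 <= a by have := le_vsum h2; rewrite vsumZ l1 v1 mulr1.
have b1' : b <= 1 by have := le_vsum h1; rewrite vsumZ l1 v1 mulr1.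
have v0 : 0 <= v i 0 by have := Apath_lev0 (flatten u) (positive_ge0 zz) i; rewrite -ez col0E.
have vi1 : v i 0 <= 1.
  have v00 : lev 0 v by rewrite ez; exact/Apath_lev0/positive_ge0.
  by have := lev_vsum v00 i; rewrite v1 scaled_onesE.
have := h1 i; have := h2 i; rewrite !colZE => k2 k1.
apply: le_trans h3.
rewrite ler_norml; apply/andP; split; nra.
Qed.

End CompletePath.

End VectorOrder.

(** * Every sequence of return words is realized by a point *)

Section PointExistence.
Context {R : realType} (gs : seq code) (gs_path : is_path gs)
  (gs_complete : complete_path gs) (omega : nat -> seq code)
  (homega : forall k, return_word gs (omega k)).

Let G n := flatten (mkseq omega n).

Let all_omega n k : all (return_word gs) (mkseq (fun j => omega (n + j)%N) k).
Proof. by apply/allP => w /mapP[j _ ->]. Qed.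

Let all_omega0 k : all (return_word gs) (mkseq omega k).
Proof. by apply/allP => w /mapP[j _ ->]. Qed.

Let GD n k : G (n + k) = G n ++ flatten (mkseq (fun j => omega (n + j)%N) k).
Proof. by rewrite /G mkseqD flatten_cat. Qed.

Let GS n : exists r, G (n + size gs) = G n ++ gs ++ r.
Proof.
have [|r hr] := flatten_long_prefix gs_path (all_omega n (size gs)).
  by rewrite size_mkseq.
by exists r; rewrite GD hr.
Qed.

Let Gpath n : is_path (G n ++ gs). Proof. exact: flatten_path. Qed.

Let gs0 : gs != [::]. Proof. by case/andP: gs_path. Qed.

(** The point is a coordinatewise Banach limit of normalized vectors. Linearity carries the limit
    through the inverse matrices, which gives only the closed condition [lev 0 (y k)]. As [y k] is
    also an image under [Apath gs] of a nonzero nonnegative vector, it is positive, and then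
    dominated by the first winner of [gs]. *)
Lemma point_exists : exists l : 'cV[R]_3, vsum l = 1 /\
  forall n, cone (flatten (mkseq omega n) ++ gs) l.
Proof.
have [L hL] := @exists_banach_limit R.
pose z n : 'cV[R]_3 := Apath (G n) *m ones.
have z0 n : positive (z n) by exact/Apath_positive/ones_positive.
pose p n : 'cV[R]_3 := (vsum (z n))^-1 *: z n.
have p1 n : vsum (p n) = 1 by rewrite vsumZ mulVf// gt_eqF// vsum_gt0.
have p0 n : positive (p n) by apply: positiveZ => //; rewrite invr_gt0 vsum_gt0.
have pb i : bounded_seq (fun n => p n i 0).
  apply: (@bounded_seqI _ _ 1) => n; rewrite (ltW (p0 n i))/=.
  by have := lev_vsum (positive_ge0 (p0 n)) i; rewrite p1 scaled_onesE.
pose l : 'cV[R]_3 := \col_i L (fun n => p n i 0).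
have lE i : l i 0 = L (fun n => p n i 0) by rewrite mxE.
have l1 : vsum l = 1.
  rewrite /vsum (eq_bigr (fun i => L (fun n => p n i 0))) => [|i _]; last by rewrite lE.
  rewrite -(lim_sum hL)//; have [Lc _ _ _ _] := hL; rewrite -[RHS]Lc.
  by congr L; apply/funext => n; rewrite -[RHS](p1 n).
pose y k := invmx (Apath (G k)) *m l.
have ly k : l = Apath (G k) *m y k by rewrite mulKVmx// Apath_unit.
have y0 k : lev 0 (y k).
  move=> i; rewrite mxE /y mxE.
  have -> : \sum_j invmx (Apath (G k)) i j * l j 0 =
      L (fun n => (invmx (Apath (G k)) *m p n) i 0).
    have [_ _ LZ _ _] := hL.
    rewrite (eq_bigr (fun j => L (fun n => invmx (Apath (G k)) i j * p n j 0))); last first.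
      by move=> j _; rewrite LZ// lE.
    rewrite -(lim_sum hL); last by move=> j; exact: bounded_seqZ.
    by congr L; apply/funext => n; rewrite mxE.
  (* [p n] is in the image of the positive vectors under [Apath (G k)] once [n >= k]. *)
  apply: (@lim_ge0_near _ _ hL k).
    have -> : (fun n => (invmx (Apath (G k)) *m p n) i 0) =
        fun n => \sum_j invmx (Apath (G k)) i j * p n j 0.
      by apply/funext => n; rewrite mxE.
    by apply: bounded_seq_sum => j; exact: bounded_seqZ.
  move=> n kn; rewrite -scalemxAr mxE mulr_ge0//.
    by rewrite invr_ge0 ltW// vsum_gt0.
  rewrite /z -(subnKC kn) GD Apath_cat -mulmxA mulKmx ?Apath_unit//.
  exact/ltW/Apath_positive/ones_positive.
have yn0 k : y k != 0.
  apply: contra_eq_neq l1 => /= yk0; rewrite (ly k) yk0 mulmx0.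
  by rewrite vsum0 eq_sym oner_eq0.
have yS k : exists r, y k = Apath gs *m (Apath r *m y (k + size gs)%N).
  have [r er] := GS k; exists r.
  by rewrite {1}/y (ly (k + size gs)%N) er !Apath_cat -!mulmxA mulKmx// Apath_unit.
have yp k : positive (y k).
  have [r er] := yS k; rewrite er; apply: complete_positive => //.
    by apply: Apath_lev0.
  apply: contraNneq (yn0 k) => e; rewrite er e mulmx0.
  by [].
have yd k : dominates (y k) (winner_of (head (1%g, 0%N) gs)).
  have [r ->] := yS k.
  case: (gs) gs_path gs0 => // c g; rewrite is_path_cons => /andP[c0 _] _.
  by rewrite Apath_act; apply: act_dominates => //; do 2 apply: Apath_positive.
(* A nonempty path is needed for [next_winner] to be read from it. *)
have cG n : (0 < n)%N -> cone (G n) l.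
  move=> n0; apply/coneP; exists (y n) => //.
  have Gn0 : G n != [::].
    by rewrite -size_eq0 -lt0n; apply: leq_trans n0 _;
       have := size_flatten_ge gs_path (all_omega0 n); rewrite size_mkseq.
  by rewrite -(next_winner_cat (Gpath n) Gn0 gs0).
exists l; split=> // n.
(* The trailing [gs] is obtained by cutting the longer path [G (n + size gs)]. *)
have [r er] := GS n.
have : cone (G (n + size gs)) l.
  by apply: cG; rewrite addn_gt0 (lt0n (size gs)) size_eq0 gs0 orbT.
have gg : G n ++ gs != [::] by case: (G n) => //; case: (gs) gs0.
have pp : is_path (((G n ++ gs) ++ r) ++ gs).
  by have := Gpath (n + size gs); rewrite er catA.
rewrite er catA; apply: cone_catl => //; apply: is_path_catl pp _.
by case: (G n ++ gs) gg.
Qed.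

Lemma point_return_domain (l : 'cV[R]_3) : vsum l = 1 ->
  (forall n, cone (flatten (mkseq omega n) ++ gs) l) ->
  return_domain gs l /\ forall n, cylinder gs (mkseq omega n) l.
Proof.
move=> l1 hc.
have hd : return_domain gs l.
  apply/return_domain_cone => //; split.
  - apply/gasket_cone; split=> // n.
    have sz : (n < size (G n.+1 ++ gs))%N.
      rewrite size_cat; have := size_flatten_ge gs_path (all_omega0 n.+1).
      by rewrite size_mkseq -/(G n.+1); lia.
    have tn0 : take n.+1 (G n.+1 ++ gs) != [::].
      by rewrite -size_eq0 size_takel.
    have := hc n.+1; have := Gpath n.+1; rewrite -/(G n.+1).
    rewrite -{1 2}(cat_take_drop n.+1 (G n.+1 ++ gs)) => pp cc.
    exists (take n.+1 (G n.+1 ++ gs)); rewrite size_takel//; split=> //.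
      exact: is_path_catl pp tn0.
    exact: cone_catl pp tn0 cc.
  - exact: (hc 0%N).
  - move=> N; exists (G N.+1); split=> //.
      by have := size_flatten_ge gs_path (all_omega0 N.+1); rewrite size_mkseq.
    exact: (hc N.+1).
split=> // n; apply/cylinder_cone => //.
Qed.

End PointExistence.

(** * Summability over return words *)

Section Summability.
Context {R : realType}.
Implicit Types (s : 'rV[R]_3) (c : code) (g h : seq code).

Definition rpositive s : Prop := forall j, 0 < s 0 j.

(** [s] stands for the column sums of a path matrix; appending the code [c] to the path changes them
    in this way. *)
Definition ract s c : 'rV[R]_3 := s *m (Bcode c)^T.

Lemma ractE s c j : ract s c 0 j = s 0 j +
  if j == winner_of c then 0 else c.2%:R * s 0 (winner_of c).
Proof.
rewrite /ract /Bcode linearD/= trmx1 mulmxDr mulmx1 !mxE; congr (_ + _).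
rewrite (eq_bigr (fun i => s 0 i * (if (i == winner_of c) && (j != winner_of c)
    then c.2%:R else 0))); last by move=> i _; rewrite !mxE.
rewrite (bigD1 (winner_of c))//= big1 ?addr0 => [|i /negbTE ->]; last by rewrite mulr0.
by rewrite eqxx/=; case: (eqVneq j (winner_of c)) => _ /=; rewrite ?mulr0// mulrC.
Qed.

Lemma ract_positive s c : rpositive s -> rpositive (ract s c).
Proof.
by move=> s0 j; rewrite ractE ltr_wpDr//; case: ifP => // _; rewrite mulr_ge0// ltW.
Qed.

Lemma ract_perm0 s (t : 'S_3) n : ract s (t, n) 0 (t 0) = s 0 (t 0).
Proof. by rewrite ractE /winner_of/= eqxx addr0. Qed.

Lemma ract_perm s (t : 'S_3) n j : j != t 0 ->
  ract s (t, n) 0 j = s 0 j + n%:R * s 0 (t 0).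
Proof. by rewrite ractE /winner_of/= => /negbTE ->. Qed.

(** Up to a common factor, the area of the part of the triangle with column sums [s] where [i] wins
    next: for the other indices [j] and [k] it equals [(2 s_i (s_i + s_j) (s_i + s_k))^-1], and the
    column sums after one simple step are [s_i], [s_i + s_j], [s_i + s_k]. *)
Definition cell s (i : 'I_3) : R := (\prod_j (s 0 i + s 0 j))^-1.

Lemma prod_perm3 (t : 'S_3) (f : 'I_3 -> R) :
  \prod_i f i = f (t 0) * f (t 1) * f (t 2).
Proof.
rewrite (reindex_inj (@perm_inj _ t)) /= !big_ord_recl big_ord0 mulr1 mulrA.
by congr (f (t _) * f (t _) * f (t _)); exact: val_inj.
Qed.

Lemma cell_gt0 s i : rpositive s -> 0 < cell s i.
Proof.
by move=> s0; rewrite invr_gt0; apply: prodr_gt0 => j _; rewrite addr_gt0.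
Qed.

(* Half of an identity of areas: the triangle of a matrix with column sums
   [a, x, y], of area [(a * x * y)^-1] up to a factor, is the union of its three
   images and the removed triangle, of area [2 / ((x + a) * (y + a) * (x + y))]. *)
Lemma cell_split (a x y : R) : 0 < a -> 0 < x -> 0 < y ->
  ((x + a) * (x + x) * (x + y))^-1 + ((y + a) * (y + x) * (y + y))^-1 <=
  (2 * a * x * y)^-1 - (2 * a * (x + a) * (y + a))^-1.
Proof.
move=> a0 x0 y0; rewrite -subr_ge0.
have -> : (2 * a * x * y)^-1 - (2 * a * (x + a) * (y + a))^-1 -
  (((x + a) * (x + x) * (x + y))^-1 + ((y + a) * (y + x) * (y + y))^-1) =
  ((x + a) * (y + a) * (x + y))^-1.
  field.
  by repeat (apply/andP; split); rewrite gt_eqF//; lra.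
by rewrite invr_ge0 !mulr_ge0 ?addr_ge0 ?ltW.
Qed.

Lemma telescope_esum (D w : nat -> R) : (forall n, 0 <= w n) ->
  (forall n, 0 <= D n) -> (forall n, (0 < n)%N -> D n <= w n - w n.+1) ->
  (\esum_(n in [set n : nat | (0 < n)%N]) (D n)%:E <= (w 1%N)%:E)%E.
Proof.
move=> w0 D0 Dw; rewrite -(@nneseries_esum _ _ (fun n => 0 < n)%N); last first.
  by move=> n _; rewrite lee_fin.
apply: lime_le; first by apply: is_cvg_nneseries_cond => n _ _; rewrite lee_fin.
apply: nearW => n; rewrite sumEFin lee_fin.
have -> : \sum_(0 <= i < n | (0 < i)%N) D i = \sum_(1 <= i < n) D i.
  case: n => [|n]; first by rewrite !big_geq.
  by rewrite big_mkcond big_nat_recl//= add0r big_add1.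
apply: (@le_trans _ _ (\sum_(1 <= i < n) (w i - w i.+1))).
  by rewrite big_nat_cond [leRHS]big_nat_cond; apply: ler_sum => i /andP[/andP[i0 _] _]; exact: Dw.
case: n => [|n]; first by rewrite big_geq.
rewrite (eq_bigr (fun i => - (w i.+1 - w i))) => [|i _]; last by rewrite opprB.
by rewrite sumrN telescope_sumr// opprB gerBl.
Qed.

(** The codes with winner [i] are [(t, n)] and [(t', n)], which differ by the order of the losers.
    By [cell_split] the two cells for [n] add up to at most [w n - w n.+1], since the losing column
    sums grow by [a] with [n]; the telescoped total [w 1] is the cell of [s]. *)
Lemma cell_esum s i : rpositive s ->
  (\esum_(c in [set c : code | winner_of c = i /\ (0 < c.2)%N])
     (cell (ract s c) (c.1 1))%:E <= (cell s i)%:E)%E.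
Proof.
move=> s0; pose t : 'S_3 := tperm 0 i.
have ti : t 0 = i by rewrite /t tpermL.
pose t2 : 'S_3 := tperm 1 2; pose t' : 'S_3 := (t2 * t)%g.
have t20 : t2 0 = 0 by exact: tpermD.
have t'0 : t' 0 = t 0 by rewrite /t' permM t20.
have t'1 : t' 1 = t 2 by rewrite /t' permM /t2 tpermL.
have t'2 : t' 2 = t 1 by rewrite /t' permM /t2 tpermR.
have tt' : t' != t by apply: contraTneq isT => e; move: t'1; rewrite e => /perm_inj.
have c0 c j : (0 <= (cell (ract s c) j)%:E)%E.
  by rewrite lee_fin ltW// cell_gt0//; exact: ract_positive.
rewrite (esumID [set c : code | c.1 = t])//.
have E1 (u : 'S_3) : u 0 = i ->
    \esum_(c in [set c : code | (winner_of c = i /\ (0 < c.2)%N) /\ c.1 = u])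
      (cell (ract s c) (c.1 1))%:E =
    (\esum_(n in [set n : nat | (0 < n)%N]) (cell (ract s (u, n)) (u 1))%:E)%E.
  move=> ui; rewrite (reindex_esum [set n : nat | (0 < n)%N] _ (fun n => (u, n)))//.
  split=> //.
  - by move=> n m _ _ [].
  - by move=> [v n] /= [[_ n0] ->]; exists n.
rewrite (_ : _ `&` [set c | c.1 = t] =
  [set c : code | (winner_of c = i /\ (0 < c.2)%N) /\ c.1 = t])//.
rewrite (_ : _ `&` ~` [set c | c.1 = t] =
  [set c : code | (winner_of c = i /\ (0 < c.2)%N) /\ c.1 = t']); last first.
  apply/seteqP; split=> -[u n] [/= [ui n0] ut]; split=> //; last first.
    by rewrite ut; apply/eqP.
  rewrite /winner_of/= in ui; apply: perm3_eq; first by rewrite ui t'0.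
  have u10 : u 1 != t 0 by rewrite ti -ui (inj_eq perm_inj).
  have u11 : u 1 != t 1.
    by apply/eqP => u1; apply: ut; apply: perm3_eq; rewrite ?ui ?ti.
  rewrite t'1; move: u10 u11.
  by elim/(@perm3_forall t): (u 1); rewrite ?eqxx.
rewrite !E1 ?t'0// -esumD//.
pose a := s 0 (t 0).
pose w n := (2 * a * (s 0 (t 1) + n%:R * a) * (s 0 (t 2) + n%:R * a))^-1.
rewrite (eq_esum (b := fun n =>
  (cell (ract s (t, n)) (t 1) + cell (ract s (t', n)) (t' 1))%:E)); last first.
  by move=> n _; rewrite EFinD.
have a0 : 0 < a by exact: s0.
have pos n j : 0 < s 0 j + n%:R * a by rewrite ltr_wpDr// mulr_ge0// ltW.
have -> : cell s i = w 1%N.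
  rewrite /cell (prod_perm3 t) -ti /w mul1r -/a; congr (_^-1); ring.
apply: telescope_esum => n.
- by rewrite invr_ge0 !mulr_ge0 ?ltW.
- by rewrite addr_ge0 ?ltW// cell_gt0//; exact: ract_positive.
move=> _; have := cell_split a0 (pos n (t 1)) (pos n (t 2)).
have n1 : t 1 != t 0 by rewrite (inj_eq perm_inj).
have n2 : t 2 != t 0 by rewrite (inj_eq perm_inj).
have n1' : t' 1 != t' 0 by rewrite (inj_eq perm_inj).
have n2' : t' 2 != t' 0 by rewrite (inj_eq perm_inj).
have -> : cell (ract s (t, n)) (t 1) = ((s 0 (t 1) + n%:R * a + a) *
   (s 0 (t 1) + n%:R * a + (s 0 (t 1) + n%:R * a)) *
   (s 0 (t 1) + n%:R * a + (s 0 (t 2) + n%:R * a)))^-1.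
  by rewrite /cell (prod_perm3 t) ract_perm0 !ract_perm.
have -> : cell (ract s (t', n)) (t' 1) = ((s 0 (t 2) + n%:R * a + a) *
   (s 0 (t 2) + n%:R * a + (s 0 (t 1) + n%:R * a)) *
   (s 0 (t 2) + n%:R * a + (s 0 (t 2) + n%:R * a)))^-1.
  rewrite /cell (prod_perm3 t') ract_perm0 !ract_perm// t'0 t'1 t'2 -/a.
  by congr (_^-1); ring.
move=> h; apply: le_trans h _; rewrite /w.
rewrite (_ : s 0 (t 1) + n%:R * a + a = s 0 (t 1) + n.+1%:R * a); last by rewrite -natr1; ring.
by rewrite (_ : s 0 (t 2) + n%:R * a + a = s 0 (t 2) + n.+1%:R * a)//; rewrite -natr1; ring.
Qed.

(** A path with prescribed first winner. Unlike [is_path] it accepts the empty sequence, which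
    arises when the first code is split off. *)
Fixpoint chain (i : 'I_3) (g : seq code) : bool :=
  if g is c :: g' then [&& winner_of c == i, (0 < c.2)%N & chain (c.1 1) g']
  else true.

Definition chain_end (i : 'I_3) (g : seq code) : 'I_3 :=
  if g is [::] then i else next_winner g.

Lemma chain_end_cons i c g : chain_end i (c :: g) = chain_end (c.1 1) g.
Proof. by case: g. Qed.

Lemma is_path_chain g : is_path g -> chain (winner_of (head (1%g, 0%N) g)) g.
Proof.
elim: g => [//|c g IH]; rewrite is_path_cons => /andP[c0]; rewrite /= eqxx c0/=.
case: g IH => // c' g IH /= /andP[+ p]; rewrite admissibleE => /eqP <-.
exact: IH.
Qed.

Lemma cell_Apath_gt0 s g i : rpositive s -> 0 < cell (s *m Apath g) i.
Proof.
move=> s0; apply: cell_gt0; elim: g s s0 => [|c g IH] s s0.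
  by rewrite Apath_nil mulmx1.
by rewrite Apath_cons mulmxA; apply: IH; exact: ract_positive.
Qed.

Definition antichain (V : set (seq code)) : Prop :=
  forall g h, V g -> V h -> prefix g h -> g = h.

(** After a fixed first code the remainders again form an antichain, bounded by induction, and
    [cell_esum] adds up the resulting cells. An antichain containing the empty word has no other
    element. *)
Lemma cell_antichain_bounded n s i (V : set (seq code)) : rpositive s ->
  (forall g, V g -> chain i g /\ (size g <= n)%N) -> antichain V ->
  (\esum_(g in V) (cell (s *m Apath g) (chain_end i g))%:E <= (cell s i)%:E)%E.
Proof.
elim: n s i V => [|n IH] s i V s0 hV aV.
  have V0 : V `<=` [set [::]] by move=> g /hV[_]; rewrite leqn0 size_eq0 => /eqP.
  have [Vn|Vn] := pselect (V [::]).
    have -> : V = [set [::]] by apply/seteqP; split=> // g ->.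
    by rewrite esum_set1 ?lee_fin Apath_nil mulmx1//; exact/ltW/cell_gt0.
  have -> : V = set0 by rewrite -subset0 => g Vg; apply: Vn; rewrite -(V0 _ Vg).
  by rewrite esum_set0 lee_fin ltW// cell_gt0.
have [Vn|Vn] := pselect (V [::]).
  have -> : V = [set [::]].
    apply/seteqP; split=> [g Vg|g -> //]; apply/esym/aV => //; exact: prefix0s.
  by rewrite esum_set1 ?lee_fin Apath_nil mulmx1//; exact/ltW/cell_gt0.
rewrite (reindex_esum (setT `*`` (fun c : code => [set g | V (c :: g)])) _
  (fun p => p.1 :: p.2)); last first.
  split=> //.
  - by move=> [c g] [].
  - by move=> [c g] [c' g'] _ _ [-> ->].
  - by move=> [|c g] // Vg; exists (c, g).
rewrite -(@esum_esum _ _ _ setT _ (fun c g =>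
  (cell (s *m Apath (c :: g)) (chain_end i (c :: g)))%:E)); last first.
  by move=> c g _ _; rewrite lee_fin ltW// cell_Apath_gt0.
apply: le_trans (cell_esum i s0); rewrite [leRHS]esum_mkcond.
apply: le_esum => c _; case: ifPn => [|hc].
  rewrite inE => -[wc c0].
  rewrite (eq_esum (b := fun g =>
    (cell (ract s c *m Apath g) (chain_end (c.1 1) g))%:E)); last first.
    by move=> g _; rewrite Apath_cons mulmxA chain_end_cons.
  apply: IH; first exact: ract_positive.
    by move=> g /= /hV /= [/and3P[_ _ ->]].
  by move=> g h /= Vg Vh gh; have := aV _ _ Vg Vh; rewrite /= eqxx => /(_ gh) [].
rewrite (_ : [set g | _] = set0) ?esum_set0//.
rewrite -subset0 => g /= /hV[/= /and3P[/eqP wc c0 _] _].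
by move/negP: hc; apply; rewrite inE.
Qed.

Lemma cell_antichain s i (V : set (seq code)) : rpositive s ->
  (forall g, V g -> chain i g) -> antichain V ->
  (\esum_(g in V) (cell (s *m Apath g) (chain_end i g))%:E <= (cell s i)%:E)%E.
Proof.
move=> s0 hV aV; apply: ge_ereal_sup => _ [X [finX XV] <-].
rewrite -esum_fset//; last by move=> g _; rewrite lee_fin ltW// cell_Apath_gt0.
(* A finite partial sum involves words of bounded length only. *)
have [n hn] : exists n, forall g, X g -> (size g <= n)%N.
  move/finite_seqP: finX => [r ->]; exists (\max_(g <- r) size g)%N => g /= gr.
  exact: leq_bigmax_seq.
have := @cell_antichain_bounded n s i X s0.
apply; last by move=> g h /XV Vg /XV Vh; exact: aV.
by move=> g Xg; split; [exact/hV/XV|exact: hn].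
Qed.

Definition rones : 'rV[R]_3 := const_mx 1.

(** The column sums add up to [pnorm g], so each of the three factors is at most [2 * pnorm g]. *)
Lemma cell_pnorm g i : (8 * pnorm g ^+ 3)^-1 <= cell (rones *m Apath g) i :> R.
Proof.
have r0 : rpositive rones by move=> j; rewrite mxE.
have p0 : rpositive (rones *m Apath g).
  elim: g (rones) r0 => [|c g IH] s s0; first by rewrite Apath_nil mulmx1.
  by rewrite Apath_cons mulmxA; apply: IH; exact: ract_positive.
have sE : pnorm g = \sum_j (rones *m Apath g) 0 j.
  rewrite /pnorm /vsum (eq_bigr (fun i => \sum_j Apath g i j)); last first.
    by move=> k _; rewrite mxE; apply: eq_bigr => j _; rewrite !mxE mulr1.
  rewrite exchange_big; apply: eq_bigr => j _; rewrite mxE.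
  by apply: eq_bigr => k _; rewrite !mxE mul1r.
have le j : (rones *m Apath g) 0 j <= pnorm g.
  by rewrite sE (bigD1 j)//= lerDl sumr_ge0// => k _; exact: ltW.
rewrite /cell lef_pV2 ?posrE; last 2 first.
- by rewrite mulr_gt0// exprn_gt0// pnorm_gt0.
- by apply: prodr_gt0 => j _; rewrite addr_gt0.
have -> : 8 * pnorm g ^+ 3 = \prod_(j < 3) (2 * pnorm g) :> R.
  by rewrite prodr_const card_ord; ring.
apply: ler_prod => j _; apply/andP; split; first by rewrite addr_ge0 ?ltW.
by have := le i; have := le j; lra.
Qed.

Section ReturnWordSum.
Context (gs : seq code) (gs_path : is_path gs).

Let gs0 : gs != [::]. Proof. by case/andP: gs_path. Qed.

Lemma return_word_head w : return_word gs w ->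
  head (1%g, 0%N) (w ++ gs) = head (1%g, 0%N) gs.
Proof.
case/and4P => _ _ /prefixP[r ->] _.
by case: (gs) gs0.
Qed.

(** A proper prefix would place an occurrence of [gs] strictly inside [w' ++ gs], against the first
    return. *)
Lemma return_word_antichain w w' : return_word gs w -> return_word gs w' ->
  prefix (w ++ gs) (w' ++ gs) -> w = w'.
Proof.
move=> hw hw' /prefixP[r e].
have sz : (size w <= size w')%N.
  by rewrite -(leq_add2r (size gs)) -!size_cat e (size_cat (w ++ gs)) leq_addr.
have [es|ns] := eqVneq (size w) (size w').
  by move: e => /eqP; rewrite -catA eqseq_cat ?es// => /andP[/eqP].
have lt : (0 < size w < size w')%N.
  by apply/andP; split; [case/and4P: hw|rewrite ltn_neqAle ns sz].
have := return_word_inner gs_path hw' lt; rewrite e -catA drop_size_cat//.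
by rewrite prefix_prefix.
Qed.

Lemma return_word_sum :
  (\esum_(w in [set w | return_word gs w]) ((pnorm w ^+ 3)^-1 : R)%:E < +oo)%E.
Proof.
pose i := winner_of (head (1%g, 0%N) gs).
have r0 : rpositive rones by move=> j; rewrite mxE.
pose V := [set w ++ gs | w in [set w | return_word gs w]].
have VE : (\esum_(g in V) (cell (rones *m Apath g) (chain_end i g))%:E =
    \esum_(w in [set w | return_word gs w])
      (cell (rones *m Apath (w ++ gs)) (chain_end i (w ++ gs)))%:E)%E.
  rewrite (reindex_esum [set w | return_word gs w] _ (fun w => w ++ gs))//.
  split=> //.
    by move=> w hw; exists w.
  move=> w w' _ _ e; have /eqP := congr1 size e.
  rewrite !size_cat eqn_add2r => /eqP es.
  by move/eqP: e; rewrite eqseq_cat// => /andP[/eqP].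
have M0 := @pnorm_gt0 R gs.
have c0 g j : (0 <= (cell (rones *m Apath g) j)%:E)%E.
  by rewrite lee_fin ltW// cell_Apath_gt0.
(* The antichain consists of the words [w ++ gs]; [pnorm_cat] trades the norm of [w] for theirs at
   the cost [pnorm gs ^+ 3]. *)
apply: (@le_lt_trans _ _ (\esum_(w in [set w | return_word gs w])
  ((8 * pnorm gs ^+ 3)%:E * (cell (rones *m Apath (w ++ gs)) (chain_end i (w ++ gs)))%:E))%E).
  apply: le_esum => w _; rewrite -EFinM lee_fin.
  apply: (@le_trans _ _ (8 * pnorm gs ^+ 3 * (8 * pnorm (w ++ gs) ^+ 3)^-1)).
    have w0 := @pnorm_gt0 R w; have wg0 := @pnorm_gt0 R (w ++ gs).
    rewrite ler_pdivlMr ?mulr_gt0 ?exprn_gt0// mulrC ler_pdivrMr ?exprn_gt0//.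
    rewrite -mulrA ler_pM2l// -exprMn mulrC.
    by apply: lerXn2r; rewrite ?nnegrE; [exact: ltW|exact/ltW/mulr_gt0|exact: pnorm_cat].
  rewrite ler_pM2l ?cell_pnorm// mulr_gt0// exprn_gt0//.
rewrite esumZl//; last by rewrite mulr_ge0// exprn_ge0// ltW.
rewrite lte_mul_pinfty// ?lee_fin ?mulr_ge0 ?exprn_ge0 ?ltW//.
rewrite -VE; apply: le_lt_trans (ltry (cell rones i)).
apply: cell_antichain => //.
  move=> _ [w hw <-]; rewrite /i -(return_word_head hw).
  by apply: is_path_chain; case/and4P: hw.
by move=> _ _ [w hw <-] [w' hw' <-] /(return_word_antichain hw hw') ->.
Qed.

End ReturnWordSum.
End Summability.

(** * Borel measures determined by cylinders *)

(** At most one extra code is used: it wins where [gs] prescribes, and its second index is the first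
    winner of [gs]. *)
Lemma connecting_path gs : is_path gs -> exists p, is_path (gs ++ p ++ gs).
Proof.
move=> pgs; have gs0 : gs != [::] by case/andP: pgs.
pose c := last (1%g, 0%N) gs; pose c' := head (1%g, 0%N) gs.
have [e|ne] := eqVneq (c'.1 0) (c.1 1).
  by exists [::]; rewrite /= is_path_cat// pgs admissibleE e eqxx.
have [t [t0 t1]] := perm3_exists ne.
have [u [u0 u1]] := @perm3_exists (c.1 1) (c'.1 0) ltac:(by rewrite eq_sym).
exists [:: (u, 1%N)]; rewrite (is_path_cat (g := gs))// is_path_cons /= pgs.
rewrite !admissibleE /= u0 eqxx andbT -[head _ gs]/(head (u, 1%N) gs).
by rewrite /c' in u1; case: (gs) gs0 u1 => // d g' _ /= ->; rewrite eqxx.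
Qed.

(** The first reappearance of [gs] along [gs ++ p ++ gs] cuts out a return word. *)
Lemma return_word_exists gs : is_path gs -> exists w, return_word gs w.
Proof.
move=> pgs; have gs0 : gs != [::] by case/andP: pgs.
have [p pp] := connecting_path pgs.
set g := gs ++ p ++ gs in pp.
have ex : exists k, (0 < k)%N && prefix gs (drop k g).
  exists (size (gs ++ p)); rewrite size_cat addn_gt0 lt0n size_eq0 gs0/=.
  by rewrite -size_cat /g catA drop_size_cat// prefix_refl.
case: (ex_minnP ex) => k /andP[k0 /prefixP[r hr]] kmin.
have kg : (k < size g)%N.
  have := congr1 size hr; rewrite size_drop size_cat => e.
  by rewrite -subn_gt0 e addn_gt0 lt0n size_eq0 gs0.
have eg : g = (take k g ++ gs) ++ r by rewrite -catA -hr cat_take_drop.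
have sk : size (take k g) = k by rewrite size_takel// ltnW.
exists (take k g); rewrite /return_word sk k0; apply/and4P; split=> //.
- by rewrite eg in pp; apply: is_path_catl pp _; case: (take k g) => //; case: (gs) gs0.
- have : take (size gs) g = gs by rewrite /g take_size_cat.
  rewrite {1}eg takel_cat ?size_cat ?leq_addl// => e.
  by rewrite -[X in prefix X _]e; exact: prefix_take.
- apply/allP => j; rewrite mem_iota => hj; apply/negP => /prefixP[s hs].
  have jk : (j < k)%N by lia.
  have e2 : drop j g = gs ++ s ++ r.
    by rewrite {1}eg drop_cat size_cat sk (ltn_addr _ jk) hs catA.
  have : (k <= j)%N by apply: kmin; rewrite e2 prefix_prefix andbT; lia.
  by rewrite leqNgt jk.
Qed.

Lemma esum_pickle {R : realType} {W : countType} (f : W -> \bar R) :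
  (forall b, 0 <= f b)%E -> (\esum_(b in setT) f b =
  \sum_(k <oo) if @pickle_inv W k is Some b then f b else 0)%E.
Proof.
move=> f0; pose g k := if @pickle_inv W k is Some b then f b else 0%E.
have g0 k : (0 <= g k)%E by rewrite /g; case: pickle_inv.
rewrite -/g nneseries_esumT//.
have -> : (\esum_(b in setT) f b = \esum_(b in [set: W]) g (pickle b))%E.
  by apply: eq_esum => b _; rewrite /g pickleK_inv.
rewrite -(@reindex_esum _ _ _ setT (range (@pickle W)) pickle g); last first.
  split.
  - by move=> b _; exists b.
  - by move=> b c _ _ /(congr1 (@pickle_inv W)); rewrite !pickleK_inv => -[].
  - by move=> k.
rewrite esum_mkcond; apply: eq_esum => k _; case: ifPn => // kn.
rewrite /g; case e : pickle_inv => [b|//]; exfalso.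
move/negP: kn; apply; rewrite inE; exists b => //.
by have := @pickle_invK W k; rewrite e.
Qed.

Lemma measure_countable_bigcup {R : realType} {W : countType} d
    (T : measurableType d) (mu : {measure set T -> \bar R}) (F : W -> set T) :
  (forall b, measurable (F b)) ->
  (forall b c t, F b t -> F c t -> b = c) ->
  (mu (\bigcup_b F b) = \esum_(b in [set: W]) mu (F b))%E.
Proof.
move=> mF dF; pose G k := if @pickle_inv W k is Some b then F b else set0.
have -> : \bigcup_b F b = \bigcup_k G k.
  apply/seteqP; split=> t [].
    by move=> b _ Fb; exists (pickle b) => //; rewrite /G pickleK_inv.
  by move=> k _; rewrite /G; case: pickle_inv => // b Fb; exists b.
rewrite measure_bigcup//; last 2 first.
- by move=> k _; rewrite /G; case: pickle_inv.
- apply/trivIsetP => j k _ _; rewrite /G.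
  case ej : (pickle_inv j) => [b|]; last by rewrite set0I.
  case ek : (pickle_inv k) => [c|]; last by rewrite setI0.
  apply: contraNeq => /set0P[t [/dF h /h bc]].
  have := @pickle_invK W j; have := @pickle_invK W k.
  by rewrite ej ek /= bc => <- <-.
rewrite esum_pickle//.
rewrite (@eq_eseriesl _ _ xpredT) => [|k]; last by rewrite in_setT.
apply: eq_eseriesr => k _; rewrite /G.
by case: pickle_inv => //; rewrite measure0.
Qed.

(** * Coding a weight on words by nested intervals *)

Section Intervals.
Context {R : realType} {W : countType} (m : seq W -> R) (b0 : W).
Hypotheses (m0 : forall u, 0 < m u) (m1 : m [::] = 1) (mr : right_consistent m).

(** Children are laid side by side in the order of [pickle]; a number that codes no letter gets an
    empty slot. *)
Definition child_weight (v : seq W) (k : nat) : R :=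
  if @pickle_inv W k is Some b then m (rcons v b) else 0.

Definition offset v k : R := \sum_(i < k) child_weight v i.

Let cw0 v k : 0 <= child_weight v k.
Proof. by rewrite /child_weight; case: pickle_inv => // b; exact: ltW. Qed.

Let offsetS v k : offset v k.+1 = offset v k + child_weight v k.
Proof. by rewrite /offset big_ord_recr. Qed.

Let offset_le v j k : (j <= k)%N -> offset v j <= offset v k.
Proof.
move=> /subnK <-; elim: (k - j)%N => // n IH; rewrite addSn offsetS.
by apply: le_trans IH _; rewrite lerDl.
Qed.

Let child_pickle v b : child_weight v (pickle b) = m (rcons v b).
Proof. by rewrite /child_weight pickleK_inv. Qed.

Let child_sum v : (\sum_(k <oo) (child_weight v k)%:E = (m v)%:E)%E.
Proof.
rewrite -(mr v) esum_pickle => [|b]; last by rewrite lee_fin ltW.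
by apply: eq_eseriesr => k _; rewrite /child_weight; case: pickle_inv.
Qed.

Let offset_max v k : offset v k <= m v.
Proof.
rewrite -lee_fin -child_sum.
have := @nneseries_lim_ge R (fun i => (child_weight v i)%:E) xpredT 0%N k _.
rewrite sumEFin big_mkord; apply => i _.
by rewrite lee_fin.
Qed.

Fixpoint left_from (v u : seq W) : R :=
  if u is b :: u' then offset v (pickle b) + left_from (rcons v b) u' else 0.

Definition left_end := left_from [::].

Let left_rcons u b : left_end (rcons u b) = left_end u + offset u (pickle b).
Proof.
suff E v : left_from v (rcons u b) = left_from v u + offset (v ++ u) (pickle b).
  by rewrite /left_end E.
elim: u v => [|c u IH] v /=; first by rewrite cats0 addr0 add0r.
by rewrite IH addrA cat_rcons.
Qed.

Definition word_interval u : set R := `[left_end u, left_end u + m u[%classic.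

Let in_word u (t : R) :
  word_interval u t <-> left_end u <= t /\ t < left_end u + m u.
Proof. by rewrite /word_interval /= in_itv/=; split=> /andP. Qed.

Lemma word_interval_sub u b : word_interval (rcons u b) `<=` word_interval u.
Proof.
move=> t /in_word[]; rewrite left_rcons => h1 h2; apply/in_word; split.
  apply: le_trans h1; rewrite lerDl.
  by rewrite /offset sumr_ge0.
apply: lt_le_trans h2 _; rewrite -addrA lerD2l -child_pickle -offsetS.
exact: offset_max.
Qed.

(** Right consistency makes the children fill the parent; the first partial sum exceeding
    [t - left_end u] selects the child. *)
Lemma word_interval_cover u t : word_interval u t ->
  exists b, word_interval (rcons u b) t.
Proof.
move=> /in_word[h1 h2].
have ex : exists k, t - left_end u < offset u k.
  apply: contrapT => /forallNP h.
  have : m u <= t - left_end u.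
    rewrite -lee_fin -child_sum; apply: lime_le.
      by apply: is_cvg_nneseries => k _ _; rewrite lee_fin.
    apply: nearW => k; rewrite sumEFin big_mkord lee_fin leNgt.
    by apply/negP; exact: h.
  by move: h2; lra.
case: (ex_minnP ex) => -[|k] hk kmin.
  by exfalso; move: hk; rewrite /offset big_ord0; lra.
have hk' : offset u k <= t - left_end u.
  by rewrite leNgt; apply/negP => /kmin; rewrite ltnn.
move: hk; rewrite offsetS /child_weight; case e : pickle_inv => [b|]; last by lra.
move=> hk; exists b; apply/in_word; rewrite left_rcons.
have -> : pickle b = k by have := @pickle_invK W k; rewrite e.
by split; lra.
Qed.

Lemma word_interval_disjoint u b c t : word_interval (rcons u b) t ->
  word_interval (rcons u c) t -> b = c.
Proof.
have lt d e : word_interval (rcons u d) t -> word_interval (rcons u e) t ->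
    (pickle d < pickle e)%N -> False.
  move=> /in_word[_ h2] /in_word[h1 _] /(offset_le u).
  by move: h1 h2; rewrite !left_rcons offsetS child_pickle; lra.
move=> hb hc; apply: (pcan_inj pickleK_inv).
by case: (ltngtP (pickle b) (pickle c)) => // h; exfalso; [exact: (lt b c)|exact: (lt c b)].
Qed.

(** The default [b0] is taken only for [t] outside [[0, 1[]. *)
Fixpoint coded_prefix (t : R) (n : nat) : seq W :=
  if n is n'.+1 then let v := coded_prefix t n' in
    rcons v (xget b0 [set b | word_interval (rcons v b) t])
  else [::].

Definition coding (t : R) (n : nat) : W :=
  xget b0 [set b | word_interval (rcons (coded_prefix t n) b) t].

Lemma mkseq_coding t n : mkseq (coding t) n = coded_prefix t n.
Proof.
elim: n => // n IH; rewrite -addn1 /mkseq iotaD map_cat -/(mkseq _ _) IH add0n.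
by rewrite /= cats1 addn1.
Qed.

Lemma unit_word_interval : word_interval [::] = `[0, 1[%classic.
Proof. by rewrite /word_interval /left_end /= m1 add0r. Qed.

Lemma coded_prefixP t n : `[0, 1[%classic t -> word_interval (coded_prefix t n) t.
Proof.
move=> t01; elim: n => [|n IH]; first by rewrite unit_word_interval.
have [b hb] := word_interval_cover IH.
rewrite /=; apply: (@xgetPex _ b0 [set b | word_interval (rcons (coded_prefix t n) b) t]).
by exists b.
Qed.

Lemma word_intervalE u : word_interval u =
  `[0, 1[%classic `&` [set t | mkseq (coding t) (size u) = u].
Proof.
apply/seteqP; split=> t.
  elim/last_ind: u => [|u b IH] ht; first by rewrite unit_word_interval in ht.
  have [t01 e] := IH (word_interval_sub ht).
  split=> //; rewrite /= mkseq_coding size_rcons /=.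
  have := coded_prefixP (size u).+1 t01; rewrite /= -mkseq_coding e.
  by set c := xget _ _ => hc; rewrite (word_interval_disjoint ht hc).
by move=> [t01 /= e]; rewrite -e mkseq_coding; exact: coded_prefixP.
Qed.

Lemma word_interval_measure u : lebesgue_measure (word_interval u) = (m u)%:E.
Proof.
rewrite /word_interval lebesgue_measure_itv /= lte_fin ltrDl m0.
by rewrite -EFinD addrAC subrr add0r.
Qed.

Lemma word_interval_measurable u : measurable (word_interval u).
Proof. exact: measurable_itv. Qed.

End Intervals.

Lemma take_mkseq (T : Type) (f : nat -> T) k n :
  (k <= n)%N -> take k (mkseq f n) = mkseq f k.
Proof. by move=> kn; rewrite /mkseq -map_take take_iota (minn_idPl kn). Qed.

(** * Measurability of cylinders and the topology they generate *)

Section BorelSets.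
Context {R : realType}.

Lemma open_borelR3 (O : set 'cV[R]_3) : open O -> measurable (O : set (borelR3 R)).
Proof. by move=> oO; exact: sub_sigma_algebra. Qed.

Lemma continuous_linear_form (c : 'I_3 -> R) :
  continuous (fun l : 'cV[R]_3 => \sum_j c j * l j 0).
Proof.
have -> : (fun l : 'cV[R]_3 => \sum_j c j * l j 0) =
    fun l : 'cV[R]_3 => c 0 * l 0 0 + c 1 * l 1 0 + c 2 * l 2 0.
  by apply/funext => l; rewrite (sum3 (fun j => c j * l j 0)).
have h j : continuous (fun l : 'cV[R]_3 => c j * l j 0).
  by move=> l; apply: continuousM; [exact: cst_continuous|exact: coord_continuous].
by move=> l; exact: continuousD (continuousD (h 0 l) (h 1 l)) (h 2 l).
Qed.

Lemma open_linear_gt0 (c : 'I_3 -> R) :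
  open [set l : 'cV[R]_3 | 0 < \sum_j c j * l j 0].
Proof.
have /continuousP := @continuous_linear_form c.
by move=> /(_ [set x | 0 < x]); apply; exact: open_gt.
Qed.

Lemma measurable_vsum1 : measurable ([set l | vsum l = 1] : set (borelR3 R)).
Proof.
rewrite -[X in measurable X]setCK; apply: measurableC; apply: open_borelR3.
have /continuousP := @continuous_linear_form (fun=> 1).
move=> /(_ (~` [set 1])); rewrite (_ : _ @^-1` _ = ~` [set l | vsum l = 1]).
  by apply; apply: closed_openC; exact: closed_eq.
apply/seteqP; split=> l /=.
  by under eq_bigr do rewrite mul1r.
by under [X in _ -> ~ (X = _)]eq_bigr do rewrite mul1r.
Qed.

Lemma measurable_cone g : measurable ([set l | cone g l] : set (borelR3 R)).
Proof.
pose A : 'M[R]_3 := invmx (Apath g); pose i := next_winner g.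
have -> : [set l | cone g l] = (\bigcap_(j in [set: 'I_3])
    [set l : 'cV[R]_3 | 0 < \sum_k A j k * l k 0]) `&`
  [set l : 'cV[R]_3 | 0 < \sum_k (A i k - \sum_(j | j != i) A j k) * l k 0].
  have E (l : 'cV[R]_3) j : (A *m l) j 0 = \sum_k A j k * l k 0 by rewrite mxE.
  have E2 (l : 'cV[R]_3) : \sum_k (A i k - \sum_(j | j != i) A j k) * l k 0 =
      (A *m l) i 0 - \sum_(j | j != i) (A *m l) j 0.
    rewrite E (eq_bigr (fun j => \sum_k A j k * l k 0)
      (F1 := fun j => (A *m l) j 0)) => [|j _]; last by rewrite E.
    rewrite exchange_big -sumrB; apply: eq_bigr => k _.
    by rewrite mulrBl mulr_suml.
  apply/seteqP; split=> l.
    move=> /dominatesP[p d]; split; last by rewrite /= E2 subr_gt0.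
    by move=> j _; rewrite /= -E.
  move=> [p]; rewrite /= E2 subr_gt0 => d; apply/dominatesP; split=> // j.
  by have := p j I; rewrite /= -E.
apply: measurableI; last first.
  apply: open_borelR3.
  exact: (@open_linear_gt0 (fun k => A i k - \sum_(j | j != i) A j k)).
apply: fin_bigcap_measurable; first exact: finite_finset.
by move=> j _; apply: open_borelR3; exact: (@open_linear_gt0 (A j)).
Qed.

Lemma measurable_countable_union (W : countType) (P : W -> Prop)
    (F : W -> set (borelR3 R)) : (forall b, P b -> measurable (F b)) ->
  measurable (\bigcup_(b in [set b | P b]) F b).
Proof.
move=> mF; rewrite bigcup_mkcond; apply: countable_bigcupT_measurable.
  exact: countableP.
by move=> b; case: ifP => // /set_mem; exact: mF.
Qed.

Lemma measurable_gasket : measurable (gasket : set (borelR3 R)).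
Proof.
have -> : gasket = [set l : 'cV[R]_3 | vsum l = 1] `&` \bigcap_n
    \bigcup_(g in [set g | is_path g /\ size g = n.+1]) [set l | cone g l].
  apply/seteqP; split=> l.
    move=> /gasket_cone[l1 h]; split=> // n _; have [g [p s c]] := h n.
    by exists g.
  move=> [l1 h]; apply/gasket_cone; split=> // n.
  by have [g [p s] c] := h n I; exists g.
apply: measurableI; first exact: measurable_vsum1.
apply: bigcapT_measurable => n; apply: measurable_countable_union => g _.
exact: measurable_cone.
Qed.

Context (gs : seq code) (gs_path : is_path gs) (gs_complete : complete_path gs).

Lemma measurable_return_domain :
  measurable (return_domain gs : set (borelR3 R)).
Proof.
have -> : return_domain gs = (gasket `&` [set l : 'cV[R]_3 | cone gs l]) `&`
    \bigcap_N \bigcup_(g in [set g | (N < size g)%N /\ is_path (g ++ gs)])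
      [set l | cone (g ++ gs) l].
  apply/seteqP; split=> l.
    move=> /(return_domain_cone gs_path)[hg hc h]; split=> // N _.
    by have [g [p s c]] := h N; exists g.
  move=> [[hg hc] h]; apply/return_domain_cone => //; split=> // N.
  by have [g [p s] c] := h N I; exists g.
apply: measurableI.
  by apply: measurableI; [exact: measurable_gasket|exact: measurable_cone].
apply: bigcapT_measurable => n; apply: measurable_countable_union => g _.
exact: measurable_cone.
Qed.

Lemma measurable_cylinder u : measurable (cylinder gs u : set (borelR3 R)).
Proof.
have [hu|hu] := boolP (all (return_word gs) u); last first.
  rewrite (_ : cylinder gs u = set0)// -subset0 => l /(cylinder_words gs_path).
  by rewrite (negbTE hu).
rewrite (_ : cylinder gs u = return_domain gs `&` [set l | cone (flatten u ++ gs) l]).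
  by apply: measurableI; [exact: measurable_return_domain|exact: measurable_cone].
by apply/seteqP; split=> l; move=> /(cylinder_cone gs_path _ hu).
Qed.

Definition rword : Type := {w : seq code | return_word gs w}.
HB.instance Definition _ := Countable.on rword.

Definition vals (u : seq rword) : seq (seq code) := [seq val w | w <- u].

Lemma vals_return u : all (return_word gs) (vals u).
Proof. by apply/allP => w /mapP[v _ ->]; exact: valP. Qed.

Lemma vals_inj : injective vals.
Proof. exact/inj_map/val_inj. Qed.

Lemma vals_surj (u : seq (seq code)) : all (return_word gs) u -> exists v, vals v = u.
Proof.
elim: u => [|w u IH] /=; first by exists [::].
by move=> /andP[hw /IH[v <-]]; exists ((Sub w hw : rword) :: v).
Qed.

Definition rcyl (u : seq rword) : set 'cV[R]_3 := cylinder gs (vals u).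

Lemma rcyl_itinerary (x : 'cV[R]_3) n : return_domain gs x ->
  exists u : seq rword, size u = n /\ rcyl u x.
Proof.
move=> hx.
have hc : cylinder gs (mkseq (fun k => return_path gs (iter k (return_map gs) x)) n) x.
  by split=> //; rewrite size_mkseq.
have [u eu] := vals_surj (cylinder_words gs_path hc).
by exists u; split; [rewrite -(size_map val) -/(vals u) eu size_mkseq|rewrite /rcyl eu].
Qed.

Lemma rcyl_take u k x : (k <= size u)%N -> rcyl u x -> rcyl (take k u) x.
Proof.
move=> ku [hx e]; split=> //.
rewrite /vals map_take size_takel ?size_map// -/(vals u) -e take_mkseq//.
by rewrite size_map.
Qed.

Lemma rcyl_uniq u v x : rcyl u x -> rcyl v x -> (size u <= size v)%N -> u = take (size u) v.
Proof.
move=> [hx e] [_ e'] uv; apply: vals_inj.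
rewrite /vals map_take -/(vals v) -e' -/(vals u) -[LHS]e take_mkseq ?size_map//.
Qed.

Lemma rcyl_eq u v x : rcyl u x -> rcyl v x -> size u = size v -> u = v.
Proof.
by move=> hu hv e; have := rcyl_uniq hu hv; rewrite e leqnn take_size => /(_ isT).
Qed.

(** The diameters of cylinders tend to 0 with the number of letters, by [cone_gap]. *)
Lemma open_rcyl (O : set 'cV[R]_3) x : open O -> return_domain gs x -> O x ->
  exists u, rcyl u x /\ rcyl u `<=` O.
Proof.
move=> oO hx Ox.
have [e e0 he] : exists2 e : R, 0 < e & forall y : 'cV[R]_3,
    (forall i, `|x i 0 - y i 0| < e) -> O y.
  have /nbhs_ballP[e /= e0 he] : nbhs x O by apply: open_nbhs_nbhs.
  exists e => // y hy; apply: he; split=> // i j; rewrite (ord1 j).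
  exact: hy.
have M3 := @pnorm_ge3 R gs.
pose q : R := 1 - (pnorm gs)^-1.
have M0 := @pnorm_gt0 R gs.
have Mi : 0 < (pnorm gs)^-1 :> R by rewrite invr_gt0.
have q0 : 0 <= q by rewrite subr_ge0 invf_le1//; lra.
have q1 : `|q| < 1 by rewrite ger0_norm// /q; lra.
have [k hk] : exists k : nat, q ^+ k * pnorm gs ^+ 2 < e.
  have /cvgrPdist_lt /(_ (e / pnorm gs ^+ 2)) := @cvg_expr R q q1.
  rewrite divr_gt0 ?exprn_gt0// => /(_ isT) [k _ /(_ k (leqnn k))] /=.
  rewrite sub0r normrN ger0_norm ?exprn_ge0// ltr_pdivlMr ?exprn_gt0// => h.
  by exists k.
have [u [su hu]] := rcyl_itinerary (k * size gs) hx.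
exists u; split=> // y hy; apply: he => i; apply: le_lt_trans hk.
have hv := vals_return u.
have [_ cx] := (cylinder_cone gs_path x hv).1 hu.
have [hy' cy] := (cylinder_cone gs_path y hv).1 hy.
have s1 z : return_domain gs z -> vsum z = 1 by move=> [[/gasketP[]]].
by apply: (cone_gap gs_path gs_complete hv) => //; rewrite ?size_map ?s1.
Qed.

(* An open set meets the return domain in a countable disjoint union of
   cylinders: those contained in it whose parent is not *)
Lemma borel_measure_unique (m1 m2 : probability (borelR3 R) R) :
  m1 (return_domain gs) = 1%E -> m2 (return_domain gs) = 1%E ->
  (forall u, m1 (rcyl u) = m2 (rcyl u)) ->
  forall A : set (borelR3 R), measurable A -> m1 A = m2 A.
Proof.
move=> h1 h2 h12 A mA.
apply: (@measure_unique _ _ (borelR3 R) (@open 'cV[R]_3) (fun=> setT)) => //.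
- by move=> B C oB oC; exact: openI.
- by move=> _; exact: openT.
- by rewrite bigcup_const//; exists 0%N.
- move=> O oO.
  have mO := open_borelR3 oO.
  have mX := measurable_return_domain.
  have trace (m : probability (borelR3 R) R) : m (return_domain gs) = 1%E ->
      m O = m (return_domain gs `&` O).
    move=> hm; rewrite -{1}(setIT O) -(setUv (return_domain gs)) setIUr.
    rewrite measureU//; last 3 first.
    + exact: measurableI.
    + by apply: measurableI => //; exact: measurableC.
    + by rewrite setIACA setICr setI0.
    rewrite [X in (_ + X)%E](_ : _ = 0%E) ?adde0 1?setIC//.
    apply/eqP; rewrite eq_le measure_ge0 andbT.
    have <- : m (~` return_domain gs) = 0%E.
      by rewrite probability_setC// hm subee.
    apply: le_measure; rewrite ?inE//.
    + by apply: measurableI => //; exact: measurableC.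
    + exact: measurableC.
  apply: (etrans (trace m1 h1)); apply: (etrans _ (esym (trace m2 h2))).
  pose minimal u := rcyl u `<=` O /\ forall k, (k < size u)%N -> ~ (rcyl (take k u) `<=` O).
  pose F u : set (borelR3 R) := if `[< minimal u >] then rcyl u else set0.
  have -> : return_domain gs `&` O = \bigcup_u F u.
    apply/seteqP; split=> [x [hx Ox]|x [u _]]; last first.
      by rewrite /F; case: asboolP => // -[uO _] hu; split; [case: hu|exact: uO].
    have [u [hu uO]] := open_rcyl oO hx Ox.
    have ex : exists k, (k <= size u)%N && `[< rcyl (take k u) `<=` O >].
      by exists (size u); rewrite leqnn take_size; apply/asboolP.
    case: (ex_minnP ex) => k /andP[ku /asboolP kO] kmin.
    exists (take k u) => //; rewrite /F; case: asboolP => [_|].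
      exact: rcyl_take.
    case; split=> // j; rewrite size_takel// => jk; rewrite take_takel ?(ltnW jk)// => jO.
    have : (k <= j)%N by apply: kmin; rewrite (leq_trans (ltnW jk))//; apply/asboolP.
    by rewrite leqNgt jk.
  have mF u : measurable (F u).
    by rewrite /F; case: asboolP => // _; exact: measurable_cylinder.
  have dF u v x : F u x -> F v x -> u = v.
    rewrite /F; case: asboolP => // -[uO um]; case: asboolP => // -[vO vm] hu hv.
    case: (ltngtP (size u) (size v)) => h; last exact: rcyl_eq hu hv h.
    - by exfalso; apply: (vm (size u)) => //; rewrite -(rcyl_uniq hu hv (ltnW h)).
    - by exfalso; apply: (um (size v)) => //; rewrite -(rcyl_uniq hv hu (ltnW h)).
  rewrite !measure_countable_bigcup//; apply: eq_esum => u _.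
  by rewrite /F; case: asboolP => _; [exact: h12|rewrite !measure0].
- by move=> _; exact: le_lt_trans (probability_le1 m1 measurableT) (ltry 1).
Qed.

End BorelSets.

(** * Laws of maps on the unit interval *)

Section Law.
Context {R : realType} (gs : seq code) (gs_path : is_path gs)
  (gs_complete : complete_path gs).

Definition unit_law (f : R -> borelR3 R) (mf : measurable_fun setT f) :
    set (borelR3 R) -> \bar R :=
  pushforward (mrestr lebesgue_measure (measurable_itv `[0, 1[)) f.

Section UnitLaw.
Context (f : R -> borelR3 R) (mf : measurable_fun setT f).

Let law0 : unit_law mf set0 = 0%E.
Proof. by rewrite /unit_law /pushforward preimage_set0 measure0. Qed.

Let law_ge0 A : (0 <= unit_law mf A)%E.
Proof. exact: measure_ge0. Qed.

Let law_sigma_additive : semi_sigma_additive (unit_law mf).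
Proof.
exact: (@measure_semi_sigma_additive _ _ _
  (pushforward (mrestr lebesgue_measure (measurable_itv `[0, 1[)) f)).
Qed.

HB.instance Definition _ := isMeasure.Build _ _ _
  (unit_law mf) law0 law_ge0 law_sigma_additive.

Let lawT : unit_law mf setT = 1%E.
Proof.
rewrite /unit_law /pushforward preimage_setT /mrestr setTI.
by rewrite lebesgue_measure_itv /= lte_fin ltr01 oppr0 adde0.
Qed.

HB.instance Definition _ := Measure_isProbability.Build _ _ _ (unit_law mf) lawT.

End UnitLaw.

(** Preimages of cylinders suffice for measurability, because every open set meets the return domain
    in a countable union of cylinders. *)
Lemma law_exists (f : R -> 'cV[R]_3) :
  (forall t, `[0, 1[%classic t -> return_domain gs (f t)) ->
  (forall u : seq (rword gs),
    measurable (`[0, 1[%classic `&` f @^-1` (rcyl u) : set R)) ->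
  exists P : probability (borelR3 R) R, forall A : set 'cV[R]_3,
    P A = lebesgue_measure (`[0, 1[%classic `&` f @^-1` A).
Proof.
move=> hX hm; pose f' t : borelR3 R := if t \in `[0, 1[%classic then f t else 0.
have mf : measurable_fun setT f'.
  apply: (@measurability _ _ _ (borelR3 R) setT f' (@open 'cV[R]_3)) => //.
  move=> _ [V oV <-]; rewrite setTI.
  have -> : f' @^-1` V = (`[0, 1[%classic `&` f @^-1` V) `|`
     (~` `[0, 1[%classic `&` [set _ | V 0]).
    apply/seteqP; split=> t; rewrite /f' /=.
      case: ifPn => [|]; first by rewrite inE; left.
      by rewrite notin_setE; right.
    by case=> [[ht Vt]|[ht V0]]; case: ifPn => //; rewrite ?inE// notin_setE.
  apply: measurableU; last first.
    apply: measurableI; first by apply: measurableC; exact: measurable_itv.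
    have [V0|V0] := pselect (V 0).
      by rewrite (_ : [set _ | _] = setT)//; apply/seteqP; split.
    by rewrite (_ : [set _ | _] = set0)//; apply/seteqP; split.
  have -> : `[0, 1[%classic `&` f @^-1` V =
    \bigcup_(u in [set u : seq (rword gs) | rcyl u `<=` V])
      (`[0, 1[%classic `&` f @^-1` (rcyl u)).
    apply/seteqP; split=> t.
      move=> [ht Vt]; have [u [hu uV]] := open_rcyl gs_path gs_complete oV (hX _ ht) Vt.
      by exists u.
    by move=> [u uV [ht hu]]; split=> //; exact: uV.
  rewrite bigcup_mkcond; apply: countable_bigcupT_measurable; first exact: countableP.
  by move=> u; case: ifP.
exists (unit_law mf) => A; rewrite /unit_law /= /pushforward /mrestr.
congr (lebesgue_measure _); rewrite setIC; apply/seteqP; split=> t [ht].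
  by rewrite /f' /= mem_set.
by move=> hA; split=> //=; rewrite /f' mem_set.
Qed.

End Law.

(** * Gibbs measures *)

Section Potential.
Context {R : realType} (gs : seq code) (gs_path : is_path gs)
  (gs_complete : complete_path gs) (kappa : R) (hkappa : 3 < kappa).
Implicit Types (u : seq (rword gs)) (w : seq (seq code)) (x : 'cV[R]_3).
Local Notation M := (pnorm gs : R).

Lemma return_domain_vsum x : return_domain gs x -> vsum x = 1.
Proof. by move=> [[/gasketP[]]]. Qed.

Lemma return_domain_positive x : return_domain gs x -> positive x.
Proof. by move=> [[[]]]. Qed.

Lemma cylinder_Apath w x : cylinder gs w x -> exists2 a, 0 < a &
  x = a *: (Apath (flatten w) *m iter (size w) (return_map gs) x).
Proof.
elim: w x => [|w0 w IH] x.
  by move=> _; exists 1; rewrite //= Apath_nil mul1mx scale1r.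
move=> /(cylinder_cons gs_path)[hx hw /IH[a a0 e]].
have [b b0 eb] := gasket_Apath (return_time gs x) hx.1.1.
exists (b * a); first exact: mulr_gt0.
rewrite iterSr {1}eb -/(return_path gs x) -/(return_map gs x) hw {1}e.
by rewrite /= Apath_cat -mulmxA -scalemxAr scalerA.
Qed.

(** [x] is proportional to [A_w y], where [y] is its return; both have sum 1, so the factor is the
    inverse of [vsum (A_w y)]. *)
Lemma roofE x : return_domain gs x ->
  roof gs x = ln (vsum (Apath (return_path gs x) *m return_map gs x)).
Proof.
move=> hx; have hy := return_domain_map gs_path hx.
have [a a0 e] := gasket_Apath (return_time gs x) hx.1.1.
rewrite -/(return_path gs x) -/(return_map gs x) in e.
have := return_domain_vsum hx; rewrite {1}e vsumZ => h.
have -> : vsum (Apath (return_path gs x) *m return_map gs x) = a^-1.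
  by rewrite -[RHS]mulr1 -h mulKf// gt_eqF.
rewrite lnV ?posrE// /roof; congr (- ln _).
rewrite {2}e -/(Apath _) -scalemxAr mulmxA mulVmx ?Apath_unit// mul1mx.
rewrite -[RHS]mulr1 -(return_domain_vsum hy) /l1norm /vsum mulr_sumr.
apply: eq_bigr => i _; rewrite colZE ger0_norm// mulr_ge0 ?(ltW a0)//.
exact/ltW/return_domain_positive.
Qed.

(** The roof is the logarithm of a matrix cocycle, so the sum along an orbit collapses to a single
    logarithm. *)
Lemma birkhoff_sumE w x : cylinder gs w x ->
  birkhoff_sum gs (fun l => - kappa * roof gs l) (size w) x =
  - kappa * ln (vsum (Apath (flatten w) *m iter (size w) (return_map gs) x)).
Proof.
elim: w x => [|w0 w IH] x.
  move=> /cylinder_nil hx; rewrite /birkhoff_sum big_ord0 /= Apath_nil mul1mx.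
  by rewrite return_domain_vsum// ln1 mulr0.
move=> hc; have /(cylinder_cons gs_path)[hx hw hy] := hc.
rewrite /birkhoff_sum /= big_ord_recl /=.
under eq_bigr => i _ do rewrite -iterS add0n iterSr.
rewrite -/(birkhoff_sum gs (fun l => - kappa * roof gs l) (size w) (return_map gs x)).
rewrite IH// -mulrDr roofE// hw -iterS iterSr.
have [b b0 e] := cylinder_Apath hy; move: (iter _ _ _) e => z e.
have vy := return_domain_vsum (return_domain_map gs_path hx).
have := vy; rewrite {1}e vsumZ => h.
have -> : vsum (Apath (flatten w) *m z) = b^-1.
  by rewrite -[RHS]mulr1 -h mulKf// gt_eqF.
have py := return_domain_positive (return_domain_map gs_path hx).
have p0 : 0 < vsum (Apath w0 *m return_map gs x).
  by apply: vsum_gt0; exact: Apath_positive.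
rewrite -lnM ?posrE ?invr_gt0//; congr (_ * ln _).
rewrite e -scalemxAr vsumZ mulrC mulKf ?gt_eqF//.
by rewrite Apath_cat mulmxA.
Qed.

Definition weight u : R := expR (- kappa * ln (pnorm (flatten (vals u)))).

Let kappa0 : 0 < kappa. Proof. by apply: lt_trans hkappa. Qed.

Lemma ln_pnorm_ge0 g : 0 <= ln (pnorm g : R).
Proof. by apply: ln_ge0; have := @pnorm_ge3 R g; lra. Qed.

(** The constant is [M] to the power [2 * kappa]. The negative exponent exchanges the two norm
    estimates: the upper bound comes from [pnorm_quasi], the lower one from [pnorm_cat]. *)
Lemma weight_quasi : quasi_multiplicative (expR (kappa * ln (M ^+ 2))) weight.
Proof.
move=> u w; rewrite /weight /vals map_cat flatten_cat -!/(vals _) -!expRD !ler_expR.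
move: (flatten (vals u)) (flatten_prefix (vals_return w)) => g.
move: (flatten (vals w)) => h [r hr].
have h1 : ln (pnorm (g ++ h) : R) <= ln (pnorm g) + ln (pnorm h).
  rewrite -lnM ?posrE ?pnorm_gt0// ler_ln ?posrE ?mulr_gt0 ?pnorm_gt0//.
  exact: pnorm_cat.
have h2 : ln (pnorm g) + ln (pnorm h) <= ln (M ^+ 2) + ln (pnorm (g ++ h)).
  rewrite -!lnM ?posrE ?exprn_gt0 ?pnorm_gt0//.
  rewrite ler_ln ?posrE ?mulr_gt0 ?exprn_gt0 ?pnorm_gt0//.
  exact: pnorm_quasi hr.
have h3 : 0 <= ln (M ^+ 2) by rewrite lnXn ?pnorm_gt0// mulrn_wge0// ln_pnorm_ge0.
move: h1 h2 h3.
move: (ln (pnorm g)) (ln (pnorm h)) (ln (pnorm (g ++ h))) (ln (M ^+ 2)) => a b c d.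
move=> /(ler_wpM2l (ltW kappa0)) h1 /(ler_wpM2l (ltW kappa0)) h2.
by move=> /(mulr_ge0 (ltW kappa0)) h3; split; lra.
Qed.

(** Norms are at least 3, so the exponent [kappa] improves on the exponent 3 of
    [return_word_sum]. *)
Lemma weight_summable : (\esum_(b in [set: rword gs]) (weight [:: b])%:E < +oo)%E.
Proof.
apply: le_lt_trans (return_word_sum (R := R) gs_path).
rewrite (reindex_esum [set: rword gs] _ val).
  apply: le_esum => b _; rewrite lee_fin /weight /= cats0.
  have L0 := ln_pnorm_ge0 (val b); have p0 := @pnorm_gt0 R (val b).
  rewrite -[leRHS]lnK ?posrE ?invr_gt0 ?exprn_gt0// ler_expR.
  rewrite lnV ?posrE ?exprn_gt0// lnXn// -mulr_natl.
  by move: (ln _) L0 => L L0; have := ler_wpM2r L0 (ltW hkappa); lra.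
split.
- by move=> b _ /=; exact: valP.
- by move=> b c _ _; exact: val_inj.
- by move=> w hw; exists (Sub w hw : rword gs).
Qed.

Lemma birkhoff_weight u x : rcyl u x ->
  weight u <= expR (birkhoff_sum gs (fun l => - kappa * roof gs l) (size u) x)
  <= expR (kappa * ln M) * weight u.
Proof.
move=> hu; rewrite -expRD !ler_expR.
have := birkhoff_sumE hu; rewrite size_map => ->.
have /return_domain_cone[//|_ /coneP[y ey /dominatesP[py _]] _] :=
  return_domain_iter_map gs_path (size u) hu.1.
have vz := return_domain_vsum (return_domain_iter_map gs_path (size u) hu.1).
move: (iter _ _ _) ey vz => z ey vz.
have /andP[h1 h2] :=
  complete_distortion gs_path gs_complete (flatten (vals u)) (positive_ge0 py) ey vz.
have M0 := @pnorm_gt0 R gs; have p0 := @pnorm_gt0 R (flatten (vals u)).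
have V0 : 0 < vsum (Apath (flatten (vals u)) *m z).
  by apply: lt_le_trans h1; rewrite mulr_gt0 ?invr_gt0.
move: h1; rewrite -ler_ln ?posrE ?mulr_gt0 ?invr_gt0// lnM ?posrE ?invr_gt0//.
rewrite lnV ?posrE// => h1.
move: h2; rewrite -ler_ln ?posrE// => h2.
move: (ln _) (ln _) (ln _) h1 h2 => a b c.
move=> /(ler_wpM2l (ltW kappa0)) h1 /(ler_wpM2l (ltW kappa0)) h2.
by apply/andP; split; lra.
Qed.

End Potential.

(** * Weights on words and invariant measures *)

Section MarkovMeasure.
Context {R : realType} (gs : seq code) (gs_path : is_path gs)
  (gs_complete : complete_path gs).
Implicit Types (u v : seq (rword gs)) (x : 'cV[R]_3).

Lemma itinerary_point (omega : nat -> rword gs) :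
  exists x, forall n, rcyl (mkseq omega n) x.
Proof.
have homega k : return_word gs (val (omega k)) by exact: valP.
have [x [hx hc]] := point_exists (R := R) gs_path gs_complete homega.
have [_ h] := point_return_domain gs_path gs_complete homega hx hc.
by exists x => n; rewrite /rcyl /vals /mkseq -map_comp; exact: h.
Qed.

Lemma rcyl_nonempty u : exists x, rcyl u x.
Proof.
have [w hw] := return_word_exists gs_path.
have [x hx] := itinerary_point (nth (Sub w hw : rword gs) u).
by exists x; have := hx (size u); rewrite mkseq_nth.
Qed.

Lemma rcyl_nil : rcyl ([::] : seq (rword gs)) = return_domain gs :> set 'cV[R]_3.
Proof. by apply/seteqP; split=> x /cylinder_nil. Qed.

Lemma rcyl_preimage v :
  return_domain gs `&` return_map gs @^-1` rcyl v = \bigcup_b rcyl (b :: v) :> set 'cV[R]_3.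
Proof.
apply/seteqP; split=> [x [hx hv]|x [b _ /(cylinder_cons gs_path)[]//]].
have [w _] := return_domain_word gs_path hx.
exists (Sub (return_path gs x) w : rword gs) => //.
by apply/(cylinder_cons gs_path).
Qed.

Lemma rcyl_rcons v : rcyl v = \bigcup_b rcyl (rcons v b) :> set 'cV[R]_3.
Proof.
apply/seteqP; split=> [x hv|x [b _ /rcyl_take-/(_ (size v))]]; last first.
  by rewrite size_rcons leqnSn -cats1 take_size_cat//; exact.
have [u [su hu]] := rcyl_itinerary gs_path (size v).+1 hv.1.
have vu : v = take (size v) u by apply: (rcyl_uniq hv hu); rewrite su.
case/lastP: u su hu vu => // u b; rewrite size_rcons => -[su] hu vu.
by exists b => //; move: vu; rewrite -su -cats1 take_size_cat// => ->.
Qed.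

(** [P] is the law of a point whose itinerary is coded by a uniform [t]. Invariance is its equality
    with the law [P2] of the image under the return map: both give mass [m u] to cylinders, [P2] by
    left consistency. *)
Lemma markov_measure_exists (m : seq (rword gs) -> R) : (forall u, 0 < m u) ->
  m [::] = 1 -> right_consistent m -> left_consistent m ->
  exists P : probability (borelR3 R) R,
    [/\ carried gs P, invariant gs P & forall u, P (rcyl u) = (m u)%:E].
Proof.
move=> m0 m1 mr ml.
have [w0 hw0] := return_word_exists gs_path; pose b0 : rword gs := Sub w0 hw0.
have [p hp] := choice (fun t : R => itinerary_point (coding m b0 t)).
have pX t : return_domain gs (p t) := (hp t 0%N).1.
have I_E := word_intervalE b0 m0 m1 mr.
have pre u : `[0, 1[%classic `&` p @^-1` rcyl u = word_interval m u.
  rewrite I_E; congr (_ `&` _); apply/seteqP; split=> t /=.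
    by move=> hu; apply: rcyl_eq (hp t _) hu _; rewrite size_mkseq.
  by move=> <-; exact: hp.
have mI u : measurable (word_interval m u) by exact: word_interval_measurable.
have mp u : measurable (`[0, 1[%classic `&` p @^-1` rcyl u) by rewrite pre.
have [P hP] := law_exists gs_path gs_complete (f := p) (fun t _ => pX t) mp.
have Pu u : P (rcyl u) = (m u)%:E.
  by rewrite hP pre; exact: word_interval_measure.
have pre2 v : `[0, 1[%classic `&` (return_map gs \o p) @^-1` rcyl v =
    \bigcup_b word_interval m (b :: v).
  have -> : `[0, 1[%classic `&` (return_map gs \o p) @^-1` rcyl v =
     `[0, 1[%classic `&` p @^-1` (return_domain gs `&` return_map gs @^-1` rcyl v).
    by apply/seteqP; split=> t [ht] /=; [|case].
  rewrite rcyl_preimage preimage_bigcup setI_bigcupr.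
  by apply: eq_bigcupr => b _; rewrite pre.
have mU v : measurable (\bigcup_b word_interval m (b :: v)).
  by apply: countable_bigcupT_measurable => //; exact: countableP.
have mp2 v : measurable (`[0, 1[%classic `&` (return_map gs \o p) @^-1` rcyl v).
  by rewrite pre2.
have [P2 hP2] := law_exists gs_path gs_complete (f := return_map gs \o p)
  (fun t _ => return_domain_map gs_path (pX t)) mp2.
have P2u v : P2 (rcyl v) = (m v)%:E.
  rewrite hP2 pre2 measure_countable_bigcup.
  - rewrite -(ml v); apply: eq_esum => b _; exact: word_interval_measure.
  - by move=> b; exact: mI.
  move=> b c t; rewrite !I_E => -[_ /= hb] [_ /= hc].
  by have [] := etrans (esym hb) hc.
exists P; split=> //; first by rewrite /carried -rcyl_nil Pu m1.
move=> A mA.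
have <- : P2 A = P A.
  apply: (borel_measure_unique gs_path gs_complete) => //.
  - by rewrite -rcyl_nil P2u m1.
  - by rewrite -rcyl_nil Pu m1.
  - by move=> u; rewrite P2u Pu.
rewrite hP hP2; congr (lebesgue_measure _).
by apply/seteqP; split=> t [ht] /=; [case|].
Qed.

Section Cylinders.
Context (P : probability (borelR3 R) R) (Pc : carried gs P) (Pi : invariant gs P).

Definition cylinder_mass u : R := fine (P (rcyl u)).

Let mP u : measurable (rcyl u : set (borelR3 R)).
Proof. exact: measurable_cylinder. Qed.

Lemma cylinder_massE u : (cylinder_mass u)%:E = P (rcyl u).
Proof. by rewrite fineK// fin_num_measure. Qed.

Lemma cylinder_mass_nil : cylinder_mass [::] = 1.
Proof. by rewrite /cylinder_mass rcyl_nil Pc. Qed.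

Lemma cylinder_mass_right : right_consistent cylinder_mass.
Proof.
move=> v; rewrite cylinder_massE rcyl_rcons measure_countable_bigcup//.
  by apply: eq_esum => b _; exact: cylinder_massE.
move=> b c x hb hc; have := rcyl_eq hb hc; rewrite !size_rcons => /(_ erefl).
by move=> /rcons_inj[].
Qed.

Lemma cylinder_mass_left : left_consistent cylinder_mass.
Proof.
move=> v; rewrite cylinder_massE -Pi// rcyl_preimage measure_countable_bigcup//.
  by apply: eq_esum => b _; exact: cylinder_massE.
by move=> b c x hb hc; have := rcyl_eq hb hc erefl => -[].
Qed.

End Cylinders.
End MarkovMeasure.

Section GibbsWeights.
Context {R : realType} {T : choiceType}.
Implicit Types (a m r : seq T -> R).

Definition gibbs_weight a m : Prop := exists P K, 0 < K /\ forall u,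
  K^-1 * (a u * expR (- ((size u)%:R * P))) <= m u <=
  K * (a u * expR (- ((size u)%:R * P))).

(** Summed over words of length [n], the bound reads [1 <= c * expR (n%:R * p)], which fails for
    large [n] when [p < 0]. *)
Lemma exponent_ge0 (m r : seq T -> R) (c p : R) : (forall u, 0 <= m u) ->
  (forall u, 0 <= r u) -> m [::] = 1 -> r [::] = 1 ->
  right_consistent m -> right_consistent r ->
  (forall u, m u <= c * (expR ((size u)%:R * p) * r u)) -> 0 <= p.
Proof.
move=> m0 r0 m1 r1 mr rr h.
have c0 : 0 <= c by have := h [::]; rewrite m1 r1 mul0r expR0; lra.
have H n : 1 <= c * expR (n%:R * p).
  have := wsum_right_consistent n [::] m0 mr; rewrite m1 => e.
  have := wsum_right_consistent n [::] r0 rr; rewrite r1 => e'.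
  rewrite -lee_fin -e -[leRHS]mule1 -e' -wsumZ ?mulr_ge0 ?expR_ge0//.
  apply: le_esum => u /= su; rewrite -EFinM lee_fin -su -mulrA; exact: h.
rewrite leNgt; apply/negP => p0.
pose n := (Num.truncn (c / - p)).+1.
have hn : c < n%:R * - p by rewrite -ltr_pdivrMr ?oppr_gt0// truncnS_gt.
have := H n; have := @expR_ge1Dx R (n%:R * - p).
have := expR_gt0 (n%:R * p); rewrite mulrN expRN; rewrite mulrN in hn.
move: (expR _) hn => e hn e0 h1 h2.
have : e^-1 <= c by rewrite -[e^-1]mul1r ler_pdivrMr.
by lra.
Qed.

Lemma gibbs_weights_eq a C m r : (forall u, 0 < a u) -> quasi_multiplicative C a ->
  m [::] = 1 -> r [::] = 1 ->
  right_consistent m -> left_consistent m ->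
  right_consistent r -> left_consistent r ->
  gibbs_weight a m -> gibbs_weight a r -> forall u, r u = m u.
Proof.
move=> a0 qa m1 r1 mr ml rr rl [P [K [K0 hm]]] [P' [K' [K'0 hr]]].
have C0 : 0 < C.
  have [_ h] := qa [::] [::]; rewrite /= in h; have := a0 [::] => h0.
  by rewrite -(pmulr_lgt0 _ h0); apply: lt_le_trans h; exact: mulr_gt0.
have gt0 (f : seq T -> R) L Q : 0 < L ->
    (forall u, L^-1 * (a u * expR (- ((size u)%:R * Q))) <= f u <=
       L * (a u * expR (- ((size u)%:R * Q)))) -> forall u, 0 < f u.
  move=> L0 hf u; have /andP[h _] := hf u; apply: lt_le_trans h.
  by rewrite !mulr_gt0 ?invr_gt0 ?expR_gt0.
have m0 := gt0 _ _ _ K0 hm; have r0 := gt0 _ _ _ K'0 hr.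
(* Eliminating the common weight between two Gibbs bounds leaves the difference of the pressures in
   the exponent; used in both directions, it makes the pressures equal. *)
have exch (f g : seq T -> R) L Q L' Q' u : 0 < L -> 0 < L' ->
    f u <= L * (a u * expR (- ((size u)%:R * Q))) ->
    L'^-1 * (a u * expR (- ((size u)%:R * Q'))) <= g u ->
    f u <= L * L' * (expR ((size u)%:R * (Q' - Q)) * g u).
  move=> L0 L'0 hf hg; apply: le_trans hf _.
  rewrite -mulrA ler_pM2l//.
  have -> : a u * expR (- ((size u)%:R * Q)) = L' * (expR ((size u)%:R * (Q' - Q)) *
      (L'^-1 * (a u * expR (- ((size u)%:R * Q'))))).
    have -> : - ((size u)%:R * Q) = (size u)%:R * (Q' - Q) - (size u)%:R * Q' by ring.
    by rewrite expRD; field; rewrite gt_eqF.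
  by rewrite ler_pM2l// ler_pM2l// expR_gt0.
have PP : P' = P.
  have h1 : 0 <= P - P'.
    apply: (@exponent_ge0 r m (K' * K)) => // [u|u|u]; try exact: ltW.
    by apply: exch => //; [have /andP[] := hr u|have /andP[] := hm u].
  have h2 : 0 <= P' - P.
    apply: (@exponent_ge0 m r (K * K')) => // [u|u|u]; try exact: ltW.
    by apply: exch => //; [have /andP[] := hm u|have /andP[] := hr u].
  by apply/le_anti; rewrite -subr_ge0 h1 -subr_ge0 h2.
(* One constant for both hypotheses of [gibbs_weight_unique]: the first summand bounds the density,
   the second the quasi-independence. *)
pose L := K' * K + K * K * C * K.
have KC : 0 < K * K * C * K by rewrite !mulr_gt0.
have KK : 0 < K' * K by rewrite mulr_gt0.
apply: (@gibbs_weight_unique R T m r L) => //; first exact: addr_gt0.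
- by move=> u; exact: ltW.
- move=> u; apply: le_trans (_ : K' * K * m u <= _); last first.
    by rewrite ler_pM2r// lerDl ltW.
  have /andP[_ h1] := hr u; have /andP[h2 _] := hm u.
  by have := exch _ _ _ _ _ _ _ K'0 K0 h1 h2; rewrite PP subrr mulr0 expR0 mul1r.
- move=> u w; apply: le_trans (_ : K * K * C * K * m (u ++ w) <= _); last first.
    by rewrite ler_pM2r// lerDr ltW.
  have /andP[_ h1] := hm u; have /andP[_ h2] := hm w; have /andP[h3 _] := hm (u ++ w).
  have [_ h4] := qa u w.
  apply: le_trans (ler_pM (ltW (m0 u)) (ltW (m0 w)) h1 h2) _.
  rewrite size_cat natrD mulrDl opprD expRD in h3.
  have e1 := expR_gt0 (- ((size u)%:R * P)); have e2 := expR_gt0 (- ((size w)%:R * P)).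
  move: (expR _) (expR _) e1 e2 h3 => x y x0 y0 h3.
  have -> : K * (a u * y) * (K * (a w * x)) = K * K * (a u * a w * (y * x)) by ring.
  have h5 : a u * a w * (y * x) <= C * a (u ++ w) * (y * x).
    by rewrite ler_pM2r// mulr_gt0.
  have h6 : a (u ++ w) * (y * x) <= K * m (u ++ w) by rewrite -ler_pdivrMl.
  have -> : K * K * C * K * m (u ++ w) = K * K * (C * (K * m (u ++ w))) by ring.
  rewrite ler_pM2l ?mulr_gt0//; apply: le_trans h5 _.
  by rewrite -mulrA ler_pM2l.
Qed.

End GibbsWeights.

Section GibbsMeasures.
Context {R : realType} (gs : seq code) (gs_path : is_path gs)
  (gs_complete : complete_path gs) (kappa : R) (hkappa : 3 < kappa).
Local Notation phi := (fun l : 'cV[R]_3 => - kappa * roof gs l).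
Local Notation a := (@weight R gs kappa).

Let a0 u : 0 < a u. Proof. exact: expR_gt0. Qed.

Let D : R := expR (kappa * ln (pnorm gs)).

Let D1 : 1 <= D.
Proof.
rewrite -expR0 ler_expR mulr_ge0 ?ln_pnorm_ge0//.
by apply/ltW; apply: lt_trans hkappa.
Qed.

Lemma gibbs_measure_weight (m : probability (borelR3 R) R) :
  gibbs_measure gs phi m -> gibbs_weight a (@cylinder_mass R gs m).
Proof.
move=> [mc mi [Q [P [Q1 hQ]]]].
have Q0 : 0 < Q by lra.
have D0 : 0 < D by have := D1; lra.
have A1 : a [::] <= 1.
  rewrite -expR0 ler_expR /= mulNr oppr_le0 mulr_ge0 ?ln_pnorm_ge0//.
  by apply/ltW; apply: lt_trans hkappa.
have QD : 1 <= Q * D by rewrite -[1]mulr1 ler_pM.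
have c0 := a0 [::]; move ec : (a [::]) A1 c0 => c A1 c0.
have Ai : 1 <= c^-1 by rewrite invf_ge1.
(* [Q * D] serves the nonempty words. The Gibbs bounds do not cover the empty word, whose mass 1 is
   compared with [c = a [::]], whence [c^-1]. *)
exists P, (Q * D + c^-1); split; first by lra.
case=> [|b u].
  rewrite ec cylinder_mass_nil//= mul0r oppr0 expR0 mulr1; apply/andP; split.
    rewrite ler_pdivrMl ?mulr1; first by lra.
    by lra.
  by rewrite mulrDl mulVf ?gt_eqF// lerDr mulr_ge0// ltW//; lra.
have [x hx] := rcyl_nonempty (R := R) gs_path gs_complete (b :: u).
have := hQ _ x _ hx; rewrite size_map -/(rcyl (b :: u)) => /(_ isT).
rewrite -(cylinder_massE gs_path) -EFinM !lee_fin expRD expRN => /andP[h1 h2].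
have /andP[b1 b2] := birkhoff_weight gs_path gs_complete hkappa hx.
have s0 := expR_gt0 (birkhoff_sum gs phi (size (b :: u)) x).
rewrite expRN; have e0 := expR_gt0 ((size (b :: u))%:R * P).
have au := a0 (b :: u).
move: (birkhoff_sum _ _ _ _) h1 h2 b1 b2 s0 => S.
rewrite -/D; move: (expR S) (expR (_ * P)) (cylinder_mass _ _) e0 (a _) au.
move=> s e r e0 w w0 h1 h2 b1 b2 s0.
have r2 : r <= Q * s * e^-1.
  have -> : r = r * (s^-1 * e) * (s * e^-1) by field; rewrite !gt_eqF.
  by rewrite -[leRHS]mulrA ler_pM2r// mulr_gt0 ?invr_gt0.
have r1 : Q^-1 * s * e^-1 <= r.
  have -> : r = r * (s^-1 * e) * (s * e^-1) by field; rewrite !gt_eqF.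
  by rewrite -[leLHS]mulrA ler_pM2r// mulr_gt0 ?invr_gt0.
have we : 0 < w * e^-1 by rewrite mulr_gt0 ?invr_gt0.
apply/andP; split.
  apply: le_trans (_ : Q^-1 * (w * e^-1) <= _).
    rewrite ler_pM2r// lef_pV2 ?posrE//; last by lra.
    apply: le_trans (_ : Q * D <= _); last by lra.
    by rewrite ler_peMr// ltW.
  by apply: le_trans r1; rewrite mulrA ler_pM2r ?invr_gt0// ler_pM2l ?invr_gt0.
apply: le_trans r2 _; apply: le_trans (_ : Q * D * (w * e^-1) <= _).
  by rewrite !mulrA ler_pM2r ?invr_gt0// -mulrA ler_pM2l.
by rewrite ler_pM2r//; lra.
Qed.

Lemma gibbs_measure_exists (m : seq (rword gs) -> R) (P K : R) : 0 < K ->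
  m [::] = 1 -> right_consistent m -> left_consistent m ->
  (forall u, K^-1 * (a u * expR (- ((size u)%:R * P))) <= m u <=
             K * (a u * expR (- ((size u)%:R * P)))) ->
  exists mu : probability (borelR3 R) R, gibbs_measure gs phi mu.
Proof.
move=> K0 m1 mr ml hm.
have m0 u : 0 < m u.
  have /andP[h _] := hm u; apply: lt_le_trans h.
  by rewrite !mulr_gt0 ?invr_gt0 ?expR_gt0.
have [mu [mc mi mE]] := markov_measure_exists gs_path gs_complete m0 m1 mr ml.
exists mu; split=> //.
have D0 : 0 < D by have := D1; lra.
have KD : 0 < K * D by rewrite mulr_gt0.
(* The summand 1 secures [1 <= Q]. *)
exists (K * D + 1), P; split; first by lra.
move=> w x _ hx; have [u eu] := vals_surj (cylinder_words gs_path hx).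
rewrite -eu in hx *.
rewrite -/(rcyl u) mE -EFinM !lee_fin expRD expRN size_map.
have := hm u; rewrite expRN.
have /andP[b1 b2] := birkhoff_weight gs_path gs_complete hkappa hx.
have s0 := expR_gt0 (birkhoff_sum gs phi (size u) x).
have e0 := expR_gt0 ((size u)%:R * P); have au := a0 u.
move: (birkhoff_sum _ _ _ _) b1 b2 s0 => S.
rewrite -/D; move: (expR S) (expR (_ * P)) (m u) e0 (a u) au => s e r e0 v v0 b1 b2 s0.
move=> /andP[h1 h2].
have r2 : r * (s^-1 * e) <= K.
  rewrite mulrA -ler_pdivlMr// -ler_pdivlMr ?invr_gt0// invrK.
  apply: le_trans h2 _; rewrite -mulrA ler_pM2l// mulrC.
  by rewrite ler_pM2l ?invr_gt0.
have r1 : (K * D)^-1 <= r * (s^-1 * e).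
  rewrite mulrA -ler_pdivrMr// -ler_pdivrMr ?invr_gt0// invrK.
  apply: le_trans h1; rewrite invfM -!mulrA ler_pM2l//; last by rewrite invr_gt0.
  rewrite [v * _]mulrC mulrCA ler_pM2l ?invr_gt0//.
  by rewrite mulrC ler_pdivrMr// mulrC.
apply/andP; split.
  by apply: le_trans r1; rewrite lef_pV2 ?posrE//; lra.
apply: le_trans r2 _; have : K <= K * D by rewrite ler_peMr// ltW.
by lra.
Qed.

End GibbsMeasures.

Theorem theorem19 (R : realType) (gstar : seq code) (kappa : R)
    (hpath : is_path gstar) (hcomplete : complete_path gstar)
    (hkappa : 3 < kappa) :
  exists m : probability (borelR3 R) R,
    gibbs_measure gstar (fun l => - kappa * roof gstar l) m /\
    forall m' : probability (borelR3 R) R,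
      gibbs_measure gstar (fun l => - kappa * roof gstar l) m' ->
      forall A : set (borelR3 R), measurable A -> m' A = m A.
Proof.
have a0 u : 0 < @weight R gstar kappa u by exact: expR_gt0.
have qa := weight_quasi (R := R) hpath hcomplete hkappa.
have [w0 hw0] := return_word_exists hpath.
have [m0 [P [K [K0 m1 mr ml hm]]]] :=
  gibbs_weight_exists (Sub w0 hw0 : rword gstar) a0 qa (weight_summable hpath hkappa).
have [m hG] := gibbs_measure_exists hpath hcomplete hkappa K0 m1 mr ml hm.
exists m; split=> // m' hG' A mA.
have [mc mi _] := hG; have [mc' mi' _] := hG'.
apply: (borel_measure_unique hpath hcomplete mc' mc _ mA) => u.
rewrite -!(cylinder_massE hpath); congr EFin.
exact: (gibbs_weights_eq a0 qa (cylinder_mass_nil mc) (cylinder_mass_nil mc')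
  (cylinder_mass_right hpath m) (cylinder_mass_left hpath mi)
  (cylinder_mass_right hpath m') (cylinder_mass_left hpath mi')
  (gibbs_measure_weight hpath hcomplete hkappa hG)
  (gibbs_measure_weight hpath hcomplete hkappa hG')).
Qed.
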